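(* Let $I$ be a nonempty set and let $(U_i)_{i\in I}$ and $(\widetilde U_i)_{i\in I}$ be families such that for each $i\in I$, $U_i$ and $\widetilde U_i$ are open nonempty subsets of a Banach space $X_i$ and $U_i$ is convex. Assume that there exists $r>0$ such that $\widetilde U_i+B_{X_i}(0,r)\subseteq U_i$ for all $i\in I$. Let $\mathcal W\subseteq\overline{\mathbb R}^{\bigsqcup_{i\in I}U_i}$ with $1_{\bigsqcup_{i\in I}U_i}\in\mathcal W$, let $\tau\in\,]0,1[$, and put $$\mathcal D^\tau=\Big\{\phi\in\mathcal C^\infty_{\mathcal W}(U_i,X_i)_{i\in I}:\ \|\phi\|_{1_{\bigsqcup_i U_i},1}<\tau\ \text{ and }\ \|\phi\|_{1_{\bigsqcup_i U_i},0}<\tfrac r2(1-\tau)\Big\}.$$ Then the map $$\mathcal D^\tau\to\mathcal C^\infty_{\mathcal W}(\widetilde U_i,X_i)_{i\in I}:\ (\phi_i)_{i\in I}\mapsto\big((\phi_i+\mathrm{id}_{U_i})^{-1}|_{\widetilde U_i}-\mathrm{id}_{\widetilde U_i}\big)_{i\in I}$$ is defined (i.e. each $\phi_i+\mathrm{id}_{U_i}$ is injective with image containing $\widetilde U_i$, and the values lie in the indicated space) and smooth.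
   Context: Conventions. $\mathbb N=\{0,1,2,\dots\}$, $\overline{\mathbb N}=\mathbb N\cup\{\infty\}$, $\overline{\mathbb R}=\mathbb R\cup\{\infty\}$ with $|\infty|=\infty$ and $0\cdot\infty=0$. All spaces are over a fixed $\mathbb K\in\{\mathbb R,\mathbb C\}$. $B_Y(0,r)$ is the open ball of radius $r$ around $0$ in $Y$; $1_S$ is the constant function $1$ on $S$. Weighted functions. For normed spaces $X,Y$, $U\subseteq X$ open nonempty and $k\in\overline{\mathbb N}$, $\mathcal{FC}^k(U,Y)$ is the set of $k$-times continuously Fréchet differentiable maps ($\mathcal{FC}^0$: continuous maps), and $D^{(\ell)}\phi:U\to \mathrm L^\ell(X,Y)$ is the $\ell$-th Fréchet derivative, with values in the continuous $\ell$-linear maps with operator norm ($D^{(0)}\phi=\phi$). For $f:U\to\overline{\mathbb R}$ put $\|\phi\|_{f,\ell}=\sup_{x\in U}|f(x)|\,\|D^{(\ell)}\phi(x)\|_{op}\in[0,\infty]$. For nonempty $\mathcal W\subseteq\overline{\mathbb R}^U$, $\mathcal C^k_{\mathcal W}(U,Y)=\{\gamma\in\mathcal{FC}^k(U,Y):\|\gamma\|_{f,\ell}<\infty\ \forall f\in\mathcal W,\ell\in\mathbb N,\ell\le k\}$, with the locally convex topology given by these seminorms. Weighted restricted products. Given open nonempty $U_i\subseteq X_i$, normed spaces $Y_i$ ($i\in I$) and nonempty $\mathcal W\subseteq\overline{\mathbb R}^{\bigsqcup_i U_i}$ (functions on the disjoint union), put $f_i=f|_{U_i}$ and $\mathcal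 W_i=\{f_i:f\in\mathcal W\}$. Then $\mathcal C^k_{\mathcal W}(U_i,Y_i)_{i\in I}$ is the space of all $(\phi_i)_i\in\prod_i\mathcal C^k_{\mathcal W_i}(U_i,Y_i)$ with $\|(\phi_i)_i\|_{f,\ell}:=\sup_{i\in I}\|\phi_i\|_{f_i,\ell}<\infty$ for all $f\in\mathcal W$, $\ell\in\mathbb N$, $\ell\le k$, with the locally convex topology defined by these seminorms. In $\mathcal C^\infty_{\mathcal W}(\widetilde U_i,X_i)_{i\in I}$ the weights are restricted to $\bigsqcup_i\widetilde U_i$ (note $\widetilde U_i\subseteq U_i$). Differentiability. A map $f:U\to Y$ from an open subset of a locally convex space $X$ to a locally convex space $Y$ is $\mathcal C^1$ if the directional derivatives $df(u;x)=\lim_{t\to0}t^{-1}(f(u+tx)-f(u))$ ($t\in\mathbb K\setminus\{0\}$) exist and $df:U\times X\to Y$ is continuous; $\mathcal C^\ell$ if it is $\mathcal C^1$ and $df$ is $\mathcal C^{\ell-1}$; smooth if $\mathcal C^\ell$ for all $\ell\in\mathbb N$. *)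

(* Defs.v *)
From HB Require Import structures.
From mathcomp Require Import all_boot all_order all_algebra.
From mathcomp Require Import all_classical all_reals all_analysis.
From mathcomp Require Import complex.

Set Implicit Arguments.
Unset Strict Implicit.
Unset Printing Implicit Defensive.

Import Order.TTheory GRing.Theory Num.Theory.
Import numFieldNormedType.Exports.

Local Open Scope classical_set_scope.
Local Open Scope ring_scope.

Variant scalar_kind := RealScalars | ComplexScalars.

Definition scalars (R : realType) (s : scalar_kind) : numFieldType :=
  match s with RealScalars => R | ComplexScalars => R[i] end.

Section Scalars.
Context {R : realType} {s : scalar_kind}.
Local Notation K := (scalars R s).

Definition re : K -> R :=
  match s return scalars R s -> R with
  | RealScalars => fun x => x
  | ComplexScalars => fun z => complex.Re z
  end.

Definition ofR : R -> K :=
  match s return R -> scalars R s with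
  | RealScalars => fun x => x
  | ComplexScalars => fun x => real_complex R x
  end.

(* Norms over K take their values in K; rnorm reads them in R. *)
Definition rnorm {V : normedZmodType K} (x : V) : R := re `|x|.

Lemma ofRK : cancel ofR re.
Proof. by rewrite /ofR /re; case: s. Qed.

Lemma reK (z : K) : 0 <= z -> ofR (re z) = z.
Proof.
rewrite /ofR /re; move: z; case: s => //= z.
by case: z => a b; rewrite lecE /= => /andP[/eqP ->].
Qed.

Lemma ofR_le a b : (ofR a <= ofR b) = (a <= b).
Proof. by rewrite /ofR; case: s => //=; rewrite lecR. Qed.

Lemma ofR_lt a b : (ofR a < ofR b) = (a < b).
Proof. by rewrite /ofR; case: s => //=; rewrite ltcR. Qed.

Lemma ofRM a b : ofR (a * b) = ofR a * ofR b.
Proof. by rewrite /ofR; case: s => //=; rewrite rmorphM. Qed.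

Lemma ofRD a b : ofR (a + b) = ofR a + ofR b.
Proof. by rewrite /ofR; case: s => //=; rewrite rmorphD. Qed.

Lemma ofR0 : ofR 0 = 0.
Proof. by rewrite /ofR; case: s => //=; rewrite rmorph0. Qed.

Lemma ofR1 : ofR 1 = 1.
Proof. by rewrite /ofR; case: s => //=; rewrite rmorph1. Qed.

Lemma rnormE (V : normedZmodType K) (x : V) : ofR (rnorm x) = `|x|.
Proof. by rewrite reK. Qed.

Lemma rnorm_ge0 (V : normedZmodType K) (x : V) : 0 <= rnorm x.
Proof. by rewrite -ofR_le rnormE ofR0. Qed.

Lemma rnormD (V : normedZmodType K) (x y : V) : rnorm (x + y) <= rnorm x + rnorm y.
Proof. by rewrite -ofR_le ofRD !rnormE ler_normD. Qed.

Lemma rnormN (V : normedZmodType K) (x : V) : rnorm (- x) = rnorm x.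
Proof. by rewrite /rnorm normrN. Qed.

Lemma rnorm0 (V : normedZmodType K) : rnorm (0 : V) = 0.
Proof. by rewrite /rnorm normr0 -ofR0 ofRK. Qed.

Lemma rnorm0_eq0 (V : normedZmodType K) (x : V) : rnorm x = 0 -> x = 0.
Proof. by move=> x0; apply/normr0_eq0; rewrite -rnormE x0 ofR0. Qed.

Lemma rnormZ (V : normedModType K) (a : K) (x : V) :
  rnorm (a *: x) = rnorm a * rnorm x.
Proof.
by apply: (can_inj ofRK); rewrite ofRM !rnormE normrZ.
Qed.

Lemma rnormX (a : K) n : rnorm (a ^+ n) = rnorm a ^+ n.
Proof.
apply: (can_inj ofRK); elim: n => [|n ih].
  by rewrite !expr0 rnormE normr1 ofR1.
by rewrite !exprS ofRM -ih !rnormE normrM.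
Qed.

Lemma rnorm_ofR a : 0 <= a -> rnorm (ofR a) = a.
Proof.
by move=> a0; apply: (can_inj ofRK); rewrite rnormE ger0_norm// -ofR0 ofR_le.
Qed.

Lemma nbhs_rnormP (V : normedModType K) (x : V) (A : set V) :
  nbhs x A <-> exists2 e : R, 0 < e & forall y, rnorm (y - x) < e -> A y.
Proof.
rewrite -nbhs_ballE; split=> [[e /= e0 eA]|[e e0 eA]].
  exists (re e); first by rewrite -ofR_lt reK ?ofR0// ltW.
  move=> y xy; apply: eA; rewrite -ball_normE /= distrC -rnormE -(reK (ltW e0)).
  by rewrite ofR_lt.
exists (ofR e) => /=; first by rewrite -ofR0 ofR_lt.
move=> y; rewrite -ball_normE /= distrC -rnormE ofR_lt; exact: eA.
Qed.

End Scalars.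

Section Mlin.
Context {R : realType} {s : scalar_kind}.
Local Notation K := (scalars R s).
Variables (l : nat) (X Y : normedModType K).

Definition multilinear (f : ('I_l -> X) -> Y) : Prop :=
  forall (i : 'I_l) (v : 'I_l -> X), linear (fun x : X => f (dfwith v i x)).

Definition continuous_multilinear (f : ('I_l -> X) -> Y) : Prop :=
  multilinear f /\ continuous (f : {ptws 'I_l -> X} -> Y).

Definition continuous_multilinear_pred : {pred ('I_l -> X) -> Y} :=
  fun f => `[< continuous_multilinear f >].

Record mlin := Mlin {
  mlin_fun :> ('I_l -> X) -> Y ;
  mlin_subproof : continuous_multilinear_pred mlin_fun }.

HB.instance Definition _ := [isSub for mlin_fun].
HB.instance Definition _ := [Choice of mlin by <:].

Lemma mlinP (f : mlin) : continuous_multilinear f.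
Proof. exact/asboolP/mlin_subproof. Qed.

Lemma mlin_ex (f : ('I_l -> X) -> Y) :
  continuous_multilinear f -> exists g : mlin, g = f :> (('I_l -> X) -> Y).
Proof. by move=> /asboolP fP; exists (Mlin fP). Qed.

Fact mlin_submod_closed :
  submod_closed continuous_multilinear_pred.
Proof.
split=> [|a f g]; rewrite ?unfold_in.
  apply/asboolP; split=> [i v a x y|]; first by change ((0 : Y) = a *: 0 + 0); rewrite scaler0 addr0.
  exact: (@cst_continuous {ptws 'I_l -> X} Y 0).
move=> /asboolP[fl fc] /asboolP[gl gc]; apply/asboolP; split.
  move=> i v b x y; rewrite !fctE fl gl !scalerDr !scalerA mulrC !addrA.
  by congr (_ + _); rewrite -!addrA; congr (_ + _); rewrite addrC.
move=> v; apply: (@cvgD K Y {ptws 'I_l -> X} (nbhs v) _ (fun x => a *: f x) g).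
  by apply: cvgZr; exact: fc.
exact: gc.
Qed.

HB.instance Definition _ := GRing.isSubmodClosed.Build K (('I_l -> X) -> Y)
  continuous_multilinear_pred mlin_submod_closed.
HB.instance Definition _ :=
  [SubChoice_isSubLmodule of mlin by <:].

Lemma mlinD (f g : mlin) v : (f + g) v = f v + g v.
Proof. by []. Qed.

Lemma mlinZ a (f : mlin) v : (a *: f) v = a *: f v.
Proof. by []. Qed.

Lemma multilinear0 (f : ('I_l -> X) -> Y) (i : 'I_l) (v : 'I_l -> X) :
  multilinear f -> f (dfwith v i (0 : X)) = 0.
Proof.
move=> fl; have := fl i v 1 0 0; rewrite scaler0 addr0 scale1r.
by move=> /(congr1 (fun z => z - f (dfwith v i (0 : X)))); rewrite subrr addrK.
Qed.

Lemma multilinearZ (f : ('I_l -> X) -> Y) (i : 'I_l) (v : 'I_l -> X) a (x : X) :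
  multilinear f -> f (dfwith v i (a *: x)) = a *: f (dfwith v i x).
Proof.
by move=> fl; have := fl i v a x 0; rewrite addr0 multilinear0// addr0.
Qed.

Lemma multilinear_homo (f : ('I_l -> X) -> Y) a (v : 'I_l -> X) :
  multilinear f -> f (fun i => a *: v i) = a ^+ l *: f v.
Proof.
move=> fl.
have H k : (k <= l)%N ->
    f (fun i : 'I_l => if (i < k)%N then a *: v i else v i) = a ^+ k *: f v.
  elim: k => [|k ih] kl; first by rewrite expr0 scale1r; congr f; apply/funext.
  pose w := fun i : 'I_l => if (i < k)%N then a *: v i else v i.
  pose j := Ordinal kl.
  have -> : (fun i : 'I_l => if (i < k.+1)%N then a *: v i else v i) =
      dfwith w j (a *: v j).
    apply/funext => i; case: dfwithP => [|i' ij]; first by rewrite /= ltnSn.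
    have ik : (i' == k :> nat) = false.
      by apply: contraNF ij => /eqP ik; apply/eqP/val_inj; rewrite /= ik.
    by rewrite /w ltnS leq_eqVlt ik.
  rewrite multilinearZ// exprS -scalerA -(ih (ltnW kl)); congr (_ *: f _).
  apply/funext => i; case: dfwithP => // .
  by rewrite /= ltnn.
rewrite -(H l (leqnn _)); congr f; apply/funext => i.
by rewrite ltn_ord.
Qed.

Lemma nbhs_ptwsP (v : {ptws 'I_l -> X}) (A : set {ptws 'I_l -> X}) :
  nbhs v A <->
  exists2 e : R, 0 < e & forall w, (forall i, rnorm (w i - v i) < e) -> A w.
Proof.
pose F : set_system {ptws 'I_l -> X} := [set A | exists2 e : R, 0 < e &
  forall w, (forall i, rnorm (w i - v i) < e) -> A w].
have FF : Filter F.
  split; first by exists 1.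
    move=> P Q [e e0 eP] [d d0 dQ]; exists (Num.min e d).
      by rewrite lt_min e0.
    by move=> w H; split; [apply: eP|apply: dQ] => i; move: (H i);
      rewrite lt_min => /andP[].
  by move=> P Q PQ [e e0 eP]; exists e => // w /eP /PQ.
split.
- suff: F --> v by apply.
  apply/cvg_sup => i B [V] [[W oW <-] /= Wv] WB.
  have : nbhs (v i) W by apply: open_nbhs_nbhs.
  move=> /nbhs_rnormP[e e0 eW]; exists e => // w H.
  by apply: WB; apply: eW; exact: H.
- move=> [e e0 eA].
  have : nbhs v [set w : {ptws 'I_l -> X} | forall i, rnorm (w i - v i) < e].
    apply: (@filter_forall _ 'I_l (fun i w => rnorm (w i - v i) < e) _
      (nbhs_filter v)) => i.
    have : nbhs (v i) [set y | rnorm (y - v i) < e].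
      by apply/(@nbhs_rnormP R s X); exists e.
    exact: (@proj_continuous 'I_l (fun=> X) i v).
  exact: filterS.
Qed.

Lemma mlin_bounded (f : mlin) : exists M : R,
  forall v, (forall i, rnorm (v i) <= 1) -> rnorm (f v) <= M.
Proof.
have [fl fc] := mlinP f.
have : nbhs (f (fun=> 0)) [set z | rnorm (z - f (fun=> 0)) < 1].
  by apply/(@nbhs_rnormP R s Y); exists 1.
move=> /(fc (fun=> 0)) /nbhs_ptwsP[e e0 He].
pose c : K := ofR (e / 2).
have c_neq0 : c != 0.
  by rewrite -ofR0 (inj_eq (can_inj ofRK)) gt_eqF// divr_gt0.
exists (rnorm (c ^- l) * (1 + rnorm (f (fun=> 0)))) => v v1.
have -> : f v = c ^- l *: f (fun i => c *: v i).
  by rewrite multilinear_homo// scalerA mulVf ?scale1r// expf_neq0.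
rewrite rnormZ ler_wpM2l ?rnorm_ge0//.
rewrite -[X in rnorm X](subrK (f (fun=> 0))) (le_trans (rnormD _ _))//.
rewrite lerD2r ltW//; apply: He => i; rewrite subr0 rnormZ /c.
rewrite rnorm_ofR ?divr_ge0 ?(ltW e0)//.
rewrite (@le_lt_trans _ _ (e / 2))//; last by rewrite gtr_pMr// invf_lt1// ltr1n.
by rewrite ler_piMr// divr_ge0// ltW.
Qed.

(* The norm of a K-normed module is K-valued; that of mlin is ofR of opnorm. *)
Definition opnorm (f : mlin) : R :=
  sup [set rnorm (f v) | v in [set v : 'I_l -> X | forall i, rnorm (v i) <= 1]].

Lemma opnorm_has_sup (f : mlin) : has_sup
  [set rnorm (f v) | v in [set v : 'I_l -> X | forall i, rnorm (v i) <= 1]].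
Proof.
split; first by exists (rnorm (f (fun=> 0))), (fun=> 0) => // i; rewrite rnorm0.
by have [M HM] := mlin_bounded f; exists M => _ [v v1 <-]; exact: HM.
Qed.

Lemma opnorm_ub (f : mlin) v :
  (forall i, rnorm (v i) <= 1) -> rnorm (f v) <= opnorm f.
Proof.
by move=> v1; apply: sup_upper_bound; [exact: opnorm_has_sup|exists v].
Qed.

Lemma opnorm_le (f : mlin) (M : R) :
  (forall v, (forall i, rnorm (v i) <= 1) -> rnorm (f v) <= M) -> opnorm f <= M.
Proof.
move=> H; apply: ge_sup; first by case: (opnorm_has_sup f).
by move=> _ [v v1 <-]; exact: H.
Qed.

Lemma opnorm_homo (f : mlin) v (M : R) : 0 < M ->
  (forall i, rnorm (v i) <= M) -> rnorm (f v) <= M ^+ l * opnorm f.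
Proof.
move=> M0 vM; have [fl _] := mlinP f.
have M_neq0 : (ofR M : K) != 0.
  by rewrite -ofR0 (inj_eq (can_inj ofRK)) gt_eqF.
have -> : f v = (ofR M : K) ^+ l *: f (fun i => (ofR M)^-1 *: v i).
  rewrite -multilinear_homo//; congr (f _); apply/funext => i.
  by rewrite scalerA mulfV// scale1r.
rewrite rnormZ rnormX rnorm_ofR ?(ltW M0)// ler_wpM2l ?exprn_ge0 ?(ltW M0)//.
apply: opnorm_ub => i; rewrite -(ler_pM2l M0) mulr1.
rewrite -{1}(@rnorm_ofR R s M) ?(ltW M0)// -rnormZ scalerA mulfV// scale1r.
exact: vM.
Qed.

Fact opnormD (f g : mlin) : opnorm (f + g) <= opnorm f + opnorm g.
Proof.
apply: opnorm_le => v v1; rewrite mlinD (le_trans (rnormD _ _))//.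
by rewrite lerD// opnorm_ub.
Qed.

Fact opnormZ (a : K) (f : mlin) : opnorm (a *: f) = rnorm a * opnorm f.
Proof.
have H b g : opnorm (b *: g) <= rnorm b * opnorm g.
  apply: opnorm_le => v v1; rewrite mlinZ rnormZ.
  by rewrite ler_wpM2l ?rnorm_ge0// opnorm_ub.
apply/eqP; rewrite eq_le H /=.
have [->|a0] := eqVneq a 0.
  rewrite rnorm0 mul0r.
  apply: le_trans (_ : rnorm ((0 *: f : mlin) (fun=> 0)) <= _).
    exact: rnorm_ge0.
  by apply: opnorm_ub => i; rewrite rnorm0.
have ra : 0 < rnorm a.
  rewrite lt_neqAle rnorm_ge0 andbT eq_sym.
  by apply: contra_neq a0 => /rnorm0_eq0.
rewrite -{1}[f](scale1r) -(mulVf a0) -scalerA.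
rewrite (le_trans (ler_wpM2l (ltW ra) (H _ _)))// mulrA.
have -> : rnorm a * rnorm (a^-1) = 1.
  by apply: (can_inj (@ofRK R s)); rewrite ofRM !rnormE -normrM mulfV// normr1 ofR1.
by rewrite mul1r.
Qed.

Fact opnorm0_eq0 (f : mlin) : opnorm f = 0 -> f = 0.
Proof.
move=> f0; apply/val_inj/funext => v /=; apply: (@rnorm0_eq0 R s).
apply/eqP; rewrite eq_le rnorm_ge0 andbT.
have := @opnorm_homo f v (1 + \sum_i rnorm (v i)); rewrite f0 mulr0; apply.
  by rewrite ltr_wpDr// sumr_ge0// => i _; exact: rnorm_ge0.
move=> i; rewrite (bigD1 i)//= addrCA lerDl addr_ge0// sumr_ge0// => j _.
exact: rnorm_ge0.
Qed.

Fact mlin_normD (f g : mlin) :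
  ofR (opnorm (f + g)) <= ofR (opnorm f) + ofR (opnorm g) :> K.
Proof. by rewrite -ofRD ofR_le opnormD. Qed.

Fact mlin_normZ (a : K) (f : mlin) :
  ofR (opnorm (a *: f)) = `|a| * ofR (opnorm f) :> K.
Proof. by rewrite opnormZ ofRM rnormE. Qed.

Fact mlin_norm0_eq0 (f : mlin) : ofR (opnorm f) = 0 :> K -> f = 0.
Proof. by rewrite -ofR0 => /(can_inj ofRK)/opnorm0_eq0. Qed.

HB.instance Definition _ := Lmodule_isNormed.Build K mlin
  mlin_normD mlin_normZ mlin_norm0_eq0.

Lemma mlin_rnormE (f : mlin) : rnorm f = opnorm f.
Proof. by apply: (can_inj (@ofRK R s)); rewrite rnormE. Qed.

(* Junk value 0 when f is not continuous multilinear. *)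
Definition to_mlin (f : ('I_l -> X) -> Y) : mlin := insubd 0 f.

Lemma to_mlinE f : continuous_multilinear f -> to_mlin f = f :> (_ -> _).
Proof. by move=> fP; rewrite /to_mlin val_insubd ifT//; apply/asboolP. Qed.

End Mlin.

Section IteratedDerivative.
Context {R : realType} {s : scalar_kind}.
Local Notation K := (scalars R s).
Variables (X Y : normedModType K).

Definition mlin_uncurry l (g : X -> mlin l X Y) : mlin l.+1 X Y :=
  to_mlin (fun v => g (v ord0) (fun j => v (lift ord0 j))).

Lemma uncurry_continuous_multilinear l (g : {linear X -> mlin l X Y}) :
  continuous g ->
  continuous_multilinear (fun v => g (v ord0) (fun j => v (lift ord0 j))).
Proof.
move=> gc; split.
  move=> i v a x y; case: (unliftP ord0 i) => [j|] ->.
    have [gl _] := mlinP (g (v ord0)).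
    have E z : (fun k => dfwith v (lift ord0 j) (z : X) (lift ord0 k)) =
        dfwith (fun k => v (lift ord0 k)) j z.
      apply/funext => k; have [->|kj] := eqVneq k j; first by rewrite !dfwithin.
      by rewrite !dfwithout// 1?eq_sym// (inj_eq lift_inj) eq_sym.
    have E0 z : dfwith v (lift ord0 j) (z : X) ord0 = v ord0.
      by rewrite dfwithout// eq_sym neq_lift.
    by rewrite !E !E0; apply: (gl j (fun k => v (lift ord0 k)) a x y).
  have E z : (fun k => dfwith v ord0 (z : X) (lift ord0 k)) =
      (fun k => v (lift ord0 k)).
    by apply/funext => k; rewrite dfwithout// neq_lift.
  by rewrite !E !dfwithin linearD linearZ.
move=> v A /(@nbhs_rnormP R s Y)[e e0 eA].
pose v' : {ptws 'I_l -> X} := fun j => v (lift ord0 j).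
pose M : R := 1 + \sum_i rnorm (v i).
have M0 : 0 < M by rewrite ltr_wpDr// sumr_ge0// => i _; exact: rnorm_ge0.
have Ml0 : 0 < (M + 1) ^+ l by rewrite exprn_gt0// addr_gt0.
have e2 : 0 < e / 2 by rewrite divr_gt0.
have : nbhs (g (v ord0)) [set h | rnorm (h - g (v ord0)) < e / 2 / (M + 1) ^+ l].
  by apply/(@nbhs_rnormP R s (mlin l X Y)); exists (e / 2 / (M + 1) ^+ l) => //; rewrite divr_gt0.
move=> /(gc (v ord0))/(@nbhs_rnormP R s X)[d1 d10 d1P].
have [_ c] := mlinP (g (v ord0)).
have : nbhs (g (v ord0) v') [set z | rnorm (z - g (v ord0) v') < e / 2].
  by apply/(@nbhs_rnormP R s Y); exists (e / 2).
move=> /(c v')/nbhs_ptwsP[d2 d20 d2P].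
apply/nbhs_ptwsP; exists (Num.min 1 (Num.min d1 d2)).
  by rewrite !lt_min ltr01 d10.
move=> w H; apply: eA.
pose w' : {ptws 'I_l -> X} := fun j => w (lift ord0 j).
rewrite -/w' -/v'.
have -> : g (w ord0) w' - g (v ord0) v' =
    (g (w ord0) - g (v ord0)) w' + (g (v ord0) w' - g (v ord0) v').
  by rewrite -[(g (w ord0) - g (v ord0)) w']/(g (w ord0) w' - g (v ord0) w') addrA subrK.
rewrite (le_lt_trans (rnormD _ _))// [e]splitr ltrD//.
  apply: le_lt_trans (@opnorm_homo R s l X Y _ _ (M + 1) _ _) _.
  - by rewrite addr_gt0.
  - move=> i; rewrite -(subrK (v (lift ord0 i)) (w' i)) (le_trans (rnormD _ _))//.
    rewrite addrC lerD//.
      rewrite /M (bigD1 (lift ord0 i))//= addrCA lerDl addr_ge0// sumr_ge0// => j _.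
      exact: rnorm_ge0.
    by rewrite ltW//; have := H (lift ord0 i); rewrite !lt_min => /and3P[].
  - rewrite -ltr_pdivlMl// mulrC -mlin_rnormE; apply: d1P.
    by have := H ord0; rewrite !lt_min => /and3P[].
by apply: d2P => i; have := H (lift ord0 i); rewrite !lt_min => /and3P[].
Qed.

(* iterD l phi x is the l-th Frechet derivative D^(l) phi(x), a continuous
   l-linear map; the direction of the last differentiation is its first
   argument.  For x in an open set U it depends only on the restriction of phi
   to U, so a map on U may be given by any extension of it to X. *)
Fixpoint iterD (l : nat) (phi : X -> Y) : X -> mlin l X Y :=
  match l with
  | 0 => fun x => to_mlin (fun=> phi x)
  | l'.+1 => fun x => mlin_uncurry ('d (iterD l' phi) x)
  end.

Lemma iterD0E phi x v : iterD 0 phi x v = phi x.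
Proof.
rewrite /= to_mlinE//; split; first by case.
exact: (@cst_continuous {ptws 'I_0 -> X} Y).
Qed.

Lemma iterDSE l phi x v : differentiable (iterD l phi) x ->
  iterD l.+1 phi x v = 'd (iterD l phi) x (v ord0) (fun j => v (lift ord0 j)).
Proof.
move=> dphi; rewrite /= /mlin_uncurry to_mlinE//.
exact/uncurry_continuous_multilinear/diff_continuous.
Qed.

Definition FC (k : nat) (U : set X) (phi : X -> Y) : Prop :=
  (forall l x, (l < k)%N -> U x -> differentiable (iterD l phi) x) /\
  (forall l x, (l <= k)%N -> U x -> {for x, continuous (iterD l phi)}).

Definition FCoo (U : set X) (phi : X -> Y) : Prop := forall k, FC k U phi.

Lemma FCooP U phi :
  FCoo U phi <-> forall l x, U x -> differentiable (iterD l phi) x.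
Proof.
split=> [H l x Ux|H k]; first by have [+ _] := H l.+1; apply.
split=> l x _ Ux; first exact: H.
exact/differentiable_continuous/H.
Qed.

Lemma near_diff (V W : normedModType K) (f g : V -> W) (x : V) :
  (\forall y \near x, f y = g y) -> differentiable f x ->
  differentiable g x /\ 'd g x = 'd f x :> (V -> W).
Proof.
move=> fg df.
have gE : g \o shift x = cst (g x) + 'd f x +o_ 0 id.
  apply/eqaddoP => _/posnumP[e].
  have /eqaddoP/(_ e%:num) := diff_locally df.
  move=> /(_ [gt0 of e%:num]).
  have : \forall h \near (0 : V), f (h + x) = g (h + x).
    by move: fg; rewrite (near_shift 0) subr0.
  apply: filterS2 => h E.
  have -> : (f \o shift x - (cst (f x) + 'd f x)) h =
      f (h + x) - (f x + 'd f x h) by [].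
  have -> : (g \o shift x - (cst (g x) + 'd f x)) h =
      g (h + x) - (g x + 'd f x h) by [].
  by rewrite E (nbhs_singleton fg).
have dg : 'd g x = 'd f x :> (V -> W).
  by apply: diff_unique gE; exact: diff_continuous.
by split=> //; apply/diff_locallyP; rewrite dg; split=> //; exact: diff_continuous.
Qed.

Lemma iterD_lin U phi psi (a : K) : open U -> FCoo U phi -> FCoo U psi ->
  forall l x, U x ->
    iterD l (a *: phi + psi) x = a *: iterD l phi x + iterD l psi x /\
    differentiable (iterD l (a *: phi + psi)) x.
Proof.
move=> oU /FCooP dphi /FCooP dpsi.
have step l : (forall x, U x ->
    iterD l (a *: phi + psi) x = a *: iterD l phi x + iterD l psi x) ->
  forall x, U x -> differentiable (iterD l (a *: phi + psi)) x /\
    'd (iterD l (a *: phi + psi)) x = a *: ('d (iterD l phi) x : X -> _) + 'd (iterD l psi) x :> (X -> _).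
  move=> ih x Ux.
  have H : \forall y \near x,
      (a *: iterD l phi + iterD l psi) y = iterD l (a *: phi + psi) y.
    have : nbhs x U by exact: open_nbhs_nbhs.
    by apply: filterS => y /ih ->.
  have d1 := dphi l x Ux; have d2 := dpsi l x Ux.
  have d3 : differentiable (a *: iterD l phi) x by exact: differentiableZ.
  have [dd dE] := near_diff H (differentiableD d3 d2).
  split; first exact: dd.
  apply: (etrans dE); apply: (etrans (diffD d3 d2)).
  by apply/funext => y; apply: (congr1 (fun z => z + _) (congr1 (fun h => h y) (diffZ a d1))).
suff main l x : U x ->
    iterD l (a *: phi + psi) x = a *: iterD l phi x + iterD l psi x.
  by move=> l x Ux; split; [exact: main|have [] := step l (main l) x Ux].
elim: l x => [|l ih] x Ux; apply/val_inj/funext => v.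
  change (iterD 0 (a *: phi + psi) x v = a *: iterD 0 phi x v + iterD 0 psi x v).
  by rewrite !iterD0E.
have [dd dE] := step l ih x Ux.
change (iterD l.+1 (a *: phi + psi) x v =
  a *: iterD l.+1 phi x v + iterD l.+1 psi x v).
apply: (etrans (iterDSE v dd)).
pose v' := fun j => v (lift ord0 j).
apply: (etrans (congr1 (fun h : X -> mlin l X Y => h (v ord0) v') dE)).
apply: (congr2 (fun y z : Y => a *: y + z)).
  exact: (esym (iterDSE v (dphi l x Ux))).
exact: (esym (iterDSE v (dpsi l x Ux))).
Qed.

Lemma FCoo_lin U phi psi (a : K) : open U -> FCoo U phi -> FCoo U psi ->
  FCoo U (a *: phi + psi).
Proof. by move=> oU dphi dpsi; apply/FCooP => l x /(iterD_lin a oU dphi dpsi l)[]. Qed.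

Lemma iterD_cst0 l : iterD l (0 : X -> Y) = 0.
Proof.
elim: l => [|l ih]; apply/funext => x; apply/val_inj/funext => v.
  by change (iterD 0 0 x v = 0); rewrite iterD0E.
change (iterD l.+1 0 x v = 0).
rewrite iterDSE ih; last exact: (@differentiable_cst _ X).
by rewrite (@diff_cst K X).
Qed.

Lemma FCoo0 U : FCoo U (0 : X -> Y).
Proof.
by apply/FCooP => l x _; rewrite iterD_cst0; exact: (@differentiable_cst _ X).
Qed.

End IteratedDerivative.

Section SeminormTopology.
Context {R : realType} {s : scalar_kind}.
Local Notation K := (scalars R s).
Variables (E : lmodType K) (J : Type) (p : J -> E -> R).

Definition semi_ball (x : E) (F : seq J) (e : R) : set E :=
  [set y | all (fun j => p j (y - x) < e) F].

(* Neighborhoods in the topology generated by the seminorms p j. *)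
Definition semi_nbhs (x : E) : set_system E :=
  [set A | exists F, exists2 e : R, 0 < e & semi_ball x F e `<=` A].

Hypothesis pD : forall j x y, p j (x + y) <= p j x + p j y.
Hypothesis pZ : forall j (a : K) x, p j (a *: x) <= rnorm a * p j x.
Hypothesis p_ge0 : forall j x, 0 <= p j x.

Lemma semi0 j : p j 0 = 0.
Proof.
apply/eqP; rewrite eq_le p_ge0 andbT.
by rewrite -(scale0r 0) (le_trans (pZ _ _ _))// rnorm0 mul0r.
Qed.

Lemma semi_ballxx x F e : 0 < e -> semi_ball x F e x.
Proof.
move=> e0; rewrite /semi_ball /= subrr (@eq_all _ _ predT) ?all_predT// => j.
by rewrite semi0 e0.
Qed.

Lemma semi_nbhs_singleton x A : semi_nbhs x A -> A x.
Proof. by move=> [F [e e0]]; apply; exact: semi_ballxx. Qed.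

Lemma semi_nbhs_filter x : ProperFilter (semi_nbhs x).
Proof.
split; first by move=> /semi_nbhs_singleton.
split; first by exists [::], 1.
  move=> A B [F [e e0 FA]] [G [d d0 GB]]; exists (F ++ G), (Num.min e d).
    by rewrite lt_min e0.
  move=> y; rewrite /semi_ball /= all_cat => /andP[yF yG]; split.
    by apply: FA; apply: sub_all yF => j; rewrite lt_min => /andP[].
  by apply: GB; apply: sub_all yG => j; rewrite lt_min => /andP[].
by move=> A B AB [F [e e0 FA]]; exists F, e => // y /FA/AB.
Qed.

Lemma semi_nbhs1 x y j e : p j (y - x) < e ->
  semi_nbhs y [set z | p j (z - x) < e].
Proof.
move=> yx; exists [:: j], (e - p j (y - x)); first by rewrite subr_gt0.
move=> z; rewrite /semi_ball /= andbT ltrBrDr => zy.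
by rewrite -(subrK y z) -addrA (le_lt_trans (pD _ _ _)).
Qed.

Lemma semi_filter_ball (F : set_system E) (x : E) (G : seq J) e : Filter F ->
  (forall j, F [set y | p j (y - x) < e]) -> F (semi_ball x G e).
Proof.
move=> FF H; elim: G => [|j G ih].
  by apply: filterS filterT => y _; rewrite /semi_ball.
by apply: filterS2 (H j) ih => y yj yG; rewrite /semi_ball /= yj.
Qed.

Lemma semi_nbhs_nbhs x A : semi_nbhs x A -> semi_nbhs x (semi_nbhs^~ A).
Proof.
move=> [F [e e0 FA]]; exists F, e => // y.
elim: F A FA => [|j F ih] A FA yF.
  by exists [::], 1 => // z _; exact: FA.
have FFy := semi_nbhs_filter y.
move: yF; rewrite /semi_ball /= => /andP[yj yF].
have := ih _ (fun z => id) yF.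
have := semi_nbhs1 yj.
apply: filterS2 => z zj zF; apply: FA.
by rewrite /semi_ball /= (zj : p j (z - x) < e).
Qed.

End SeminormTopology.

Section SeminormTvs.
Context {R : realType} {s : scalar_kind}.
Local Notation K := (scalars R s).
Variables (E : preTopologicalLmodType K) (J : Type) (p : J -> E -> R).
Hypothesis pD : forall j x y, p j (x + y) <= p j x + p j y.
Hypothesis pZ : forall j (a : K) x, p j (a *: x) <= rnorm a * p j x.
Hypothesis p_ge0 : forall j x, 0 <= p j x.
Hypothesis nbhsE : forall x, nbhs x = semi_nbhs p x.

Let semi_cvg (F : set_system E) (x : E) : Filter F ->
  (forall j e, 0 < e -> F [set y | p j (y - x) < e]) -> F --> x.
Proof.
move=> FF H A; rewrite nbhs_simpl nbhsE => -[G [e e0 GA]].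
by apply: filterS GA _; apply: semi_filter_ball => j; exact: H.
Qed.

Let nbhs1 x j e : 0 < e -> nbhs x [set z | p j (z - x) < e].
Proof. by move=> e0; rewrite nbhsE; apply: semi_nbhs1; rewrite // subrr semi0. Qed.

Lemma semi_add_continuous : continuous (fun x : E * E => x.1 + x.2).
Proof.
move=> [x y]; apply: semi_cvg => j e e0 /=.
exists ([set z | p j (z - x) < e / 2], [set z | p j (z - y) < e / 2]).
  by split; apply: nbhs1; rewrite divr_gt0.
move=> [a b] /= [ax bY]; rewrite opprD addrACA (le_lt_trans (pD _ _ _))//.
by rewrite [e]splitr ltrD.
Qed.

Lemma semi_scale_continuous : continuous (fun z : K^o * E => z.1 *: z.2).
Proof.
move=> [a x]; apply: semi_cvg => j e e0 /=.
pose M := 1 + p j x; have M0 : 0 < M by rewrite ltr_pwDl.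
pose N := 1 + rnorm a; have N0 : 0 < N by rewrite ltr_pwDl// rnorm_ge0.
exists ([set b : K^o | rnorm (b - a) < Num.min 1 (e / 2 / M)],
  [set y | p j (y - x) < e / 2 / N]).
  split; last by apply: nbhs1; rewrite !divr_gt0.
  apply/(@nbhs_rnormP R s K^o); exists (Num.min 1 (e / 2 / M)) => //.
  by rewrite lt_min ltr01 !divr_gt0.
move=> [b y] /= []; rewrite lt_min => /andP[b1 ba] yx.
have -> : b *: y - a *: x = b *: (y - x) + (b - a) *: x.
  by rewrite scalerBr scalerBl addrA subrK.
rewrite (le_lt_trans (pD _ _ _))// [e]splitr ltr_leD//.
  rewrite (le_lt_trans (pZ _ _ _))//.
  rewrite (@le_lt_trans _ _ (N * p j (y - x)))//.
    rewrite ler_wpM2r// -(subrK a b) (le_trans (rnormD _ _))//.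
    by rewrite lerD2r ltW.
  by rewrite -ltr_pdivlMl// mulrC.
rewrite (le_trans (pZ _ _ _))//.
rewrite (@le_trans _ _ (rnorm (b - a) * M))//.
  by rewrite ler_wpM2l ?rnorm_ge0// lerDr.
by rewrite -ler_pdivlMr// ltW.
Qed.

Lemma semi_locally_convex :
  exists2 B : set_system E, (forall b, b \in B -> convex_set b) & basis B.
Proof.
exists [set A | open A /\ convex_set A]; first by move=> b; rewrite inE => -[].
split; first by move=> A [].
move=> x A; rewrite nbhsE => -[F [e e0 FA]].
exists (semi_ball p x F e) => //; split; last exact: semi_ballxx.
have o1 j : open [set y | p j (y - x) < e].
  by rewrite openE => y yx; rewrite /interior nbhsE; exact: semi_nbhs1.
have c1 j : convex_set [set y | p j (y - x) < e].
  move=> y z k; rewrite !inE /= => yx zx.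
  have -> : (conv k y z : E) - x = k%:num *: (y - x : E) + (1 - k%:num) *: (z - x : E).
    rewrite !scalerBr addrACA -opprD -scalerDl addrC.
    by rewrite [k%:num + _]addrC subrK scale1r addrC.
  have k0 : 0 <= k%:num by []. 
  have k1 : 0 <= 1 - k%:num by rewrite subr_ge0.
  have kk : rnorm (k%:num : K) + rnorm (1 - k%:num : K) = 1.
    apply: (can_inj (@ofRK R s)); rewrite ofRD !rnormE !ger0_norm// ofR1.
    by rewrite addrC subrK.
  rewrite (le_lt_trans (pD _ _ _))//.
  rewrite (le_lt_trans (lerD (pZ _ _ _) (pZ _ _ _)))//.
  pose m := Num.max (p j (y - x)) (p j (z - x)).
  have me : m < e by rewrite gt_max yx.
  apply: le_lt_trans me; rewrite -[leRHS]mul1r -kk mulrDl.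
  by rewrite lerD// ler_wpM2l ?rnorm_ge0// le_max lexx ?orbT.
elim: F {FA} => [|j F [ihO ihC]].
  have -> : semi_ball p x [::] e = setT by apply/seteqP; split.
  by split; [exact: openT|move=> y z k _ _; rewrite inE].
have -> : semi_ball p x (j :: F) e =
    [set y | p j (y - x) < e] `&` semi_ball p x F e.
  by apply/seteqP; split => y; rewrite /semi_ball /= => /andP.
split; first exact: openI.
move=> y z k; rewrite !inE => -[y1 y2] [z1 z2]; split.
  by apply/set_mem/c1; rewrite inE.
by apply/set_mem/ihC; rewrite inE.
Qed.

End SeminormTvs.

Section WeightedSpaces.
Context {R : realType} {s : scalar_kind}.
Local Notation K := (scalars R s).

Record domain (X : normedModType K) := Domain {
  dom :> set X ;
  dom_open : open dom ;
  dom_neq0 : dom !=set0 }.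

Definition weight_norm (X Y : normedModType K) (U : set X) (f : X -> \bar R)
    (l : nat) (phi : X -> Y) : \bar R :=
  ereal_sup [set (`|f x| * (rnorm (iterD l phi x))%:E)%E | x in U].

Definition weighted (X Y : normedModType K) (U : set X)
    (W : set (X -> \bar R)) (phi : X -> Y) : Prop :=
  FCoo U phi /\ forall f l, W f -> (weight_norm U f l phi < +oo)%E.

(* A wrapper carrying the pointwise module structure. *)
Definition family (I : Type) (X Y : I -> normedModType K) := forall i, X i -> Y i.

Section Family.
Variables (I : Type) (X Y : I -> normedModType K).
Local Notation fam := (family X Y).

HB.instance Definition _ := gen_eqMixin fam.
HB.instance Definition _ := gen_choiceMixin fam.

Let famD (phi psi : fam) : fam := fun i => phi i + psi i.
Let famN (phi : fam) : fam := fun i => - phi i.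
Let famZ (a : K) (phi : fam) : fam := fun i => a *: phi i.
Let fam0 : fam := fun i => 0.

Let famDA : associative famD.
Proof. by move=> f g h; apply: functional_extensionality_dep => i; exact: addrA. Qed.
Let famDC : commutative famD.
Proof. by move=> f g; apply: functional_extensionality_dep => i; exact: addrC. Qed.
Let fam0D : left_id fam0 famD.
Proof. by move=> f; apply: functional_extensionality_dep => i; exact: add0r. Qed.
Let famND : left_inverse fam0 famN famD.
Proof. by move=> f; apply: functional_extensionality_dep => i; exact: addNr. Qed.

HB.instance Definition _ := GRing.isZmodule.Build fam famDA famDC fam0D famND.

Let famZA a b phi : famZ a (famZ b phi) = famZ (a * b) phi.
Proof. by apply: functional_extensionality_dep => i; exact: scalerA. Qed.
Let fam1Z : left_id 1 famZ.
Proof. by move=> f; apply: functional_extensionality_dep => i; exact: scale1r. Qed.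
Let famZDr : right_distributive famZ +%R.
Proof. by move=> a f g; apply: functional_extensionality_dep => i; exact: scalerDr. Qed.
Let famZDl phi : {morph famZ^~ phi : a b / a + b}.
Proof. by move=> a b; apply: functional_extensionality_dep => i; exact: scalerDl. Qed.

HB.instance Definition _ :=
  GRing.Zmodule_isLmodule.Build K fam famZA fam1Z famZDr famZDl.

Lemma famDE (phi psi : fam) i : (phi + psi) i = phi i + psi i. Proof. by []. Qed.
Lemma famZE a (phi : fam) i : (a *: phi) i = a *: phi i. Proof. by []. Qed.
Lemma fam0E i : (0 : fam) i = 0. Proof. by []. Qed.

End Family.

Section WeightedProduct.
Variables (I : Type) (X Y : I -> normedModType K) (U : forall i, domain (X i)).
Variable W : set (forall i, X i -> \bar R).
Local Notation fam := (family X Y).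

Definition prod_norm (f : forall i, X i -> \bar R) (l : nat) (phi : fam) : \bar R :=
  ereal_sup [set weight_norm (U i) (f i) l (phi i) | i in [set: I]].

(* phi i, a map on U i, is represented by its extension by 0 to X i, so that
   equality in wprod is equality of maps on the U i.  Weights on the disjoint
   union of the U i are likewise given as functions on all the X i of which only
   the values on the U i matter; the same W read over smaller domains is thus
   the set of restricted weights. *)
Definition weighted_family (phi : fam) : Prop :=
  [/\ forall i x, ~ dom (U i) x -> phi i x = 0,
      forall i, weighted (U i) [set f i | f in W] (phi i) &
      forall f l, W f -> (prod_norm f l phi < +oo)%E].

Definition weighted_family_pred : {pred fam} := fun phi => `[< weighted_family phi >].

Record wprod := WProd {
  wprod_fun :> forall i, X i -> Y i ;
  wprod_subproof : weighted_family_pred wprod_fun }.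

HB.instance Definition _ := [isSub for (wprod_fun : wprod -> fam)].
HB.instance Definition _ := [Choice of wprod by <:].

Lemma wprodP (phi : wprod) : weighted_family phi.
Proof. exact/asboolP/wprod_subproof. Qed.

Lemma wprod_ex (phi : fam) :
  weighted_family phi -> exists psi : wprod, psi = phi :> fam.
Proof. by move=> /asboolP phiP; exists (WProd phiP). Qed.

Lemma prod_norm_ub f l (phi : fam) i x : dom (U i) x ->
  (`|f i x| * (rnorm (iterD l (phi i) x))%:E <= prod_norm f l phi)%E.
Proof.
move=> Ux; apply: (@le_trans _ _ (weight_norm (U i) (f i) l (phi i))).
  by apply: ereal_sup_ubound; exists x.
by apply: ereal_sup_ubound; exists i.
Qed.

Lemma prod_norm_le f l (phi : fam) M :
  (forall i x, dom (U i) x ->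
    (`|f i x| * (rnorm (iterD l (phi i) x))%:E <= M)%E) ->
  (prod_norm f l phi <= M)%E.
Proof.
move=> H; apply: ge_ereal_sup => _ [i _ <-].
by apply: ge_ereal_sup => _ [x Ux <-]; exact: H.
Qed.

Lemma prod_norm_lin f l (phi psi : fam) (a : K) (A B : \bar R) :
  (forall i, FCoo (U i) (phi i)) -> (forall i, FCoo (U i) (psi i)) ->
  (0 <= A)%E -> (0 <= B)%E ->
  (prod_norm f l phi <= A)%E -> (prod_norm f l psi <= B)%E ->
  (prod_norm f l (a *: phi + psi)%R <= (rnorm a)%:E * A + B)%E.
Proof.
move=> dphi dpsi A0 B0 HA HB; apply: prod_norm_le => i x Ux.
rewrite famDE famZE.
have [-> _] := iterD_lin a (@dom_open _ (U i)) (dphi i) (dpsi i) l Ux.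
apply: (@le_trans _ _ (`|f i x| *
  ((rnorm a)%:E * (rnorm (iterD l (phi i) x))%:E + (rnorm (iterD l (psi i) x))%:E))%E).
  apply: lee_wpmul2l => //; rewrite -EFinM -EFinD lee_fin.
  by rewrite (le_trans (rnormD _ _))// rnormZ.
rewrite ge0_muleDr ?lee_fin ?mulr_ge0 ?rnorm_ge0//.
rewrite leeD//.
  rewrite muleCA lee_wpmul2l ?lee_fin ?rnorm_ge0//.
  exact: le_trans (prod_norm_ub _ _ _ Ux) HA.
exact: le_trans (prod_norm_ub _ _ _ Ux) HB.
Qed.

Lemma weight_le_prod f l (phi : fam) i :
  (weight_norm (U i) (f i) l (phi i) <= prod_norm f l phi)%E.
Proof. by apply: ereal_sup_ubound; exists i. Qed.

Fact wprod_submod_closed : submod_closed weighted_family_pred.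
Proof.
split=> [|a phi psi]; rewrite ?unfold_in.
  have H f l : (prod_norm f l 0%R <= 0)%E.
    apply: prod_norm_le => i x _; rewrite fam0E iterD_cst0.
    by rewrite [X in rnorm X](_ : _ = 0)// rnorm0 mule0.
  apply/asboolP; split => // [i|f l _].
    split; first exact: FCoo0.
    move=> _ l [f Wf <-]; apply: le_lt_trans (ltry 0).
    exact: le_trans (weight_le_prod _ _ _ _) (H f l).
  by apply: le_lt_trans (ltry 0); exact: H.
move=> /asboolP[phi0 phiW phiB] /asboolP[psi0 psiW psiB].
have H f l : W f -> (prod_norm f l (a *: phi + psi)%R < +oo)%E.
  move=> Wf; pose A := Order.max (0 : \bar R)%E (prod_norm f l phi).
  pose B := Order.max (0 : \bar R)%E (prod_norm f l psi).
  have A0 : (0 <= A)%E by rewrite le_max lexx.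
  have B0 : (0 <= B)%E by rewrite le_max lexx.
  have Aoo : (A < +oo)%E by rewrite gt_max ltry phiB.
  have Boo : (B < +oo)%E by rewrite gt_max ltry psiB.
  apply: (@le_lt_trans _ _ ((rnorm a)%:E * A + B)%E).
    apply: prod_norm_lin => //; rewrite ?le_max ?lexx ?orbT// => i.
      by have [] := phiW i.
    by have [] := psiW i.
  by rewrite lte_add_pinfty// lte_mul_pinfty// lee_fin rnorm_ge0.
apply/asboolP; split=> // [i x Ux|i].
  by rewrite famDE famZE !fctE phi0// psi0// scaler0 addr0.
have [dphi _] := phiW i; have [dpsi _] := psiW i.
split; first by apply: FCoo_lin => //; exact: dom_open.
move=> _ l [f Wf <-]; exact: le_lt_trans (weight_le_prod _ _ _ _) (H f l Wf).
Qed.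

HB.instance Definition _ := GRing.isSubmodClosed.Build K fam
  weighted_family_pred wprod_submod_closed.
HB.instance Definition _ := [SubChoice_isSubLmodule of wprod by <:].

Definition wseminorm (j : {f | W f} * nat) (phi : wprod) : R :=
  fine (prod_norm (sval j.1) j.2 phi).

Let wprod_FC (phi : wprod) i : FCoo (U i) (phi i).
Proof. by have [_ /(_ i)[]] := wprodP phi. Qed.

Fact wseminorm_ge0 j phi : 0 <= wseminorm j phi.
Proof.
rewrite /wseminorm; have [[i _]|I0] := pselect (exists i : I, True).
  have [x Ux] := dom_neq0 (U i).
  apply: fine_ge0; apply: le_trans (prod_norm_ub _ _ _ Ux).
  by rewrite mule_ge0// lee_fin rnorm_ge0.
suff -> : prod_norm (sval j.1) j.2 phi = -oo%E by [].
apply/eqP; rewrite -leeNy_eq; apply: prod_norm_le => i.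
by exfalso; apply: I0; exists i.
Qed.

Lemma wseminorm_ub j (phi : wprod) : (prod_norm (sval j.1) j.2 phi <= (wseminorm j phi)%:E)%E.
Proof.
have [_ _ /(_ _ j.2 (svalP j.1))] := wprodP phi.
rewrite /wseminorm; case: (prod_norm _ _ _) => //= _.
by rewrite leNye.
Qed.

Lemma wseminorm_le j (phi : wprod) M : 0 <= M ->
  (prod_norm (sval j.1) j.2 phi <= M%:E)%E -> wseminorm j phi <= M.
Proof. by rewrite /wseminorm; case: (prod_norm _ _ _). Qed.

Let wseminorm_lin j a phi psi :
  wseminorm j (a *: phi + psi) <= rnorm a * wseminorm j phi + wseminorm j psi.
Proof.
apply: wseminorm_le.
  by rewrite addr_ge0 ?mulr_ge0 ?rnorm_ge0 ?wseminorm_ge0.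
rewrite EFinD EFinM; apply: (@prod_norm_lin _ _ phi psi) => //.
- by rewrite lee_fin wseminorm_ge0.
- by rewrite lee_fin wseminorm_ge0.
- exact: wseminorm_ub.
- exact: wseminorm_ub.
Qed.

Let rnorm1 : rnorm (1 : K) = 1.
Proof. by rewrite -[1 in LHS]ofR1 rnorm_ofR. Qed.

Fact wseminormD j phi psi :
  wseminorm j (phi + psi) <= wseminorm j phi + wseminorm j psi.
Proof. by have := wseminorm_lin j 1 phi psi; rewrite scale1r rnorm1 mul1r. Qed.

Let wseminorm0 j : wseminorm j 0 = 0.
Proof.
apply/eqP; rewrite eq_le wseminorm_ge0 andbT; apply: wseminorm_le => //.
apply: prod_norm_le => i x _; change ((0 : wprod) i) with (0 : X i -> Y i).
by rewrite iterD_cst0 [X in rnorm X](_ : _ = 0)// rnorm0 mule0.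
Qed.

Fact wseminormZ j (a : K) phi : wseminorm j (a *: phi) <= rnorm a * wseminorm j phi.
Proof.
by have := wseminorm_lin j a phi 0; rewrite addr0 wseminorm0 addr0.
Qed.

Definition wprod_nbhs : wprod -> set_system wprod := semi_nbhs wseminorm.

HB.instance Definition _ := hasNbhs.Build wprod wprod_nbhs.
HB.instance Definition _ := Nbhs_isNbhsTopological.Build wprod
  (semi_nbhs_filter wseminormZ wseminorm_ge0)
  (@semi_nbhs_singleton _ _ _ _ _ wseminormZ wseminorm_ge0)
  (semi_nbhs_nbhs wseminormD wseminormZ wseminorm_ge0).
(* In this version of the library the factory only provides the uniformity. *)
HB.instance Definition _ := PreTopologicalLmod_isTvs.Build K wprod
  (semi_add_continuous wseminormD wseminormZ wseminorm_ge0 (fun=> erefl))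
  (semi_scale_continuous wseminormD wseminormZ wseminorm_ge0 (fun=> erefl))
  (semi_locally_convex wseminormD wseminormZ wseminorm_ge0 (fun=> erefl)).
HB.instance Definition _ := PreTopologicalNmodule_isTopologicalNmodule.Build wprod
  (semi_add_continuous wseminormD wseminormZ wseminorm_ge0 (fun=> erefl)).
HB.instance Definition _ := TopologicalNmodule_isTopologicalLmodule.Build K wprod
  (semi_scale_continuous wseminormD wseminormZ wseminorm_ge0 (fun=> erefl)).
HB.instance Definition _ := Uniform_isTvs.Build K wprod
  (semi_locally_convex wseminormD wseminormZ wseminorm_ge0 (fun=> erefl)).

End WeightedProduct.
End WeightedSpaces.

Section Calculus.
Context {K : numFieldType}.

(* C^l maps in the sense of Bastiani (Michal, Keller C^l_c) on A, for A open.
   f and df are total; only the values of f on A and of df on A * E matter. *)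
Fixpoint diffC (l : nat) (E F : tvsType K) (A : set E) (f : E -> F) : Prop :=
  match l with
  | 0 => {within A, continuous f}
  | l'.+1 => exists df : E * E -> F,
      [/\ forall u x, A u ->
            (fun t : K => t^-1 *: (f (u + t *: x) - f u)) @ 0^' --> df (u, x),
          {within A `*` setT, continuous df} &
          @diffC l' (E * E)%type F (A `*` setT) df]
  end.

Definition smooth (E F : tvsType K) (A : set E) (f : E -> F) : Prop :=
  open A /\ forall l, diffC l A f.

End Calculus.

(* Main.v *)
From HB Require Import structures.
Require Import Defs.
From mathcomp Require Import all_boot all_order all_algebra.
From mathcomp Require Import all_classical all_reals all_analysis.
From mathcomp Require Import ring lra.

Set Implicit Arguments.
Unset Strict Implicit.
Unset Printing Implicit Defensive.

Import Order.TTheory GRing.Theory Num.Theory.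
Import numFieldNormedType.Exports Defs.

Local Open Scope classical_set_scope.
Local Open Scope ring_scope.

(* With chi = - phi, the inverse of id + phi is sigma y = y + chi (sigma y), so
   that sigma - id = chi o sigma.  The derivatives of chi o sigma, in the point y
   as well as in the parameter phi, are finite sums of expressions built from
   vectors, from terms D^m chi_k (sigma y) (t_1, .., t_m), where chi_k is chi or
   a direction of differentiation, and from the resolvent of D chi (sigma y).
   This class of expressions is closed under differentiation along lines in
   (phi, y).  The bounds |D^m chi_k (sigma y)| <= |D^m chi_k y| +
   |D^(m+1) chi_k|_oo |sigma y - y| and |sigma y - y| <= |chi y| / (1 - tau)
   show that an expression other than a bare vector is bounded, with a weight f
   at y, by finitely many seminorms of the chi_k for the weights f and 1.
   Applied to first and second derivatives along lines, these bounds and the mean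
   value inequality give the continuity of the map and the existence of its
   directional derivative, which again belongs to the class.  Derivatives in y
   and in phi commute by a mean value argument. *)

(** * Linear combinations and curves in normed spaces *)

(** The target is only locally convex and every bound has to be uniform in i and y, so no inverse
    function theorem on a Banach space gives the result. Uniformity comes from the weight 1: its
    seminorms bound each derivative of all chi_i on the whole of U_i. Remainders along lines are
    therefore quadratic, with constants that depend on finitely many seminorms, and no little-o ever
    has to be made uniform. The derivative of order l in y of an expression is, with the maps kept
    fixed, the value of its l-fold formal derivative. All seminorms thus reduce to bounds on values
    of expressions; the price is that differentiability in phi for a seminorm of order l requires
    the two kinds of derivatives to commute. The estimates hold on the set given by the non-strict
    inequalities, which is convex and contains - D, so segments between two parameters stay inside
    it; the strict inequalities make D open. *)

Inductive lexp (K : Type) :=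
  | LZero | LVar of nat | LAdd of lexp K & lexp K | LOpp of lexp K
  | LScale of K & lexp K.
Arguments LZero {K}.
Arguments LVar {K}.

Section LinearExpressions.
Variables (K : nzRingType) (V : lmodType K).

Fixpoint leval (env : seq V) (e : lexp K) : V :=
  match e with
  | LZero => 0
  | LVar n => nth 0 env n
  | LAdd a b => leval env a + leval env b
  | LOpp a => - leval env a
  | LScale c a => c *: leval env a
  end.

Fixpoint lcoef (n : nat) (e : lexp K) : K :=
  match e with
  | LZero => 0
  | LVar m => if m == n then 1 else 0
  | LAdd a b => lcoef n a + lcoef n b
  | LOpp a => - lcoef n a
  | LScale c a => c * lcoef n a
  end.

Lemma leval_coef env e :
  leval env e = \sum_(n < size env) lcoef n e *: nth 0 env n.
Proof.
elim: e => [|m|a iha b ihb|a iha|c a iha] /=.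
- by rewrite big1// => n _; rewrite scale0r.
- have [ms|sm] := ltnP m (size env); last first.
    rewrite nth_default// big1// => n _; case: eqP => [E|_]; last by rewrite scale0r.
    by have := ltn_ord n; rewrite -E ltnNge sm.
  rewrite (bigD1 (Ordinal ms))//= eqxx scale1r big1 ?addr0// => n nm.
  case: eqP => [E|_]; last by rewrite scale0r.
  by move: nm; rewrite -val_eqE /= E eqxx.
- by rewrite iha ihb -big_split; apply: eq_bigr => n _; rewrite scalerDl.
- by rewrite iha -sumrN; apply: eq_bigr => n _; rewrite scaleNr.
- by rewrite iha scaler_sumr; apply: eq_bigr => n _; rewrite scalerA.
Qed.

(** A conjunction computed by recursion, so that for a concrete environment simplification leaves
    one ring identity per atom. *)
Fixpoint lcoef_eq (n : nat) (e1 e2 : lexp K) : Prop :=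
  match n with
  | 0 => True
  | n'.+1 => lcoef n' e1 = lcoef n' e2 /\ lcoef_eq n' e1 e2
  end.

Lemma lexp_eq env e1 e2 : lcoef_eq (size env) e1 e2 -> leval env e1 = leval env e2.
Proof.
move=> H; rewrite !leval_coef; apply: eq_bigr => -[n ns] _ /=; congr (_ *: _).
elim: (size env) H ns => // m ih /= [E H]; rewrite ltnS leq_eqVlt.
by case/predU1P => [->|/ih]; last exact.
Qed.

End LinearExpressions.

Ltac lin_index x env :=
  lazymatch env with
  | x :: _ => constr:(0%N)
  | _ :: ?env' => let n := lin_index x env' in constr:(n.+1)
  end.
Ltac lin_mem x env :=
  lazymatch env with
  | x :: _ => constr:(true)
  | _ :: ?env' => lin_mem x env'
  | _ => constr:(false)
  end.
Ltac lin_atoms t env :=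
  lazymatch t with
  | (?a + ?b)%R => let env' := lin_atoms a env in lin_atoms b env'
  | (- ?a)%R => lin_atoms a env
  | (?c *: ?a)%R => lin_atoms a env
  | GRing.zero => env
  | ?x => lazymatch lin_mem x env with true => env | false => constr:(x :: env) end
  end.
Ltac lin_reify K t env :=
  lazymatch t with
  | (?a + ?b)%R => let a' := lin_reify K a env in let b' := lin_reify K b env in
      constr:(@LAdd K a' b')
  | (- ?a)%R => let a' := lin_reify K a env in constr:(@LOpp K a')
  | (?c *: ?a)%R => let a' := lin_reify K a env in constr:(@LScale K c a')
  | GRing.zero => constr:(@LZero K)
  | ?x => let n := lin_index x env in constr:(@LVar K n)
  end.
(* Equality of linear combinations in a left module, by comparing coefficients. *)
Ltac linear_comb K :=
  lazymatch goal with
  | |- @eq ?V ?a ?b =>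
    let env := lin_atoms a (@nil V) in
    let env := lin_atoms b env in
    let a' := lin_reify K a env in
    let b' := lin_reify K b env in
    refine (@lexp_eq K V env a' b' _); rewrite /=;
    repeat (split; [try ring|]); try exact: I
  end.

Lemma ofR_opp (R : realType) (s : scalar_kind) (a : R) :
  ofR (- a) = - ofR a :> scalars R s.
Proof. by apply: (addrI (ofR a)); rewrite -ofRD !subrr ofR0. Qed.

(** Curves are parametrised by reals even when K is complex. *)
Definition rscale (R : realType) (s : scalar_kind) (V : lmodType (scalars R s))
  (a : R) (x : V) : V := (ofR a : scalars R s) *: x.

Ltac rlin :=
  rewrite /rscale ?(ofRD, ofR_opp, ofRM, ofR0, ofR1);
  match goal with R : realType, s : scalar_kind |- _ =>
    linear_comb (scalars R s)
  end.

Section RealScalars.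
Context {R : realType} {s : scalar_kind}.
Local Notation K := (scalars R s).

Section Lmod.
Variable V : lmodType K.
Implicit Types (a b : R) (x y : V).

Lemma rscaleDl a b x : rscale (a + b) x = rscale a x + rscale b x.
Proof. by rewrite /rscale ofRD scalerDl. Qed.

Lemma rscaleNl a x : rscale (- a) x = - rscale a x.
Proof. by rewrite /rscale ofR_opp scaleNr. Qed.

Lemma rscaleBl a b x : rscale (a - b) x = rscale a x - rscale b x.
Proof. by rewrite rscaleDl rscaleNl. Qed.

Lemma rscale0 x : rscale 0 x = 0.
Proof. by rewrite /rscale ofR0 scale0r. Qed.

Lemma rscaler0 a : rscale a (0 : V) = 0.
Proof. exact: scaler0. Qed.

Lemma rscale1 x : rscale 1 x = x.
Proof. by rewrite /rscale ofR1 scale1r. Qed.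

Lemma rscaleA a b x : rscale a (rscale b x) = rscale (a * b) x.
Proof. by rewrite /rscale scalerA ofRM. Qed.
End Lmod.

Section Normed.
Variable V : normedModType K.
Implicit Types (a b : R) (x y : V).

Lemma rnorm_rscale a x : rnorm (rscale a x) = `|a| * rnorm x.
Proof.
have H b : 0 <= b -> rnorm (rscale b x) = b * rnorm x.
  by move=> b0; rewrite rnormZ rnorm_ofR.
have [a0|a0] := leP 0 a; first by rewrite H// ger0_norm.
by rewrite -[a in LHS]opprK rscaleNl rnormN H ?oppr_ge0 1?ltW// ltr0_norm.
Qed.

Lemma rnormB x y : rnorm (x - y) <= rnorm x + rnorm y.
Proof. by rewrite -(rnormN y) rnormD. Qed.

Lemma rnormBC x y : rnorm (x - y) = rnorm (y - x).
Proof. by rewrite -opprB rnormN. Qed.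

Lemma rnorm_tri y x z : rnorm (x - z) <= rnorm (x - y) + rnorm (y - z).
Proof. by apply: le_trans (rnormD _ _); rewrite addrA subrK. Qed.

Lemma rnorm_sum n (F : 'I_n -> V) : rnorm (\sum_j F j) <= \sum_j rnorm (F j).
Proof.
elim/big_rec2: _ => [|j y x _ ih]; first by rewrite rnorm0.
by rewrite (le_trans (rnormD _ _))// lerD2l.
Qed.

Lemma rnorm_small x : (forall e : R, 0 < e -> rnorm x <= e) -> x = 0.
Proof.
move=> H; apply: rnorm0_eq0; apply/eqP; rewrite eq_le rnorm_ge0 andbT.
by apply/ler_addgt0Pr => e e0; rewrite add0r H.
Qed.

End Normed.

Lemma half_gt0 (e : R) : 0 < e -> 0 < e / 2.
Proof. by move=> e0; rewrite divr_gt0. Qed.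

Section RealLine.
Variable V : normedModType K.
Implicit Types (g : R -> V) (a b : R).

(** Real induction: the set S of points satisfying the bound contains its supremum c, by the local
    bound at c applied to a point of S close to c, and if c < b the same local bound would carry S
    beyond c. This replaces the use of linear functionals in the mean value inequality. *)
Lemma locally_lipschitz_bound g M b : 0 <= b ->
  (forall c, 0 <= c <= b -> exists2 d : R, 0 < d &
     forall t, 0 <= t <= b -> `|t - c| < d -> rnorm (g t - g c) <= M * `|t - c|) ->
  rnorm (g b - g 0) <= M * b.
Proof.
move=> b0 H; pose S := [set t | 0 <= t <= b /\ rnorm (g t - g 0) <= M * t].
have S0 : S 0 by split; rewrite ?lexx// subrr rnorm0 mulr0.
have hS : has_sup S by split; [exists 0|exists b => t [/andP[]]].
pose c := sup S.
have c0 : 0 <= c by apply: sup_upper_bound.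
have cb : c <= b by apply: ge_sup; [exists 0|move=> t [/andP[]]].
have cI : 0 <= c <= b by rewrite c0.
have [d d0 Hd] := H c cI.
have Sc : S c.
  split=> //; have [t St ct] := sup_adherent d0 hS.
  have tc : t <= c by exact: sup_upper_bound.
  have [tI Ht] := St.
  have dt : `|t - c| < d by rewrite distrC ger0_norm ?subr_ge0// ltrBlDl -ltrBlDr.
  have := Hd t tI dt; rewrite distrC ger0_norm ?subr_ge0// => Htc.
  rewrite (le_trans (rnorm_tri (g t) _ _))// rnormBC.
  by rewrite (le_trans (lerD Htc Ht))// -mulrDr subrK.
have [cb'|bc] := ltP c b; last first.
  suff -> : b = c by case: Sc.
  by apply/eqP; rewrite eq_le bc.
pose t := Num.min b (c + d / 2).
have ct : c < t by rewrite lt_min cb' ltrDl divr_gt0.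
have St : S t.
  have tI : 0 <= t <= b by rewrite (le_trans c0 (ltW ct)) ge_min lexx.
  split=> //; have tc : `|t - c| < d.
    rewrite gtr0_norm ?subr_gt0// ltrBlDl (@le_lt_trans _ _ (c + d / 2))//.
      by rewrite ge_min lexx orbT.
    by rewrite ltrD2l gtr_pMr// invf_lt1// ltr1n.
  have := Hd t tI tc; rewrite gtr0_norm ?subr_gt0// => Htc.
  rewrite (le_trans (rnorm_tri (g c) _ _))//.
  by rewrite (le_trans (lerD Htc Sc.2))// -mulrDr subrK.
by have := sup_upper_bound hS St; rewrite leNgt ct.
Qed.

(* One-sided at the end points of [0, b]. *)
Definition rderiv b g c (d : V) := forall e : R, 0 < e -> exists2 r : R, 0 < r &
  forall t, 0 <= t <= b -> `|t - c| < r ->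
    rnorm (g t - g c - rscale (t - c) d) <= e * `|t - c|.

Lemma mean_value b g g' M : 0 <= b ->
  (forall c, 0 <= c <= b -> rderiv b g c (g' c)) ->
  (forall c, 0 <= c <= b -> rnorm (g' c) <= M) ->
  rnorm (g b - g 0) <= M * b.
Proof.
move=> b0 dg gM; apply/ler_addgt0Pr => e e0.
(* Dividing by b + 1 keeps the total loss [e' * b] below [e] and allows b = 0. *)
pose e' := e / (b + 1); have b1 : 0 < b + 1 by rewrite ltr_wpDl.
have e'0 : 0 < e' by rewrite divr_gt0.
apply: (@le_trans _ _ ((M + e') * b)); last first.
  rewrite mulrDl lerD2l /e' mulrAC ler_pdivrMr// ler_pM2l//.
  by rewrite lerDl ler01.
apply: locally_lipschitz_bound => // c cI.
have [d d0 Hd] := dg c cI e' e'0; exists d => // t tI tc.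
rewrite -(subrK (rscale (t - c) (g' c)) (g t - g c)) (le_trans (rnormD _ _))//.
rewrite addrC mulrDl lerD ?Hd// rnorm_rscale mulrC ler_wpM2r//.
exact: gM.
Qed.

Lemma rderiv_lin b g h c x y (a : K) : rderiv b g c x -> rderiv b h c y ->
  rderiv b (fun t => a *: g t + h t) c (a *: x + y).
Proof.
move=> dg dh e e0.
pose e' := e / 2 / (rnorm a + 1).
have a1 : 0 < rnorm a + 1 by rewrite ltr_wpDl// rnorm_ge0.
have e'0 : 0 < e' by rewrite !divr_gt0.
have [r r0 Hr] := dg e' e'0.
have [q q0 Hq] := dh (e / 2) (half_gt0 e0).
exists (Num.min r q); first by rewrite lt_min r0.
move=> t tI; rewrite lt_min => /andP[tr tq].
have -> : a *: g t + h t - (a *: g c + h c) - rscale (t - c) (a *: x + y) =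
    a *: (g t - g c - rscale (t - c) x) + (h t - h c - rscale (t - c) y).
  by rlin.
rewrite (le_trans (rnormD _ _))// [leRHS](_ : _ = e / 2 * `|t - c| + e / 2 * `|t - c|).
  rewrite lerD ?Hq// rnormZ (@le_trans _ _ (rnorm a * (e' * `|t - c|)))//.
    by rewrite ler_wpM2l ?rnorm_ge0// Hr.
  rewrite mulrA ler_wpM2r// /e' mulrCA ler_piMr ?divr_ge0 ?ltW//.
  by rewrite ltr_pdivrMr// mul1r ltrDl.
by rewrite -mulrDl -splitr.
Qed.

Lemma rderivB b g h c x y : rderiv b g c x -> rderiv b h c y ->
  rderiv b (fun t => g t - h t) c (x - y).
Proof.
move=> dg dh; have := @rderiv_lin b h g c y x (-1) dh dg.
rewrite scaleN1r addrC => H e /H[r r0 {}H]; exists r => // t tI tr.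
by have := H t tI tr; rewrite !scaleN1r ![- h _ + _]addrC.
Qed.

Lemma rderiv_line b c (x : V) : rderiv b (fun t => rscale t x) c x.
Proof.
move=> e e0; exists 1 => // t _ _.
by rewrite -rscaleBl subrr rnorm0 mulr_ge0// ltW.
Qed.

(** The mean value inequality applied to g minus its tangent at 0, whose derivative at c is at most
    M c by the mean value inequality for g'. The factor 1/2 is given up. *)
Lemma taylor2 b g g' g'' M : 0 <= b ->
  (forall c, 0 <= c <= b -> rderiv b g c (g' c)) ->
  (forall c, 0 <= c <= b -> rderiv b g' c (g'' c)) ->
  (forall c, 0 <= c <= b -> rnorm (g'' c) <= M) ->
  rnorm (g b - g 0 - rscale b (g' 0)) <= M * b ^+ 2.
Proof.
move=> b0 dg dg' gM.
have M0 : 0 <= M by apply: le_trans (gM 0 _); rewrite ?rnorm_ge0// lexx.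
pose h t := g t - rscale t (g' 0).
have -> : g b - g 0 - rscale b (g' 0) = h b - h 0.
  by rewrite /h rscale0 subr0 addrAC.
rewrite expr2 mulrA; apply: (@mean_value b h (fun c => g' c - g' 0)) => // c cI.
  by apply: rderivB; [exact: dg|exact: rderiv_line].
have [c0 cb] := andP cI.
apply: (@le_trans _ _ (M * c)); last by rewrite ler_wpM2l.
have sub t : 0 <= t <= c -> 0 <= t <= b.
  by move=> /andP[-> tc]; exact: le_trans tc cb.
apply: (@mean_value c g' g'') => // [t tI|t /sub]; last exact: gM.
move=> e e0; have [r r0 H] := dg' t (sub t tI) e e0.
by exists r => // u /sub; exact: H.
Qed.

Lemma rderiv_uniq b g c x y : 0 < b -> 0 <= c <= b ->
  rderiv b g c x -> rderiv b g c y -> x = y.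
Proof.
move=> b0 cI dx dy; apply/eqP; rewrite -subr_eq0; apply/eqP/rnorm_small => e e0.
have [r r0 Hr] := dx (e / 2) (half_gt0 e0).
have [q q0 Hq] := dy (e / 2) (half_gt0 e0).
(* The test point lies to the right of c if c is in the left half of [0, b], and to the left
   otherwise; a distance of at most b / 2 keeps it inside. *)
have [t [tI tc tr tq]] : exists t, [/\ 0 <= t <= b, 0 < `|t - c|, `|t - c| < r & `|t - c| < q].
  have [c0 cb] := andP cI.
  pose m := Num.min (b / 2) (Num.min (r / 2) (q / 2)).
  have m0 : 0 < m by rewrite !lt_min !divr_gt0.
  have mb : m <= b / 2 by rewrite ge_min lexx.
  have mr : m < r by rewrite !gt_min [r / 2 < r]gtr_pMr// invf_lt1// ltr1n ?orbT.
  have mq : m < q by rewrite !gt_min [q / 2 < q]gtr_pMr// invf_lt1// ltr1n ?orbT.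
  have [cb2|cb2] := leP c (b / 2).
    exists (c + m); rewrite [c + m]addrC addrK gtr0_norm//; split=> //.
    by rewrite addr_ge0 ?(ltW m0)//= [b]splitr lerD.
  exists (c - m); rewrite addrAC subrr add0r normrN gtr0_norm//; split=> //.
  rewrite subr_ge0 (le_trans mb (ltW cb2))/= (le_trans _ cb)//.
  by rewrite gerBl ltW.
rewrite -(@ler_pM2l _ `|t - c|)// -rnorm_rscale.
have -> : rscale (t - c) (x - y) =
    (g t - g c - rscale (t - c) y) - (g t - g c - rscale (t - c) x).
  by rlin.
rewrite (le_trans (rnormB _ _))// (le_trans (lerD (Hq t tI tq) (Hr t tI tr)))//.
by rewrite -mulrDl -splitr mulrC.
Qed.

End RealLine.
End RealScalars.

Section RealLine2.
Context {R : realType} {s : scalar_kind}.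
Local Notation K := (scalars R s).
Variable V : normedModType K.

Lemma rderiv_sub b b' (g : R -> V) c d : b' <= b -> rderiv b g c d -> rderiv b' g c d.
Proof.
move=> bb dg e e0; have [r r0 H] := dg e e0; exists r => // t /andP[t0 tb].
by apply: H; rewrite t0 (le_trans tb).
Qed.

(* Only one of the two mixed derivatives is assumed to exist: the second
   difference of G is [x y G12 0 0] up to [C (x + y) x y]. *)
Lemma rderiv_exchange b C (G G1 G12 : R -> R -> V) (G2 : R -> V) : 0 < b ->
  (forall x y, 0 <= x <= b -> 0 <= y <= b -> rderiv b (G^~ y) x (G1 x y)) ->
  (forall x y, 0 <= x <= b -> 0 <= y <= b -> rderiv b (G1 x) y (G12 x y)) ->
  (forall x, 0 <= x <= b -> rderiv b (G x) 0 (G2 x)) ->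
  (forall x y, 0 <= x <= b -> 0 <= y <= b ->
    rnorm (G12 x y - G12 0 0) <= C * (x + y)) ->
  rderiv b G2 0 (G12 0 0).
Proof.
move=> b0 dG dG1 dG2 HC; set L := G12 0 0.
have bI : 0 <= b <= b by rewrite (ltW b0) lexx.
have C0 : 0 <= C.
  have := le_trans (rnorm_ge0 _) (HC b b bI bI).
  by rewrite pmulr_lge0// addr_gt0.
have I0 : (0 : R) <= 0 <= b by rewrite lexx (ltW b0).
have key x y : 0 <= x <= b -> 0 <= y <= b ->
    rnorm (G x y - G x 0 - (G 0 y - G 0 0) - rscale (x * y) L) <= C * (x + y) * y * x.
  move=> /andP[x0 xb] yI; have /andP[y0 yb] := yI.
  pose h t := G t y - G t 0 - rscale t (rscale y L).
  have -> : G x y - G x 0 - (G 0 y - G 0 0) - rscale (x * y) L = h x - h 0.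
    by rewrite /h; rlin.
  have sub t : 0 <= t <= x -> 0 <= t <= b by move=> /andP[-> /le_trans]; apply.
  apply: (@mean_value R s V x h (fun t => G1 t y - G1 t 0 - rscale y L)) => // t tx.
    apply: rderivB; last exact: rderiv_line.
    by apply: rderivB; apply: (rderiv_sub xb); apply: dG => //; exact: sub.
  pose k u := G1 t u - rscale u L.
  have -> : G1 t y - G1 t 0 - rscale y L = k y - k 0 by rewrite /k; rlin.
  apply: (@mean_value R s V y k (fun u => G12 t u - L)) => // u uy.
    apply: rderivB; last exact: rderiv_line.
    apply: (rderiv_sub yb); apply: dG1; first exact: sub.
    by have /andP[u0 uy'] := uy; rewrite u0 (le_trans uy').
  have /andP[t0 tx'] := tx; have /andP[u0 uy'] := uy.
  apply: le_trans (HC t u (sub t tx) _) _; first by rewrite u0 (le_trans uy').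
  by rewrite ler_wpM2l// lerD.
(* This is [key] divided by y, for small y: the difference quotients in y approach [G2 x] and
   [G2 0]. The three errors [e'] are those of the two quotients and the term C x y. *)
have quad x : 0 <= x <= b -> rnorm (G2 x - G2 0 - rscale x L) <= C * x * x.
  move=> xI; have /andP[x0 xb] := xI; apply/ler_addgt0Pr => e e0.
  pose e' := e / 3; have e'0 : 0 < e' by rewrite divr_gt0.
  have [r r0 Hr] := dG2 x xI e' e'0; have [q q0 Hq] := dG2 0 I0 e' e'0.
  pose w := e' / (C * x + 1).
  have w0 : 0 < w by rewrite divr_gt0// ltr_wpDl// mulr_ge0.
  pose y := Num.min (Num.min b w) (Num.min (r / 2) (q / 2)).
  have y0 : 0 < y by rewrite !lt_min b0 w0 !half_gt0.
  have yI : 0 <= y <= b by rewrite (ltW y0) !ge_min lexx.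
  have yw : C * x * y <= e'.
    apply: (@le_trans _ _ ((C * x + 1) * w)).
      by rewrite ler_pM ?mulr_ge0 ?(ltW y0)// ?lerDl// !ge_min lexx orbT.
    by rewrite /w mulrCA divff ?mulr1// gt_eqF// ltr_wpDl// mulr_ge0.
  have yr : `|y - 0| < r.
    rewrite subr0 gtr0_norm// !gt_min [r / 2 < r]gtr_pMr// invf_lt1// ltr1n.
    by rewrite ?orbT.
  have yq : `|y - 0| < q.
    rewrite subr0 gtr0_norm// !gt_min [q / 2 < q]gtr_pMr// invf_lt1// ltr1n.
    by rewrite ?orbT.
  have := Hr y yI yr; have := Hq y yI yq; have := key x y xI yI.
  rewrite subr0 gtr0_norm// => k1 k2 k3.
  rewrite -(@ler_pM2l _ y)// -{1}(gtr0_norm y0) -rnorm_rscale.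
  have -> : rscale y (G2 x - G2 0 - rscale x L) =
    (G x y - G x 0 - (G 0 y - G 0 0) - rscale (x * y) L)
    - (G x y - G x 0 - rscale y (G2 x)) + (G 0 y - G 0 0 - rscale y (G2 0)).
    by rlin.
  rewrite (le_trans (rnormD _ _))// (le_trans (lerD (rnormB _ _) (lexx _)))//.
  rewrite (le_trans (lerD (lerD k1 k3) k2))//.
  have -> : e = e' + e' + e' by rewrite /e'; field.
  rewrite -subr_ge0.
  have -> : y * (C * x * x + (e' + e' + e')) - (C * (x + y) * y * x + e' * y + e' * y)
    = y * (e' - C * x * y) by ring.
  by rewrite mulr_ge0 ?(ltW y0)// subr_ge0.
move=> e e0; exists (e / (C + 1)); first by rewrite divr_gt0// ltr_wpDl.
move=> t tI; rewrite subr0 => tr; apply: le_trans (quad t tI) _.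
have /andP[t0 _] := tI; move: tr; rewrite ger0_norm// => tr.
rewrite ler_wpM2r// (@le_trans _ _ ((C + 1) * t))//.
  by rewrite ler_wpM2r// lerDl.
by rewrite -ler_pdivlMl ?ltr_wpDl// mulrC ltW.
Qed.

End RealLine2.

Section Contraction.
Context {R : realType} {s : scalar_kind}.
Local Notation K := (scalars R s).
Variable X : completeNormedModType K.

Lemma contraction_fixpoint (S : set X) (F : X -> X) (q : R) (x0 : X) :
  0 <= q < 1 -> S x0 -> (forall x, S x -> S (F x)) ->
  (forall x y, S x -> S y -> rnorm (F x - F y) <= q * rnorm (x - y)) ->
  (forall x, (forall e : R, 0 < e -> exists2 y, S y & rnorm (y - x) < e) -> S x) ->
  exists2 x, S x & F x = x.
Proof.
move=> /andP[q0 q1] Sx0 FS Fq clS.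
pose x n := iter n F x0; have Sx n : S (x n) by elim: n => //= n; exact: FS.
pose d := rnorm (F x0 - x0); have d0 : 0 <= d by exact: rnorm_ge0.
have q1' : 0 < 1 - q by rewrite subr_gt0.
have step n : rnorm (x n.+1 - x n) <= q ^+ n * d.
  elim: n => [|n ih]; first by rewrite expr0 mul1r.
  by rewrite (le_trans (Fq (x n.+1) (x n) (Sx _) (Sx _)))// exprS -mulrA ler_wpM2l.
have dist n m : rnorm (x (m + n)%N - x n) <= q ^+ n * (d / (1 - q)).
  (* The exact geometric sum, with its factor [1 - q ^+ m], is what passes through the induction on
     m. *)
  suff H : rnorm (x (m + n)%N - x n) <= q ^+ n * (d / (1 - q)) * (1 - q ^+ m).
    rewrite (le_trans H)// ler_piMr ?gerBl ?exprn_ge0//.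
    by rewrite mulr_ge0 ?exprn_ge0// divr_ge0// ltW.
  elim: m => [|m ih]; first by rewrite add0n subrr rnorm0 expr0 subrr mulr0.
  rewrite (le_trans (rnorm_tri (x (m + n)%N) _ _))//.
  rewrite (le_trans (lerD (step (m + n)%N) ih))// addnC exprD exprS le_eqVlt; apply/orP; left.
  by apply/eqP; field; rewrite gt_eqF.
have small e : 0 < e -> exists n, q ^+ n * (d / (1 - q)) < e.
  move=> e0; have cq : `|q| < 1 by rewrite ger0_norm.
  have := cvg_expr cq => /cvgrPdist_lt/(_ (e / (d / (1 - q) + 1))).
  have D0 : 0 < d / (1 - q) + 1 by rewrite ltr_wpDl// divr_ge0// ltW.
  case; first by rewrite /= divr_gt0.
  move=> n _ /(_ n (leqnn n)); rewrite /= sub0r normrN ger0_norm ?exprn_ge0// => H.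
  exists n; rewrite (@le_lt_trans _ _ (q ^+ n * (d / (1 - q) + 1)))//.
    by rewrite ler_wpM2l ?exprn_ge0// lerDl.
  by rewrite -ltr_pdivlMr.
have /cauchy_cvgP/cvg_ex[l xl] : cauchy (x n @[n --> \oo]).
  apply: cauchy_exP => e e0.
  have [|N HN] := small (re e); first by rewrite -(@ofR_lt _ s) ofR0 reK// ltW.
  exists (x N), N => // n /= Nn; rewrite -ball_normE /= distrC -rnormE -(reK (ltW e0)).
  by rewrite ofR_lt (le_lt_trans _ HN)// -(subnK Nn).
have lim e : 0 < e -> exists N, forall n, (N <= n)%N -> rnorm (x n - l) < e.
  move=> e0; have : nbhs l [set y | rnorm (y - l) < e].
    by apply/(@nbhs_rnormP R s X); exists e.
  by move=> /xl[N _ HN]; exists N.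
have Sl : S l.
  by apply: clS => e /lim[N /(_ N (leqnn N)) HN]; exists (x N).
exists l => //; apply/eqP; rewrite -subr_eq0; apply/eqP/(@rnorm_small R s) => e e0.
have [N HN] := lim (e / 2) (half_gt0 e0).
rewrite (le_trans (rnorm_tri (x N.+1) _ _))// [e]splitr lerD//; last first.
  by rewrite ltW// HN.
rewrite (le_trans (Fq l (x N) Sl (Sx N)))// (@le_trans _ _ (rnorm (l - x N)))//.
  by rewrite ler_piMl ?rnorm_ge0// ltW.
by rewrite rnormBC ltW// HN.
Qed.

End Contraction.

Section Frechet.
Context {R : realType} {s : scalar_kind}.
Local Notation K := (scalars R s).
Variables X Z : normedModType K.

Lemma diff_rnorm (f : X -> Z) x : differentiable f x -> forall e : R, 0 < e ->
  exists2 r : R, 0 < r & forall h, rnorm h < r ->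
    rnorm (f (x + h) - f x - 'd f x h) <= e * rnorm h.
Proof.
move=> df e e0; have /eqaddoP/(_ (ofR e)) := diff_locally df.
have eK : 0 < ofR e :> K by rewrite -(@ofR0 R s) ofR_lt.
move=> /(_ eK)/(@nbhs_rnormP R s X)[r r0 H].
exists r => // h hr; have := H h; rewrite subr0 => /(_ hr).
rewrite -(@ofR_le _ s) ofRM !rnormE.
have -> : (f \o shift x - (cst (f x) + 'd f x)) h = f (h + x) - (f x + 'd f x h) by [].
by rewrite opprD addrA [h + x]addrC.
Qed.

Lemma diff_of_quadratic (f : X -> Z) x (L : {linear X -> Z}) (M C r : R) : 0 < r ->
  (forall h, rnorm (L h) <= M * rnorm h) ->
  (forall h, rnorm h < r -> rnorm (f (x + h) - f x - L h) <= C * rnorm h ^+ 2) ->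
  differentiable f x /\ 'd f x = L :> (X -> Z).
Proof.
move=> r0 LM H.
have Lc : continuous L.
  move=> y A /(@nbhs_rnormP R s Z)[e e0 eA].
  apply/(@nbhs_rnormP R s X); exists (e / (`|M| + 1)).
    by rewrite divr_gt0// ltr_wpDl.
  move=> z zy; apply: eA; rewrite -linearB (le_lt_trans (LM _))//.
  rewrite (@le_lt_trans _ _ ((`|M| + 1) * rnorm (z - y)))//.
    by rewrite ler_wpM2r ?rnorm_ge0// (le_trans (ler_norm _))// lerDl.
  by rewrite -ltr_pdivlMl ?ltr_wpDl// mulrC.
have E : f \o shift x = cst (f x) + L +o_ 0 id.
  apply/eqaddoP => e e0.
  have e0' : 0 < re e by rewrite -(@ofR_lt _ s) ofR0 reK// ltW.
  apply/(@nbhs_rnormP R s X); exists (Num.min r (re e / (`|C| + 1))).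
    by rewrite lt_min r0 divr_gt0// ltr_wpDl.
  move=> h; rewrite subr0 lt_min => /andP[hr he].
  have := H h hr.
  have -> : (f \o shift x - (cst (f x) + (L : X -> Z))) h =
      f (h + x) - (f x + L h) by [].
  rewrite opprD addrA [h + x]addrC.
  move=> H1.
  rewrite -rnormE -[X in _ <= _ * X]rnormE -(reK (ltW e0)) -ofRM ofR_le (le_trans H1)//.
  rewrite expr2 mulrA ler_wpM2r ?rnorm_ge0//.
  rewrite (@le_trans _ _ ((`|C| + 1) * rnorm h))//.
    by rewrite ler_wpM2r ?rnorm_ge0// (le_trans (ler_norm _))// lerDl.
  by rewrite -ler_pdivlMl ?ltr_wpDl// mulrC ltW.
have dE : 'd f x = L :> (X -> Z) by exact: diff_unique.
by split=> //; apply/diff_locallyP; rewrite dE.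
Qed.

Lemma diff_rderiv (f : X -> Z) b p h c : differentiable f (p + rscale c h) ->
  rderiv b (fun t => f (p + rscale t h)) c ('d f (p + rscale c h) h).
Proof.
move=> df e e0; pose m := rnorm h + 1.
have m0 : 0 < m by rewrite ltr_wpDl// rnorm_ge0.
have [r r0 H] := diff_rnorm df (divr_gt0 e0 m0).
exists (r / m) => [|t _ tc]; first by rewrite divr_gt0.
have := H (rscale (t - c) h).
have -> : p + rscale c h + rscale (t - c) h = p + rscale t h by rlin.
have hm : rnorm (rscale (t - c) h) <= `|t - c| * m.
  by rewrite rnorm_rscale ler_wpM2l// lerDl.
have -> : 'd f (p + rscale c h) (rscale (t - c) h) =
    rscale (t - c) ('d f (p + rscale c h) h) by exact: (linearZ_LR ('d f (p + rscale c h))).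
move=> /(_ _)/le_trans H1; apply: H1.
  by rewrite (le_lt_trans hm)// -ltr_pdivlMr.
have em : 0 <= e / m by rewrite ltW// divr_gt0.
rewrite (le_trans (ler_wpM2l em hm))//.
by rewrite mulrCA divfK ?gt_eqF// mulrC.
Qed.

End Frechet.

(** * Multilinear maps and iterated derivatives *)

Section MultilinearEstimates.
Context {R : realType} {s : scalar_kind}.
Local Notation K := (scalars R s).
Variables (l : nat) (X Y : normedModType K).
Implicit Types (f : ('I_l -> X) -> Y) (v w u : 'I_l -> X) (M B C d : R).

(** Stands in for the operator norm when f is not yet known to be continuous; continuity follows
    from it in [multilinear_unit_bounded_continuous]. *)
Definition unit_bounded f (M : R) :=
  forall v, (forall i, rnorm (v i) <= 1) -> rnorm (f v) <= M.

Lemma unit_bounded_ge0 f M : unit_bounded f M -> 0 <= M.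
Proof.
by move=> /(_ (fun=> 0)) H; apply: le_trans (H _); rewrite ?rnorm_ge0// => i; rewrite rnorm0.
Qed.

Lemma mlin_unit_bounded (f : mlin l X Y) : unit_bounded f (rnorm f).
Proof. by move=> v v1; rewrite mlin_rnormE opnorm_ub. Qed.

Lemma multilinear_bound f M B v : multilinear f -> unit_bounded f M -> 0 < B ->
  (forall i, rnorm (v i) <= B) -> rnorm (f v) <= M * B ^+ l.
Proof.
move=> fl fM B0 vB.
have -> : v = (fun i => ofR B *: rscale B^-1 (v i)).
  by apply/funext => i; rewrite -/(rscale _ _) rscaleA mulfV ?rscale1// gt_eqF.
rewrite multilinear_homo// rnormZ rnormX rnorm_ofR ?(ltW B0)// mulrC.
rewrite ler_wpM2r ?exprn_ge0 ?(ltW B0)//; apply: fM => i.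
by rewrite rnorm_rscale gtr0_norm ?invr_gt0// mulrC ler_pdivrMr// mul1r.
Qed.

Lemma multilinearB f i v x y : multilinear f ->
  f (dfwith v i (x - y)) = f (dfwith v i x) - f (dfwith v i y).
Proof.
move=> fl; have := fl i v (-1) y x; rewrite !scaleN1r [- y + x]addrC => ->.
by rewrite addrC.
Qed.

Lemma multilinear_rscale f i v a x : multilinear f ->
  f (dfwith v i (rscale a x)) = rscale a (f (dfwith v i x)).
Proof. exact: multilinearZ. Qed.

(** Slot k receives the unit vector in the direction of x, hence the assumption 1 <= B; the norm of
    x is pulled out by homogeneity. *)
Lemma multilinear_coord_bound f M B k v x : multilinear f -> unit_bounded f M ->
  1 <= B -> (forall i, rnorm (v i) <= B) ->
  rnorm (f (dfwith v k x)) <= M * B ^+ l * rnorm x.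
Proof.
move=> fl fM B1 vB; have B0 : 0 < B by apply: lt_le_trans B1.
have [x0|x0] := eqVneq (rnorm x) 0.
  by rewrite (rnorm0_eq0 x0) multilinear0// !rnorm0 mulr0.
have xp : 0 < rnorm x by rewrite lt_neqAle eq_sym x0 rnorm_ge0.
have -> : x = ofR (rnorm x) *: rscale (rnorm x)^-1 x.
  by rewrite -/(rscale _ _) rscaleA mulfV// rscale1.
rewrite multilinearZ// !rnormZ !rnorm_ofR ?invr_ge0 ?(ltW xp)//.
rewrite mulVf// mulr1 mulrC ler_wpM2r ?(ltW xp)//.
apply: multilinear_bound => // i; case: dfwithP => // .
by rewrite rnormZ rnorm_ofR ?invr_ge0 ?(ltW xp)// mulVf.
Qed.

Definition hybrid w v (k : nat) : 'I_l -> X := fun j => if (j < k)%N then w j else v j.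

Lemma multilinear_telescope f v w : multilinear f ->
  f w - f v = \sum_(k < l) f (dfwith (hybrid w v k) k (w k - v k)).
Proof.
move=> fl; have -> : f v = f (hybrid w v 0) by congr f; apply/funext.
have -> : f w = f (hybrid w v l).
  by congr f; apply/funext => j; rewrite /hybrid ltn_ord.
rewrite -(telescope_sumr (fun k => f (hybrid w v k)))// big_mkord.
apply: eq_bigr => k _; rewrite multilinearB//; congr (f _ - f _); apply/funext => j.
  case: dfwithP => [|j' jk]; first by rewrite /hybrid ltnSn.
  rewrite /hybrid ltnS leq_eqVlt; case: eqP => //= E.
  by move: jk; rewrite (val_inj E) eqxx.
by case: dfwithP => // ; rewrite /hybrid ltnn.
Qed.

Lemma hybrid_bound w v k B : (forall i, rnorm (v i) <= B) ->
  (forall i, rnorm (w i) <= B) -> forall i, rnorm (hybrid w v k i) <= B.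
Proof. by move=> vB wB i; rewrite /hybrid; case: ifP. Qed.

Lemma rnorm_sum_le (F : 'I_l -> Y) C : (forall k, rnorm (F k) <= C) ->
  rnorm (\sum_k F k) <= l%:R * C.
Proof.
move=> FC; rewrite (le_trans (rnorm_sum _))//.
rewrite (@le_trans _ _ (\sum_(k < l) C))//; first by apply: ler_sum.
by rewrite sumr_const card_ord mulr_natl.
Qed.

Lemma multilinear_lipschitz f M B d v w : multilinear f -> unit_bounded f M ->
  1 <= B -> (forall i, rnorm (v i) <= B) -> (forall i, rnorm (w i) <= B) ->
  (forall i, rnorm (w i - v i) <= d) ->
  rnorm (f w - f v) <= l%:R * (M * B ^+ l * d).
Proof.
move=> fl fM B1 vB wB wv; rewrite multilinear_telescope//; apply: rnorm_sum_le => k.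
rewrite (le_trans (multilinear_coord_bound k _ fl fM B1 (hybrid_bound k vB wB)))//.
rewrite ler_wpM2l//.
by rewrite mulr_ge0 ?(unit_bounded_ge0 fM)// exprn_ge0// (le_trans ler01).
Qed.

(** The product rule with a quadratic remainder. In the telescoping sum, slot k contributes its own
    second order remainder, and the effect of having already replaced v by w in the earlier slots,
    which is a product of two first order increments. *)
Lemma multilinear_taylor f M B d v w u : multilinear f -> unit_bounded f M ->
  1 <= B -> (forall i, rnorm (v i) <= B) -> (forall i, rnorm (w i) <= B) ->
  (forall i, rnorm (w i - v i) <= B * `|d|) -> (forall i, rnorm (u i) <= B) ->
  (forall i, rnorm (w i - v i - rscale d (u i)) <= B * d ^+ 2) ->
  rnorm (f w - f v - rscale d (\sum_k f (dfwith v k (u k)))) <=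
    l%:R * ((M * B ^+ l * B + l%:R * (M * B ^+ l * B)) * d ^+ 2).
Proof.
move=> fl fM B1 vB wB wv uB wvu.
have B0 : 0 <= B by apply: le_trans B1.
have C0 : 0 <= M * B ^+ l by rewrite mulr_ge0 ?(unit_bounded_ge0 fM)// exprn_ge0.
rewrite multilinear_telescope// /rscale scaler_sumr -sumrB.
apply: rnorm_sum_le => k; rewrite -/(rscale d _).
have -> : f (dfwith (hybrid w v k) k (w k - v k)) - rscale d (f (dfwith v k (u k))) =
    f (dfwith (hybrid w v k) k (w k - v k - rscale d (u k)))
    + rscale d (f (dfwith (hybrid w v k) k (u k)) - f (dfwith v k (u k))).
  rewrite (multilinearB _ _ (w k - v k) (rscale d (u k)) fl) (multilinear_rscale _ _ _ _ fl).
  by rlin.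
rewrite (le_trans (rnormD _ _))// mulrDl lerD//.
  rewrite (le_trans (multilinear_coord_bound k _ fl fM B1 (hybrid_bound k vB wB)))//.
  by rewrite -[leRHS]mulrA ler_wpM2l.
rewrite rnorm_rscale -[d ^+ 2]real_normK ?num_real// expr2 [leRHS]mulrA [leRHS]mulrC ler_wpM2l//.
rewrite -!mulrA.
have hB z k' : (forall i, rnorm (z i) <= B) -> forall i, rnorm (dfwith z k' (u k') i) <= B.
  by move=> zB i; case: dfwithP.
rewrite (le_trans (multilinear_lipschitz (d := B * `|d|) fl fM B1 (hB v k vB)
  (hB _ k (hybrid_bound k vB wB)) _))//.
  move=> i; case: dfwithP => [|i' ik].
    by rewrite dfwithin subrr rnorm0 mulr_ge0.
  by rewrite dfwithout// /hybrid; case: ifP => // _; rewrite subrr rnorm0 mulr_ge0.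
by rewrite -!mulrA.
Qed.

Lemma multilinear_unit_bounded_continuous f M : multilinear f -> unit_bounded f M ->
  continuous_multilinear f.
Proof.
move=> fl fM; split=> // v A /(@nbhs_rnormP R s Y)[e e0 eA].
apply/nbhs_ptwsP; pose B := \sum_i rnorm (v i) + 2.
have S0 : 0 <= \sum_i rnorm (v i) by rewrite sumr_ge0// => i _; exact: rnorm_ge0.
have B1 : 1 <= B by rewrite ler_wpDl// ler1n.
have vB' i : rnorm (v i) <= \sum_i rnorm (v i).
  by rewrite (bigD1 i)//= lerDl sumr_ge0// => j _; exact: rnorm_ge0.
pose D := M * B ^+ l; pose C := l%:R * D + 1.
have C0 : 0 < C.
  rewrite ltr_wpDl// mulr_ge0// mulr_ge0 ?(unit_bounded_ge0 fM)//.
  by rewrite exprn_ge0// (le_trans ler01).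
exists (Num.min 1 (e / C)); first by rewrite lt_min ltr01 divr_gt0.
move=> w H; apply: eA.
have wv i : rnorm (w i - v i) <= Num.min 1 (e / C) by rewrite ltW.
have vB i : rnorm (v i) <= B by rewrite (le_trans (vB' i))// lerDl.
have wB i : rnorm (w i) <= B.
  rewrite -(subrK (v i) (w i)) (le_trans (rnormD _ _))// addrC lerD//.
  by rewrite (le_trans (wv i))// ge_min (ler_nat _ 1 2).
rewrite (le_lt_trans (multilinear_lipschitz fl fM B1 vB wB wv))//.
rewrite -/D.
have D0 : 0 <= l%:R * D.
  by rewrite mulr_ge0// mulr_ge0 ?(unit_bounded_ge0 fM)// exprn_ge0// (le_trans ler01).
rewrite mulrA (@le_lt_trans _ _ (l%:R * D * (e / C)))//.
  by rewrite ler_wpM2l// ge_min lexx orbT.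
by rewrite mulrCA gtr_pMr// ltr_pdivrMr// mul1r ltrDl.
Qed.

End MultilinearEstimates.

Section IteratedDerivativeEstimates.
Context {R : realType} {s : scalar_kind}.
Local Notation K := (scalars R s).
Variables (X Y : normedModType K).

Definition vcons l (x : X) (w : 'I_l -> X) : 'I_l.+1 -> X :=
  fun i => if unlift ord0 i is Some j then w j else x.

Lemma vcons0 l x (w : 'I_l -> X) : vcons x w ord0 = x.
Proof. by rewrite /vcons unlift_none. Qed.

Lemma vconsS l x (w : 'I_l -> X) j : vcons x w (lift ord0 j) = w j.
Proof. by rewrite /vcons liftK. Qed.

Lemma mlin_eq l (f g : mlin l X Y) : (forall v, f v = g v) -> f = g.
Proof. by move=> fg; apply/val_inj/funext. Qed.

Lemma mlinB l (f g : mlin l X Y) v : (f - g) v = f v - g v.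
Proof. by []. Qed.

Lemma mlin_rscale l a (f : mlin l X Y) v : (rscale a f) v = rscale a (f v).
Proof. by []. Qed.

Lemma mlin_rnorm_le l (f : mlin l X Y) M : unit_bounded f M -> rnorm f <= M.
Proof. by move=> fM; rewrite mlin_rnormE; exact: opnorm_le. Qed.

(** The entry x is overwritten and thus arbitrary; with a common x, linearity in the added argument
    becomes an instance of multilinearity. *)
Lemma vcons_dfwith l x (w : 'I_l -> X) y : vcons y w = dfwith (vcons x w) ord0 y.
Proof.
apply/funext => i; case: (unliftP ord0 i) => [j|] ->.
  by rewrite vconsS dfwithout ?vconsS// neq_lift.
by rewrite vcons0 dfwithin.
Qed.

Lemma mlin_vcons_lin l (f : mlin l.+1 X Y) (a : K) x y w :
  f (vcons (a *: x + y) w) = a *: f (vcons x w) + f (vcons y w).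
Proof.
have [fl _] := mlinP f.
rewrite (vcons_dfwith 0 w (a *: x + y)) (vcons_dfwith 0 w x) (vcons_dfwith 0 w y).
exact: fl.
Qed.

Lemma iterDS l (phi : X -> Y) x h w : differentiable (iterD l phi) x ->
  iterD l.+1 phi x (vcons h w) = 'd (iterD l phi) x h w.
Proof.
move=> dphi; rewrite iterDSE// vcons0.
by rewrite (_ : (fun j => _) = w)//; apply/funext => j; rewrite vconsS.
Qed.

Lemma mlin_vcons_bound l (f : mlin l.+1 X Y) x w B : 1 <= B ->
  (forall i, rnorm (w i) <= B) -> rnorm (f (vcons x w)) <= rnorm f * B ^+ l.+1 * rnorm x.
Proof.
move=> B1 wB; have [fl _] := mlinP f; rewrite (vcons_dfwith 0 w).
apply: multilinear_coord_bound => //; first exact: mlin_unit_bounded.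
move=> i; case: (unliftP ord0 i) => [j|] ->; first by rewrite vconsS.
by rewrite vcons0 rnorm0 (le_trans ler01).
Qed.

Lemma diff_iterD_bound l (phi : X -> Y) x h : differentiable (iterD l phi) x ->
  rnorm ('d (iterD l phi) x h) <= rnorm (iterD l.+1 phi x) * rnorm h.
Proof.
move=> dphi; apply: mlin_rnorm_le => w w1; rewrite -iterDS//.
by rewrite (le_trans (mlin_vcons_bound _ _ (lexx _) w1))// expr1n mulr1.
Qed.

Section Convex.
Variables (U : set X) (phi : X -> Y).
Hypothesis cU : forall p q t, U p -> U q -> 0 <= t <= 1 -> U (p + rscale t (q - p)).
Hypothesis dphi : FCoo U phi.

Lemma iterD_lipschitz l M p q : U p -> U q ->
  (forall x, U x -> rnorm (iterD l.+1 phi x) <= M) ->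
  rnorm (iterD l phi q - iterD l phi p) <= M * rnorm (q - p).
Proof.
move=> Up Uq HM; have /FCooP d := dphi.
pose g t := iterD l phi (p + rscale t (q - p)).
have -> : iterD l phi q - iterD l phi p = g 1 - g 0.
  by rewrite /g rscale1 rscale0 addr0 [p + _]addrC subrK.
rewrite -[leRHS]mulr1.
apply: (@mean_value R s _ 1 g
    (fun c => 'd (iterD l phi) (p + rscale c (q - p)) (q - p))) => // c cI.
  by apply: diff_rderiv; exact/d/cU.
rewrite (le_trans (diff_iterD_bound _ _))//; first exact/d/cU.
by rewrite ler_wpM2r ?rnorm_ge0//; exact/HM/cU.
Qed.

(** Along the segment, the derivative differs from its value at p by what [iterD_lipschitz] allows
    one order higher; [vcons] translates between the Frechet derivative of [iterD l phi] and
    [iterD l.+1 phi]. *)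
Lemma iterD_taylor l M p q : U p -> U q ->
  (forall x, U x -> rnorm (iterD l.+2 phi x) <= M) ->
  rnorm (iterD l phi q - iterD l phi p - 'd (iterD l phi) p (q - p))
    <= M * rnorm (q - p) ^+ 2.
Proof.
move=> Up Uq HM; have /FCooP d := dphi.
pose L := 'd (iterD l phi) p (q - p).
pose g t := iterD l phi (p + rscale t (q - p)) - rscale t L.
have -> : iterD l phi q - iterD l phi p - L = g 1 - g 0.
  by rewrite /g !rscale1 !rscale0 addr0 subr0 addrAC [p + _]addrC subrK.
rewrite -[leRHS]mulr1.
apply: (@mean_value R s _ 1 g
    (fun c => 'd (iterD l phi) (p + rscale c (q - p)) (q - p) - L)) => // c cI.
  apply: rderivB; last exact: rderiv_line.
  by apply: diff_rderiv; exact/d/cU.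
apply: mlin_rnorm_le => w w1; rewrite mlinB -!iterDS//; last 2 first.
- exact: d.
- exact/d/cU.
rewrite -[X in rnorm X](mlinB (iterD l.+1 phi (p + rscale c (q - p))) (iterD l.+1 phi p)).
rewrite (le_trans (mlin_vcons_bound _ _ (lexx _) w1))// expr1n mulr1 expr2 mulrA.
rewrite ler_wpM2r ?rnorm_ge0//.
rewrite (le_trans (iterD_lipschitz Up (cU Up Uq cI) HM))// addrAC subrr add0r.
have /andP[c0 c1] := cI.
rewrite rnorm_rscale ger0_norm// ler_wpM2l//; last by rewrite ler_piMl ?rnorm_ge0.
exact: le_trans (rnorm_ge0 _) (HM p Up).
Qed.

End Convex.
End IteratedDerivativeEstimates.

(** * Curves with quadratic remainder and the fixed point *)

Lemma le_absorb (R : realType) (tau a x : R) : tau < 1 -> x <= a + tau * x -> x <= a / (1 - tau).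
Proof.
by move=> t1; rewrite -lerBlDr -[X in X - _]mul1r -mulrBl mulrC -ler_pdivlMr ?subr_gt0.
Qed.

Section FinUniform.
Variable R : realType.

Lemma fin_uniform n (P : 'I_n -> R -> Prop) :
  (forall j C C', C <= C' -> P j C -> P j C') ->
  (forall j, exists C, P j C) -> exists2 C, 0 <= C & forall j, P j C.
Proof.
move=> mono /choice[C HC]; exists (\sum_j `|C j|); first by apply: sumr_ge0.
move=> j; apply: mono (HC j); rewrite (le_trans (ler_norm _))//.
by rewrite (bigD1 j)//= lerDl sumr_ge0.
Qed.
End FinUniform.

Section QuadraticDerivative.
Context {R : realType} {s : scalar_kind}.
Local Notation K := (scalars R s).
Variable S : set R.

(** A quadratic remainder instead of a little-o, so that the rules below only combine constants. In
    the applications S consists of the parameters at which the fixed point is available, and it need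
    not be a neighborhood of 0. The constant is purely qualitative: uniform bounds come later, from
    bounds on the derivatives themselves. *)
Definition qder (V : normedModType K) (g : R -> V) (d : V) := exists C : R,
  forall t, S t -> `|t| <= 1 -> rnorm (g t - g 0 - rscale t d) <= C * t ^+ 2.

Section Rules.
Variable V : normedModType K.
Implicit Types (g h : R -> V) (x y d : V).

Lemma qder_ge0 g d : qder g d -> exists2 C : R, 0 <= C &
  forall t, S t -> `|t| <= 1 -> rnorm (g t - g 0 - rscale t d) <= C * t ^+ 2.
Proof.
move=> [C HC]; exists `|C| => // t St t1; rewrite (le_trans (HC t St t1))//.
by rewrite ler_wpM2r ?sqr_ge0// ler_norm.
Qed.

Lemma qder_lip g d : qder g d -> exists2 C : R, 0 <= C &
  forall t, S t -> `|t| <= 1 -> rnorm (g t - g 0) <= C * `|t|.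
Proof.
move=> /qder_ge0[C C0 HC]; exists (C + rnorm d); first by rewrite addr_ge0 ?rnorm_ge0.
move=> t St t1; rewrite -(subrK (rscale t d) (g t - g 0)) (le_trans (rnormD _ _))//.
rewrite mulrDl lerD//; last by rewrite rnorm_rscale mulrC.
rewrite (le_trans (HC t St t1))// ler_wpM2l// -[t ^+ 2]real_normK ?num_real// expr2.
by rewrite ler_piMl.
Qed.

Lemma qder_cst x : qder (fun=> x) 0.
Proof. by exists 0 => t _ _; rewrite subrr rscaler0 subrr rnorm0 mul0r. Qed.

Lemma qderD g h x y : qder g x -> qder h y -> qder (fun t => g t + h t) (x + y).
Proof.
move=> [C HC] [D HD]; exists (C + D) => t St t1.
have -> : g t + h t - (g 0 + h 0) - rscale t (x + y) =
  (g t - g 0 - rscale t x) + (h t - h 0 - rscale t y) by rlin.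
by rewrite (le_trans (rnormD _ _))// mulrDl lerD ?HC ?HD.
Qed.

Lemma qder_sum n (g : 'I_n -> R -> V) (d : 'I_n -> V) :
  (forall j, qder (g j) (d j)) -> qder (fun t => \sum_j g j t) (\sum_j d j).
Proof.
elim: n g d => [|n ih] g d H.
  have -> : (fun t => \sum_(j < 0) g j t) = (fun=> 0).
    by apply/funext => t; rewrite big_ord0.
  by rewrite big_ord0; exact: qder_cst.
have -> : (fun t => \sum_(j < n.+1) g j t) =
    (fun t => g ord0 t + \sum_(j < n) g (lift ord0 j) t).
  by apply/funext => t; rewrite big_ord_recl.
by rewrite big_ord_recl; apply: qderD => //; exact: ih.
Qed.
End Rules.

(** The remainder splits into that of F at the fixed arguments u 0, a product of the increments of F
    and of u, and the remainder of the fixed multilinear map F 0 along u. *)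
Lemma qder_mlin (X Y : normedModType K) m (F : R -> mlin m X Y) F'
    (u : R -> 'I_m -> X) (u' : 'I_m -> X) :
  qder F F' -> (forall j, qder (u^~ j) (u' j)) ->
  qder (fun t => F t (u t)) (F' (u 0) + \sum_j F 0 (dfwith (u 0) j (u' j))).
Proof.
move=> dF du.
have [C C0 HC] := qder_ge0 dF; have [L L0 HL] := qder_lip dF.
have [B B0 HB] : exists2 B : R, 0 <= B & forall j,
    [/\ rnorm (u 0 j) <= B, rnorm (u' j) <= B, forall t, S t -> `|t| <= 1 -> rnorm (u t j) <= B,
     forall t, S t -> `|t| <= 1 -> rnorm (u t j - u 0 j) <= B * `|t| &
     forall t, S t -> `|t| <= 1 -> rnorm (u t j - u 0 j - rscale t (u' j)) <= B * t ^+ 2].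
  apply: fin_uniform => [j B B' BB' [H1 H2 H3 H4 H5]|j].
    split; rewrite ?(le_trans _ BB')//.
    - by move=> t St t1; rewrite (le_trans (H3 t St t1)).
    - by move=> t St t1; rewrite (le_trans (H4 t St t1))// ler_wpM2r.
    - by move=> t St t1; rewrite (le_trans (H5 t St t1))// ler_wpM2r// sqr_ge0.
  have [D D0 HD] := qder_ge0 (du j); have [E E0 HE] := qder_lip (du j).
  exists (rnorm (u 0 j) + rnorm (u' j) + D + E); split.
  - by rewrite -!addrA lerDl !addr_ge0 ?rnorm_ge0.
  - by rewrite -addrA addrAC lerDr !addr_ge0 ?rnorm_ge0.
  - move=> t St t1; rewrite -(subrK (u 0 j) (u t j)) addrC (le_trans (rnormD _ _))//.
    rewrite -!addrA lerD2l addrA (@le_trans _ _ E)//; last first.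
      by rewrite lerDr addr_ge0 ?rnorm_ge0.
    by rewrite (le_trans (HE t St t1))// ler_piMr.
  - move=> t St t1; rewrite (le_trans (HE t St t1))// ler_wpM2r// lerDr.
    by rewrite !addr_ge0 ?rnorm_ge0.
  - move=> t St t1; rewrite (le_trans (HD t St t1))// ler_wpM2r ?sqr_ge0//.
    by rewrite -addrA addrCA lerDl !addr_ge0 ?rnorm_ge0.
pose B1 := B + 1; have B11 : 1 <= B1 by rewrite lerDr.
have BB1 : B <= B1 by rewrite lerDl.
pose M := rnorm (F 0).
exists (C * B1 ^+ m + m%:R * (L * B1 ^+ m * B1) +
  m%:R * (M * B1 ^+ m * B1 + m%:R * (M * B1 ^+ m * B1))) => t St t1.
have -> : F t (u t) - F 0 (u 0) -
    rscale t (F' (u 0) + \sum_j F 0 (dfwith (u 0) j (u' j))) =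
  (F t - F 0 - rscale t F') (u 0) + ((F t - F 0) (u t) - (F t - F 0) (u 0))
  + (F 0 (u t) - F 0 (u 0) - rscale t (\sum_j F 0 (dfwith (u 0) j (u' j)))).
  by rewrite !(mlinB, mlin_rscale); rlin.
have b0 j : rnorm (u 0 j) <= B1 by have [H _ _ _ _] := HB j; exact: le_trans BB1.
have b1 j : rnorm (u t j) <= B1 by have [_ _ H _ _] := HB j; exact: le_trans (H t St t1) BB1.
have b2 j : rnorm (u t j - u 0 j) <= B1 * `|t|.
  by have [_ _ _ H _] := HB j; rewrite (le_trans (H t St t1))// ler_wpM2r.
have b3 j : rnorm (u t j - u 0 j - rscale t (u' j)) <= B1 * t ^+ 2.
  by have [_ _ _ _ H] := HB j; rewrite (le_trans (H t St t1))// ler_wpM2r// sqr_ge0.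
have b4 j : rnorm (u' j) <= B1 by have [_ H _ _ _] := HB j; exact: le_trans BB1.
have [lF0 _] := mlinP (F 0); have [lFt _] := mlinP (F t - F 0).
have [lFq _] := mlinP (F t - F 0 - rscale t F').
have B1p : 0 < B1 by apply: lt_le_trans B11.
have B1m : 0 <= B1 ^+ m by rewrite exprn_ge0// ltW.
rewrite 2!mulrDl (le_trans (rnormD _ _))// lerD//; last first.
  rewrite -[leRHS]mulrA.
  exact: (multilinear_taylor lF0 (mlin_unit_bounded (F 0)) B11 b0 b1 b2 b4 b3).
rewrite (le_trans (rnormD _ _))// lerD//.
  rewrite (le_trans (multilinear_bound lFq (mlin_unit_bounded _) B1p b0))//.
  by rewrite mulrAC ler_wpM2r// HC.
rewrite (le_trans (multilinear_lipschitz lFt (mlin_unit_bounded _) B11 b0 b1 b2))//.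
rewrite -[leRHS]mulrA ler_wpM2l// -[t ^+ 2]real_normK ?num_real//.
have -> : L * B1 ^+ m * B1 * `|t| ^+ 2 = (L * `|t|) * (B1 ^+ m * (B1 * `|t|)) by ring.
rewrite -[leLHS]mulrA ler_wpM2r ?HL//.
by rewrite !mulr_ge0// ltW.
Qed.

End QuadraticDerivative.

Section FixedPoints.
Context {R : realType} {s : scalar_kind}.
Local Notation K := (scalars R s).
Variable X : completeNormedModType K.
Variable tau : R.
Hypothesis tau01 : 0 <= tau < 1.

Let tau1 : tau < 1. Proof. by case/andP: tau01. Qed.
Let tau1' : 0 < 1 - tau. Proof. by rewrite subr_gt0. Qed.

Lemma absorb_eq0 (x : X) : rnorm x <= tau * rnorm x -> x = 0.
Proof.
rewrite -[leRHS]add0r => /(le_absorb tau1); rewrite mul0r => x0.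
by apply: rnorm0_eq0; apply/eqP; rewrite eq_le x0 rnorm_ge0.
Qed.

Lemma rnorm_iterD0 (phi : X -> X) x : rnorm (iterD 0 phi x) = rnorm (phi x).
Proof.
apply/eqP; rewrite eq_le; apply/andP; split.
  by apply: mlin_rnorm_le => v _; rewrite iterD0E.
rewrite -(iterD0E phi x (fun=> 0)).
by apply: mlin_unit_bounded => i; rewrite rnorm0.
Qed.

Lemma rnorm_mlin0_le (f : mlin 0 X X) v : rnorm (f v) <= rnorm f.
Proof.
by have := mlin_unit_bounded f; apply; case.
Qed.

Section Resolvent.
Variable A : mlin 1 X X.
Hypothesis Atau : rnorm A <= tau.

Lemma mlin1_vcons (x : X) : (fun=> x) = vcons x (fun _ : 'I_0 => 0).
Proof.
by apply/funext => i; rewrite (ord1 i) vcons0.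
Qed.

Lemma mlin1_lin (f : mlin 1 X X) a x y :
  f (fun=> a *: x + y) = a *: f (fun=> x) + f (fun=> y).
Proof. by rewrite !mlin1_vcons mlin_vcons_lin. Qed.

Lemma mlin1B (f : mlin 1 X X) x y : f (fun=> x - y) = f (fun=> x) - f (fun=> y).
Proof.
by have := mlin1_lin f (-1) y x; rewrite !scaleN1r [- y + x]addrC => ->; rewrite addrC.
Qed.

Lemma mlin1Z (f : mlin 1 X X) a x : f (fun=> a *: x) = a *: f (fun=> x).
Proof.
have f0 : f (fun=> 0) = 0 by have := mlin1B f 0 0; rewrite !subrr.
by have := mlin1_lin f a x 0; rewrite f0 !addr0.
Qed.

Lemma mlin1_bound (f : mlin 1 X X) x : rnorm (f (fun=> x)) <= rnorm f * rnorm x.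
Proof.
rewrite mlin1_vcons (le_trans (mlin_vcons_bound (B := 1) _ _ _ _))//; first by case.
by rewrite expr1n mulr1.
Qed.

Lemma mlin1_tau x : rnorm (A (fun=> x)) <= tau * rnorm x.
Proof. by rewrite (le_trans (mlin1_bound _ _))// ler_wpM2r// rnorm_ge0. Qed.

(** This is (1 - A)^-1 w, obtained as a fixed point rather than as a Neumann series. The default 0
    is not reached when the norm of A is at most tau. *)
Definition resolvent (w : X) : X := xget 0 [set u | u = w + A (fun=> u)].

Lemma resolventP w : resolvent w = w + A (fun=> resolvent w).
Proof.
have [||||x _ /esym xE] := @contraction_fixpoint R s X setT (fun u => w + A (fun=> u)) tau 0 tau01.
- by [].
- by [].
- by move=> x y _ _; rewrite opprD addrACA subrr add0r -mlin1B mlin1_tau.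
- by [].
rewrite /resolvent; case: xgetP => [u _ //|/(_ x)]; by case.
Qed.

Lemma resolvent_uniq w u : u = w + A (fun=> u) -> u = resolvent w.
Proof.
move=> uE; apply/eqP; rewrite -subr_eq0; apply/eqP/absorb_eq0.
rewrite {1}uE {1}resolventP opprD addrACA subrr add0r -mlin1B; exact: mlin1_tau.
Qed.

Lemma resolvent_lin a u v : resolvent (a *: u + v) = a *: resolvent u + resolvent v.
Proof.
apply/esym/resolvent_uniq; rewrite mlin1_lin {1}(resolventP u) {1}(resolventP v).
by rlin.
Qed.

Lemma resolvent_bound w : rnorm (resolvent w) <= rnorm w / (1 - tau).
Proof.
apply: le_absorb => //; rewrite {1}resolventP (le_trans (rnormD _ _))// lerD2l.
exact: mlin1_tau.
Qed.

End Resolvent.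

(** Differentiating u = w + F u gives d = (w' + F' u) + F d, an equation for d with the same
    operator. The increment of u, and then its remainder, satisfy equations of this form too, so
    each is bounded by an error plus tau times itself, and [le_absorb] applies. *)
Lemma qder_resolvent (S : set R) (F : R -> mlin 1 X X) F' (w : R -> X) w' : S 0 ->
  (forall t, S t -> rnorm (F t) <= tau) -> qder S F F' -> qder S w w' ->
  qder S (fun t => resolvent (F t) (w t))
    (resolvent (F 0) (w' + F' (fun=> resolvent (F 0) (w 0)))).
Proof.
move=> S0 Ftau dF dw.
have F0tau := Ftau 0 S0.
have [u uE] : exists u : R -> X, forall t, u t = resolvent (F t) (w t).
  by exists (fun t => resolvent (F t) (w t)).
rewrite -(uE 0); set d := resolvent (F 0) _.
have dE : d = w' + F' (fun=> u 0) + F 0 (fun=> d) by exact: resolventP.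
have uP t : S t -> u t = w t + F t (fun=> u t).
  by move=> St; rewrite uE; exact: resolventP (Ftau t St) (w t).
have uP0 := uP 0 S0.
have uB' t : S t -> rnorm (u t) <= rnorm (w t) / (1 - tau).
  by move=> St; rewrite uE; exact: resolvent_bound (Ftau t St) (w t).
have -> : (fun t => resolvent (F t) (w t)) = u by apply/funext => t; rewrite uE.
move: d dE {uE} => d dE.
have [C C0 HC] := qder_ge0 dw; have [L L0 HL] := qder_lip dw.
have [CF CF0 HCF] := qder_ge0 dF; have [LF LF0 HLF] := qder_lip dF.
have [B B0 uB] : exists2 B, 0 <= B & forall t, S t -> `|t| <= 1 -> rnorm (u t) <= B.
  exists ((rnorm (w 0) + L) / (1 - tau)).
    by apply: divr_ge0 (ltW tau1'); exact: addr_ge0 (rnorm_ge0 _) L0.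
  move=> t St t1; apply: le_trans (uB' t St) _.
  rewrite ler_wpM2r ?invr_ge0 ?(ltW tau1')// -(subrK (w 0) (w t)) addrC.
  rewrite (le_trans (rnormD _ _))// lerD2l (le_trans (HL t St t1))//.
  by rewrite ler_piMr.
have [Lu Lu0 lip] : exists2 Lu, 0 <= Lu &
    forall t, S t -> `|t| <= 1 -> rnorm (u t - u 0) <= Lu * `|t|.
  exists ((L + LF * B) / (1 - tau)).
    by apply: divr_ge0 (ltW tau1'); exact: addr_ge0 L0 (mulr_ge0 LF0 B0).
  move=> t St t1; rewrite mulrAC; apply: le_absorb => //.
  have E : u t - u 0 = (w t - w 0) + (F t - F 0) (fun=> u t) + F 0 (fun=> u t - u 0).
    by rewrite {1}(uP t St) {1}uP0 mlin1B mlinB; rlin.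
  rewrite {1}E (le_trans (rnormD _ _))// lerD//; last exact: mlin1_tau.
  rewrite mulrDl (le_trans (rnormD _ _))// lerD ?HL//.
  rewrite (le_trans (mlin1_bound _ _))// mulrAC ler_pM ?rnorm_ge0//.
    exact: HLF.
  exact: uB.
exists ((C + CF * B + LF * Lu) / (1 - tau)) => t St t1.
rewrite mulrAC; apply: le_absorb => //.
have E : u t - u 0 - rscale t d = (w t - w 0 - rscale t w')
   + (F t - F 0 - rscale t F') (fun=> u 0) + (F t - F 0) (fun=> u t - u 0)
   + F 0 (fun=> u t - u 0 - rscale t d).
  have -> : F 0 (fun=> u t - u 0 - rscale t d) = F 0 (fun=> u t - u 0) - rscale t (F 0 (fun=> d)).
    by rewrite mlin1B; congr (_ - _); exact: mlin1Z.
  by rewrite {1}(uP t St) {1}uP0 {1}dE !(mlinB, mlin_rscale, mlin1B); rlin.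
rewrite {1}E (le_trans (rnormD _ _))// lerD//; last exact: mlin1_tau.
rewrite 2!mulrDl (le_trans (rnormD _ _))// lerD//; last first.
  rewrite (le_trans (mlin1_bound _ _))//.
  rewrite -[t ^+ 2]real_normK ?num_real// expr2.
  have -> : LF * Lu * (`|t| * `|t|) = LF * `|t| * (Lu * `|t|) by ring.
  by apply: ler_pM; rewrite ?rnorm_ge0//; [exact: HLF|exact: lip].
rewrite (le_trans (rnormD _ _))// lerD//; first exact: HC.
rewrite (le_trans (mlin1_bound _ _))// mulrAC.
apply: ler_pM; rewrite ?rnorm_ge0//; first exact: HCF.
by apply: uB => //; rewrite normr0.
Qed.

Variables (U Ut : set X) (rho : R).
Hypothesis rho0 : 0 <= rho.
Hypothesis oU : open U.
Hypothesis cU : forall p q t, U p -> U q -> 0 <= t <= 1 -> U (p + rscale t (q - p)).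
Hypothesis UtU : forall y x, Ut y -> rnorm (x - y) <= rho -> U x.

(** Non-strict bounds, so that the condition passes to convex combinations. The last one keeps the
    map sending x to y + chi x inside the closed ball of radius rho around y. *)
Definition contractive (chi : X -> X) := [/\ FCoo U chi,
  forall x, U x -> rnorm (iterD 1 chi x) <= tau & forall x, U x -> rnorm (chi x) <= rho].

Section Sigma.
Variable chi : X -> X.
Hypothesis hchi : contractive chi.

Lemma lipschitz_iterD0 (phi : X -> X) M x y : FCoo U phi ->
  (forall x, U x -> rnorm (iterD 1 phi x) <= M) -> U x -> U y ->
  rnorm (phi x - phi y) <= M * rnorm (x - y).
Proof.
move=> dphi phi1 Ux Uy; apply: le_trans (iterD_lipschitz cU dphi Uy Ux phi1).
by apply: le_trans (rnorm_mlin0_le _ (fun=> 0)); rewrite mlinB !iterD0E.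
Qed.

Lemma contractive_lipschitz x y : U x -> U y -> rnorm (chi x - chi y) <= tau * rnorm (x - y).
Proof. by move=> Ux Uy; have [d c _] := hchi; exact: lipschitz_iterD0. Qed.

(** The preimage of y under id - chi. For y in [Ut] it exists by contraction on the closed ball of
    radius rho around y, so the default is not reached. *)
Definition sigma (y : X) : X := xget y [set x | U x /\ x = y + chi x].

Lemma sigmaP y : Ut y -> U (sigma y) /\ sigma y = y + chi (sigma y).
Proof.
move=> Uty; have [_ _ chi0] := hchi.
have [||||x xy /esym xE] := @contraction_fixpoint R s X [set x | rnorm (x - y) <= rho]
    (fun x => y + chi x) tau y tau01.
- by rewrite /= subrr rnorm0.
- by move=> x /= xy; rewrite [y + _]addrC addrK chi0//; exact: UtU xy.
- move=> x z /= xy zy; rewrite opprD addrACA subrr add0r.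
  by apply: contractive_lipschitz; apply: UtU; eassumption.
- move=> x H /=; apply/ler_addgt0Pr => e e0; have [z /= zy xz] := H e e0.
  by rewrite (le_trans (rnorm_tri z _ _))// addrC lerD// rnormBC ltW.
rewrite /sigma; case: xgetP => [u _ //|/(_ x)]; case; split=> //; exact: UtU xy.
Qed.

Lemma sigma_dist y : Ut y -> U y -> rnorm (sigma y - y) <= rnorm (chi y) / (1 - tau).
Proof.
move=> Uty Uy; have [Us sE] := sigmaP Uty.
apply: le_absorb => //; rewrite {1}sE [y + _]addrC addrK.
rewrite -(subrK (chi y) (chi (sigma y))) addrC (le_trans (rnormD _ _))// lerD2l.
exact: contractive_lipschitz.
Qed.

End Sigma.

(** An environment e lists the maps of an expression: e 0 is the chi that defines sigma, the others
    are directions of differentiation. *)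
Definition bounded_family (e : nat -> X -> X) :=
  (forall k, FCoo U (e k)) /\
  (forall k m, exists M, forall x, U x -> rnorm (iterD m (e k) x) <= M).

Definition eline (e e' : nat -> X -> X) (a : R) : nat -> X -> X :=
  fun k => (ofR a : K) *: e' k + e k.

Lemma iterD_eline e e' a k m x : bounded_family e -> bounded_family e' -> U x ->
  iterD m (eline e e' a k) x = rscale a (iterD m (e' k) x) + iterD m (e k) x.
Proof.
by move=> [de _] [de' _] Ux; have [-> _] := iterD_lin (ofR a : K) oU (de' k) (de k) m Ux.
Qed.

Lemma eline0 e e' : eline e e' 0 = e.
Proof.
apply: functional_extensionality_dep => k.
by rewrite /eline ofR0 scale0r add0r.
Qed.

Section Lines.
Variables (e e' : nat -> X -> X) (y z : X).
Hypothesis ce : contractive (e 0).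
Hypothesis be : bounded_family e.
Hypothesis be' : bounded_family e'.
Hypothesis Uty : Ut y.

Let S : set R := [set t | contractive (eline e e' t 0) /\ Ut (y + rscale t z)].
Let p t := sigma (eline e e' t 0) (y + rscale t z).
Let x0 := sigma (e 0) y.

Let p0 : p 0 = x0.
Proof. by rewrite /p eline0 rscale0 addr0. Qed.

Let Ux0 : U x0. Proof. by have [] := sigmaP ce Uty. Qed.
Let x0E : x0 = y + e 0 x0. Proof. by have [] := sigmaP ce Uty. Qed.

Let Up t : S t -> U (p t).
Proof. by move=> [c ut]; have [] := sigmaP c ut. Qed.

Let pE t : S t -> p t = y + rscale t z + (rscale t (e' 0 (p t)) + e 0 (p t)).
Proof. by move=> [c ut]; have [_ H] := sigmaP c ut; exact: H. Qed.

Let dp := resolvent (iterD 1 (e 0) x0) (z + e' 0 x0).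

(** Implicit differentiation of p = y + t z + (e 0 + t e' 0)(p) yields dp = z + e' 0 x0 + D (e
    0)(x0) dp, hence the resolvent in [dp]. Both the Lipschitz bound and the remainder are obtained
    by absorbing tau times the unknown quantity. *)
Lemma qder_sigma : qder S p dp.
Proof.
have [de ce1 _] := ce; have [de' be1'] := be'; have [_ be1] := be.
have [M HM] := be1' 0 0; have [M1 HM1] := be1' 0 1; have [M2 HM2] := be1 0 2.
have M20 : 0 <= M2 by apply: le_trans (HM2 x0 Ux0); exact: rnorm_ge0.
have M10 : 0 <= M1 by apply: le_trans (HM1 x0 Ux0); exact: rnorm_ge0.
pose L := (rnorm z + M) / (1 - tau).
exists ((M1 * L + M2 * L ^+ 2) / (1 - tau)) => t St t1; rewrite p0.
have lip : rnorm (p t - x0) <= L * `|t|.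
  rewrite /L mulrAC; apply: le_absorb => //.
  have E : p t - x0 = rscale t (z + e' 0 (p t)) + (e 0 (p t) - e 0 x0).
    by rewrite {1}(pE St) {1}x0E; rlin.
  rewrite {1}E (le_trans (rnormD _ _))// lerD//; last exact: (contractive_lipschitz ce (Up St) Ux0).
  rewrite rnorm_rscale mulrC ler_wpM2r// (le_trans (rnormD _ _))// lerD2l.
  by rewrite -rnorm_iterD0; exact/HM/Up.
rewrite mulrAC; apply: le_absorb => //.
pose A := iterD 1 (e 0) x0.
have At : rnorm A <= tau by exact: ce1.
have dpE : dp = z + e' 0 x0 + A (fun=> dp) by exact: resolventP.
have E : p t - x0 - rscale t dp = rscale t (e' 0 (p t) - e' 0 x0)
    + (e 0 (p t) - e 0 x0 - A (fun=> p t - x0)) + A (fun=> p t - x0 - rscale t dp).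
  have -> : A (fun=> p t - x0 - rscale t dp) = A (fun=> p t - x0) - rscale t (A (fun=> dp)).
    by rewrite mlin1B; congr (_ - _); exact: mlin1Z.
  by rewrite {1}(pE St) {1}x0E {1}dpE; rlin.
rewrite {1}E {E} (le_trans (rnormD _ _))// lerD//; last exact: mlin1_tau.
rewrite mulrDl (le_trans (rnormD _ _))// lerD//.
  rewrite rnorm_rscale -[t ^+ 2]real_normK ?num_real// expr2 mulrA mulrC.
  rewrite ler_wpM2r// -mulrA (le_trans (lipschitz_iterD0 (de' 0) HM1 (Up St) Ux0))//.
  by rewrite ler_wpM2l.
have := iterD_taylor cU de Ux0 (Up St) HM2.
have /FCooP d := de.
have E : rnorm (e 0 (p t) - e 0 x0 - A (fun=> p t - x0)) <=
    rnorm (iterD 0 (e 0) (p t) - iterD 0 (e 0) x0 - 'd (iterD 0 (e 0)) x0 (p t - x0)).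
  apply: le_trans (rnorm_mlin0_le _ (fun=> 0)).
  rewrite !mlinB !iterD0E (mlin1_vcons (p t - x0)) /A iterDS//; exact: d.
move=> /(le_trans E)/le_trans; apply.
rewrite -mulrA ler_wpM2l// -[t ^+ 2]real_normK ?num_real// -exprMn.
by rewrite lerXn2r ?nnegrE ?rnorm_ge0// (le_trans (rnorm_ge0 _) lip).
Qed.

Lemma qder_iterD m k : qder S (fun t => iterD m (eline e e' t k) (p t))
  (iterD m (e' k) x0 + 'd (iterD m (e k)) x0 dp).
Proof.
have [de' be1'] := be'; have [de be1] := be.
have [M1 HM1] := be1' k m.+1; have [M2 HM2] := be1 k m.+2; have [M0 HM0] := be1 k m.+1.
have M20 : 0 <= M2 by apply: le_trans (HM2 x0 Ux0); exact: rnorm_ge0.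
have M10 : 0 <= M1 by apply: le_trans (HM1 x0 Ux0); exact: rnorm_ge0.
have M00 : 0 <= M0 by apply: le_trans (HM0 x0 Ux0); exact: rnorm_ge0.
have [C C0 HC] := qder_ge0 qder_sigma; have [L L0 HL] := qder_lip qder_sigma.
exists (M1 * L + M2 * L ^+ 2 + M0 * C) => t St t1.
have := HC t St t1; have := HL t St t1; rewrite p0 => lip quad.
rewrite eline0 iterD_eline//; last exact: Up.
have /FCooP d := de k; have dx := d m x0 Ux0.
have -> : rscale t (iterD m (e' k) (p t)) + iterD m (e k) (p t) - iterD m (e k) x0 -
      rscale t (iterD m (e' k) x0 + 'd (iterD m (e k)) x0 dp) =
    rscale t (iterD m (e' k) (p t) - iterD m (e' k) x0) +
    (iterD m (e k) (p t) - iterD m (e k) x0 - 'd (iterD m (e k)) x0 (p t - x0))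
    + 'd (iterD m (e k)) x0 (p t - x0 - rscale t dp).
  have -> : 'd (iterD m (e k)) x0 (p t - x0 - rscale t dp) =
      'd (iterD m (e k)) x0 (p t - x0) - rscale t ('d (iterD m (e k)) x0 dp).
    by rewrite linearB; congr (_ - _); exact: linearZ_LR.
  by rlin.
rewrite 2!mulrDl (le_trans (rnormD _ _))// lerD//; last first.
  rewrite (le_trans (diff_iterD_bound _ dx))// -mulrA ler_pM ?rnorm_ge0//.
  exact: HM0.
rewrite (le_trans (rnormD _ _))// lerD//.
  rewrite rnorm_rscale -[t ^+ 2]real_normK ?num_real// expr2 mulrA mulrC.
  rewrite ler_wpM2r// -mulrA (le_trans (iterD_lipschitz cU (de' k) Ux0 (Up St) HM1))//.
  by rewrite ler_wpM2l.
rewrite (le_trans (iterD_taylor cU (de k) Ux0 (Up St) HM2))//.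
rewrite -mulrA ler_wpM2l// -[t ^+ 2]real_normK ?num_real// -exprMn.
by rewrite lerXn2r ?nnegrE ?rnorm_ge0// (le_trans (rnorm_ge0 _) lip).
Qed.

End Lines.
End FixedPoints.

(** * Expressions and their derivatives *)

(* Expressions in a point y, vectors v n and maps e k: [Comp k ts] is
   D^m (e k) (sigma y) (ts), and [Res t] is (1 - D (e 0) (sigma y))^-1 t, where
   sigma y = y + e 0 (sigma y). *)
Inductive term : Type :=
  | Vec of nat
  | Sum n of 'I_n -> term
  | Comp m of nat & 'I_m -> term
  | Res of term.

Definition tadd (a b : term) : term := Sum (fun i : 'I_2 => if i == ord0 then a else b).

Definition tcons m (a : term) (ts : 'I_m -> term) : 'I_m.+1 -> term :=
  fun i => if unlift ord0 i is Some j then ts j else a.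

(* [der t] differentiates t with the maps e k in the directions e' k and the
   point y in the direction z; e and e' are stored at the even and odd indices,
   and z before the vectors. *)
Fixpoint shift_term (t : term) : term :=
  match t with
  | Vec n => Vec n.+1
  | Sum n ts => Sum (fun j => shift_term (ts j))
  | Comp m k ts => Comp k.*2 (fun j => shift_term (ts j))
  | Res t => Res (shift_term t)
  end.

(** The derivative of sigma: in the environment [mix e e'], entry 1 is e' 0 and vector 0 is the
    direction z, so this is the resolvent applied to z + e' 0 (sigma y). The inner [Vec 0] merely
    fills a function on the empty type. *)
Definition dsigma : term :=
  Res (tadd (Vec 0) (Comp 1 (fun _ : 'I_0 => Vec 0))).

(** For [Comp] the summands differentiate the map, the point sigma y and the arguments. For [Res], u
    = t + A u gives u' = (1 - A)^-1 (t' + A' u), where A' consists of D (e' 0), the term [Comp 1 u],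
    and of D^2 (e 0) along [dsigma], the term with [Comp 0]. *)
Fixpoint der (t : term) : term :=
  match t with
  | Vec _ => Sum (fun _ : 'I_0 => Vec 0)
  | Sum n ts => Sum (fun j => der (ts j))
  | Comp m k ts =>
      let us := fun j => shift_term (ts j) in
      tadd (tadd (Comp k.*2.+1 us) (Comp k.*2 (tcons dsigma us)))
           (Sum (fun j => Comp k.*2 (dfwith us j (der (ts j)))))
  | Res t =>
      let u := fun _ : 'I_1 => Res (shift_term t) in
      Res (tadd (der t) (tadd (Comp 1 u) (Comp 0 (tcons dsigma u))))
  end.

(** Interleaving leaves e 0 at index 0, so a differentiated expression is evaluated at the same
    sigma y. *)
Definition mix (T : Type) (e e' : nat -> T) : nat -> T :=
  fun n => if odd n then e' n./2 else e n./2.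

Definition scons (T : Type) (z : T) (v : nat -> T) : nat -> T :=
  fun n => if n is n'.+1 then v n' else z.

Lemma mix_even T (e e' : nat -> T) k : mix e e' k.*2 = e k.
Proof. by rewrite /mix odd_double doubleK. Qed.

Lemma mix_odd T (e e' : nat -> T) k : mix e e' k.*2.+1 = e' k.
Proof. by rewrite /mix /= odd_double /= uphalf_double. Qed.

#[local] Arguments Defs.iterD : simpl never.

Section Terms.
Context {R : realType} {s : scalar_kind}.
Local Notation K := (scalars R s).
Variable X : completeNormedModType K.
Variables (tau rho : R) (U Ut : set X).
Hypothesis tau01 : 0 <= tau < 1.
Hypothesis rho0 : 0 <= rho.
Hypothesis oU : open U.
Hypothesis cU : forall p q t, U p -> U q -> 0 <= t <= 1 -> U (p + rscale t (q - p)).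
Hypothesis UtU : forall y x, Ut y -> rnorm (x - y) <= rho -> U x.

Local Notation env := (nat -> X -> X).
Local Notation contr := (contractive tau U rho).
Local Notation bfam := (bounded_family U).

Section Eval.
Variables (e : env) (v : nat -> X) (y : X).

Fixpoint eval (t : term) : X :=
  match t with
  | Vec n => v n
  | Sum n ts => \sum_j eval (ts j)
  | Comp m k ts => iterD m (e k) (sigma U (e 0) y) (fun j => eval (ts j))
  | Res t => resolvent (iterD 1 (e 0) (sigma U (e 0) y)) (eval t)
  end.

Lemma eval_tadd a b : eval (tadd a b) = eval a + eval b.
Proof. by rewrite /= big_ord_recl big_ord1. Qed.

Lemma eval_res t :
  eval (Res t) = resolvent (iterD 1 (e 0) (sigma U (e 0) y)) (eval t).
Proof. by []. Qed.

Lemma eval_comp m k (ts : 'I_m -> term) :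
  eval (Comp k ts) = iterD m (e k) (sigma U (e 0) y) (fun j => eval (ts j)).
Proof. by []. Qed.

Lemma eval_tcons m a (ts : 'I_m -> term) :
  (fun j => eval (tcons a ts j)) = vcons (eval a) (fun j => eval (ts j)).
Proof. by apply/funext => i; rewrite /tcons /vcons; case: unlift. Qed.

Lemma eval_dfwith m (ts : 'I_m -> term) i a :
  (fun j => eval (dfwith ts i a j)) = dfwith (fun j => eval (ts j)) i (eval a).
Proof.
apply/funext => j; have [<-|ij] := eqVneq i j; first by rewrite !dfwithin.
by rewrite !dfwithout.
Qed.

End Eval.

Lemma eval_shift e e' v z y t : eval (mix e e') (scons z v) y (shift_term t) = eval e v y t.
Proof.
elim: t => [//|n ts ih|m k ts ih|t ih] /=.
- exact: eq_bigr.
- by rewrite mix_even; congr (_ _); apply/funext => j.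
- by rewrite ih.
Qed.

Lemma eval_dsigma e e' v z y : eval (mix e e') (scons z v) y dsigma =
  resolvent (iterD 1 (e 0) (sigma U (e 0) y)) (z + e' 0 (sigma U (e 0) y)).
Proof. by rewrite /= big_ord_recl big_ord1 /= iterD0E. Qed.

Lemma bfam_diff (e : env) k m x : bfam e -> U x -> differentiable (iterD m (e k)) x.
Proof. by move=> [/(_ k)/FCooP d _]; exact: d. Qed.

Lemma bfam_mix e e' : bfam e -> bfam e' -> bfam (mix e e').
Proof.
move=> [de be] [de' be']; split=> [k|k m]; rewrite /mix; first by case: ifP.
by case: ifP.
Qed.

Lemma bfam0 : bfam (fun=> 0).
Proof.
split=> [k|k m]; first exact: FCoo0.
by exists 0 => x _; rewrite iterD_cst0 [X in rnorm X](_ : _ = 0)// rnorm0.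
Qed.

Lemma bfam_lin a e e' : bfam e -> bfam e' -> bfam (fun k => a *: e' k + e k).
Proof.
move=> [de be] [de' be']; split=> [k|k m]; first exact: FCoo_lin.
have [M HM] := be k m; have [M' HM'] := be' k m.
exists (rnorm a * M' + M) => x Ux.
have [-> _] := iterD_lin a oU (de' k) (de k) m Ux.
rewrite (le_trans (rnormD _ _))// lerD//; last exact: HM.
by rewrite rnormZ ler_wpM2l ?rnorm_ge0//; exact: HM'.
Qed.

Lemma bfam_eline e e' a : bfam e -> bfam e' -> bfam (eline e e' a).
Proof. exact: bfam_lin. Qed.

Lemma eline_mix (e e' f f' : env) a :
  eline (mix e e') (mix f f') a = mix (eline e f a) (eline e' f' a).
Proof. by apply: functional_extensionality_dep => k; rewrite /eline /mix; case: ifP. Qed.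

Lemma eline_eline (e e' : env) a b : eline (eline e e' a) e' b = eline e e' (a + b).
Proof.
by apply: functional_extensionality_dep => k; rewrite /eline ofRD scalerDl addrCA addrA.
Qed.

Lemma eval_qder t e e' v y z : contr (e 0) -> bfam e -> bfam e' -> Ut y ->
  qder [set a | contr (eline e e' a 0) /\ Ut (y + rscale a z)]
    (fun a => eval (eline e e' a) v (y + rscale a z) t)
    (eval (mix e e') (scons z v) y (der t)).
Proof.
move=> ce be be' Uty; set S := [set a | _].
have S0 : S 0 by split; rewrite ?eline0 ?rscale0 ?addr0.
have dF := qder_iterD tau01 rho0 oU cU UtU z ce be be' Uty.
elim: t => [n|n ts ih|m k ts ih|t ih].
- rewrite /= big_ord0; exact: qder_cst.
- exact: qder_sum.
- rewrite [der _]/= !eval_tadd.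
  have -> : eval (mix e e') (scons z v) y (Comp k.*2.+1 (fun j => shift_term (ts j))) =
      iterD m (e' k) (sigma U (e 0) y) (fun j => eval e v y (ts j)).
    by rewrite /= mix_odd; congr (_ _); apply/funext => j; rewrite eval_shift.
  have -> : eval (mix e e') (scons z v) y (Comp k.*2 (tcons dsigma (fun j => shift_term (ts j)))) =
      'd (iterD m (e k)) (sigma U (e 0) y)
        (resolvent (iterD 1 (e 0) (sigma U (e 0) y)) (z + e' 0 (sigma U (e 0) y)))
        (fun j => eval e v y (ts j)).
    rewrite [LHS]/= mix_even eval_tcons eval_dsigma iterDS.
      by congr (_ _); apply/funext => j; rewrite eval_shift.
    by apply: bfam_diff => //; have [] := sigmaP tau01 rho0 cU UtU ce Uty.
  rewrite [X in _ + X]/=.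
  under eq_bigr do rewrite mix_even eval_dfwith.
  have := qder_mlin (dF m k) ih; rewrite eline0 rscale0 addr0.
  have -> : (fun j => eval (mix e e') (scons z v) y (shift_term (ts j))) =
      (fun j => eval e v y (ts j)) by apply/funext => j; rewrite eval_shift.
  exact.
- have Ux : U (sigma U (e 0) y) by have [] := sigmaP tau01 rho0 cU UtU ce Uty.
  have Ftau a : S a -> rnorm (iterD 1 (eline e e' a 0)
      (sigma U (eline e e' a 0) (y + rscale a z))) <= tau.
    move=> [c ut]; have [Ua _] := sigmaP tau01 rho0 cU UtU c ut.
    by have [_ + _] := c; exact.
  have := qder_resolvent tau01 S0 Ftau (dF 1 0) ih.
  rewrite [der _]/= eval_res !eval_tadd !eval_comp eval_tcons eval_dsigma.
  rewrite -[mix e e' 0]/(e 0) -[mix e e' 1]/(e' 0) !eline0 rscale0 addr0.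
  have -> : (fun=> eval (mix e e') (scons z v) y (Res (shift_term t))) =
      (fun _ : 'I_1 => resolvent (iterD 1 (e 0) (sigma U (e 0) y)) (eval e v y t)).
    by apply/funext => j; rewrite eval_res eval_shift.
  rewrite iterDS; last exact: bfam_diff.
  exact.
Qed.

End Terms.

Section TermsLine.
Context {R : realType} {s : scalar_kind}.
Local Notation K := (scalars R s).
Variable X : completeNormedModType K.
Variables (tau rho : R) (U Ut : set X).
Hypothesis tau01 : 0 <= tau < 1.
Hypothesis rho0 : 0 <= rho.
Hypothesis oU : open U.
Hypothesis cU : forall p q t, U p -> U q -> 0 <= t <= 1 -> U (p + rscale t (q - p)).
Hypothesis UtU : forall y x, Ut y -> rnorm (x - y) <= rho -> U x.

Local Notation env := (nat -> X -> X).
Local Notation contr := (contractive tau U rho).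
Local Notation bfam := (bounded_family U).
Local Notation eval := (eval U).

(** Each summand of [der t] contains the direction exactly once: as e' k, inside [dsigma], or inside
    the derivative of a subexpression. *)
Lemma eval_der_lin t (e e1 e2 : env) v y z1 z2 (a : K) :
  contr (e 0) -> bfam e -> bfam e1 -> bfam e2 -> Ut y ->
  eval (mix e (fun k => a *: e1 k + e2 k)) (scons (a *: z1 + z2) v) y (der t) =
  a *: eval (mix e e1) (scons z1 v) y (der t) + eval (mix e e2) (scons z2 v) y (der t).
Proof.
move=> ce be be1 be2 Uty.
have [Ux _] := sigmaP tau01 rho0 cU UtU ce Uty.
have [de1 _] := be1; have [de2 _] := be2.
have Atau : rnorm (iterD 1 (e 0) (sigma U (e 0) y)) <= tau by have [_ + _] := ce; exact.
have linD k m : iterD m (a *: e1 k + e2 k) (sigma U (e 0) y) =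
    a *: iterD m (e1 k) (sigma U (e 0) y) + iterD m (e2 k) (sigma U (e 0) y).
  by have [-> _] := iterD_lin a oU (de1 k) (de2 k) m Ux.
have linS : eval (mix e (fun k => a *: e1 k + e2 k)) (scons (a *: z1 + z2) v) y dsigma =
  a *: eval (mix e e1) (scons z1 v) y dsigma + eval (mix e e2) (scons z2 v) y dsigma.
  rewrite !eval_dsigma -(resolvent_lin tau01 Atau); congr resolvent.
  set x := sigma _ _ _.
  rewrite -[RHS]/(a *: (z1 + e1 0%N x) + (z2 + e2 0%N x)).
  rewrite -[LHS]/(a *: z1 + z2 + (a *: e1 0%N x + e2 0%N x)).
  by rlin.
elim: t => [n|n ts ih|m k ts ih|t ih].
- by rewrite /= !big_ord0 scaler0 addr0.
- by rewrite /= scaler_sumr -big_split; apply: eq_bigr => j _; rewrite ih.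
- rewrite [der _]/= !eval_tadd !eval_comp !mix_odd !mix_even !eval_tcons linS.
  rewrite -[mix e _ 0]/(e 0) -[mix e e1 0]/(e 0) -[mix e e2 0]/(e 0) linD.
  have E f z : (fun j => eval (mix e f) (scons z v) y (shift_term (ts j))) =
    (fun j => eval e v y (ts j)) by apply/funext => j; rewrite eval_shift.
  rewrite !E mlin_vcons_lin mlinD mlinZ.
  set S := Sum _.
  have -> : eval (mix e (fun k => a *: e1 k + e2 k)) (scons (a *: z1 + z2) v) y S =
    a *: eval (mix e e1) (scons z1 v) y S + eval (mix e e2) (scons z2 v) y S.
    rewrite /= scaler_sumr -big_split; apply: eq_bigr => j _.
    rewrite !eval_dfwith !E !mix_even ih -[mix e _ 0]/(e 0) -[mix e e1 0]/(e 0) -[mix e e2 0]/(e 0).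
    have [fl _] := mlinP (iterD m (e k) (sigma U (e 0) y)); exact: fl.
  by rlin.
- rewrite [der _]/= !eval_res !eval_tadd !eval_comp !eval_tcons linS ih.
  have E f z : (fun=> eval (mix e f) (scons z v) y (Res (shift_term t))) =
    (fun _ : 'I_1 => eval e v y (Res t)).
    by apply/funext => j; rewrite eval_res eval_shift.
  rewrite !E -[mix e _ 0]/(e 0) -[mix e e1 0]/(e 0) -[mix e e2 0]/(e 0).
  rewrite -[mix e _ 1]/(a *: e1 0 + e2 0) -[mix e e1 1]/(e1 0) -[mix e e2 1]/(e2 0).
  rewrite linD mlin_vcons_lin mlinD mlinZ -(resolvent_lin tau01 Atau).
  by congr resolvent; rlin.
Qed.

Definition admissible_line (e e' : env) (y z : X) (b : R) := forall c : R, 0 <= c <= b ->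
  contr (eline e e' c 0) /\ Ut (y + rscale c z).

(** The environment and the point at parameter c are a new origin of the same line, so [eval_qder],
    which is stated at parameter 0, gives the derivative at every c. *)
Lemma eval_rderiv t (e e' : env) v y z b c : bfam e -> bfam e' ->
  admissible_line e e' y z b -> 0 <= c <= b ->
  rderiv b (fun a => eval (eline e e' a) v (y + rscale a z) t) c
    (eval (mix (eline e e' c) e') (scons z v) (y + rscale c z) (der t)).
Proof.
move=> be be' se cb; have [ce Uty] := se c cb.
have [C C0 HC] := qder_ge0 (eval_qder tau01 rho0 oU cU UtU t v z ce
  (bfam_eline oU c be be') be' Uty).
move=> eps eps0; exists (Num.min 1 (eps / (C + 1))).
  by rewrite lt_min ltr01 divr_gt0// ltr_wpDl.
move=> a ab; rewrite lt_min => /andP[ac1 ac].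
have E (w : R) : y + rscale c z + rscale w z = y + rscale (c + w) z by rlin.
have := HC (a - c); rewrite /= !E !eline_eline addr0 addrCA subrr addr0.
move=> /(_ (se a ab) (ltW ac1))/le_trans; apply.
rewrite -[(a - c) ^+ 2]real_normK ?num_real// expr2 mulrA ler_wpM2r//.
rewrite (@le_trans _ _ ((C + 1) * `|a - c|))//.
  by rewrite ler_wpM2r// lerDl.
by rewrite -ler_pdivlMl ?ltr_wpDl// mulrC ltW.
Qed.

Lemma eline_zero (e : env) c : eline e (fun=> 0) c = e.
Proof. by apply: functional_extensionality_dep => k; rewrite /eline scaler0 add0r. Qed.

(** The direction e' stays constant along the line, so [mix e e'] moves in the direction [mix e' 0],
    and [eval_rderiv] applies once more. *)
Lemma eval_rderiv2 t (e e' : env) v y z b c : bfam e -> bfam e' ->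
  admissible_line e e' y z b -> 0 <= c <= b ->
  rderiv b (fun a => eval (mix (eline e e' a) e') (scons z v) (y + rscale a z) (der t)) c
    (eval (mix (mix (eline e e' c) e') (mix e' (fun=> 0))) (scons z (scons z v))
      (y + rscale c z) (der (der t))).
Proof.
move=> be be' se cb.
have E a : mix (eline e e' a) e' = eline (mix e e') (mix e' (fun=> 0)) a.
  by rewrite eline_mix eline_zero.
have -> : (fun a => eval (mix (eline e e' a) e') (scons z v) (y + rscale a z) (der t)) =
  (fun a => eval (eline (mix e e') (mix e' (fun=> 0)) a) (scons z v) (y + rscale a z) (der t)).
  by apply/funext => a; rewrite E.
rewrite E; apply: eval_rderiv => //; first exact: bfam_mix.
by apply: bfam_mix => //; exact: bfam0.
Qed.

(* c ranges over the real numbers below a weight |f y|, which may be infinite. *)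
Definition ctl (N : nat) (B c : R) (y : X) (e : env) := forall k m, (k < N)%N -> (m < N)%N ->
  (forall x, U x -> rnorm (iterD m (e k) x) <= B) /\ c * rnorm (iterD m (e k) y) <= B.

Definition vctl (N : nat) (B : R) (v : nat -> X) := forall n, (n < N)%N -> rnorm (v n) <= B.

End TermsLine.

(** * Bounds on expressions, with and without weight *)

Fixpoint term_order (t : term) : nat :=
  match t with
  | Vec n => n.+1
  | Sum n ts => \max_j term_order (ts j)
  | Comp m k ts => maxn (maxn k.+1 m.+2) (\max_j term_order (ts j))
  | Res t => maxn 2 (term_order t)
  end.

(** Every summand contains some D^m (e k), which is what the weight can be played against; a bare
    vector, or the resolvent of one, offers nothing of the kind. *)
Fixpoint decaying (t : term) : bool :=
  match t with
  | Vec n => false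
  | Sum n ts => [forall j, decaying (ts j)]
  | Comp m k ts => true
  | Res t => decaying t
  end.

Lemma decaying_tadd a b : decaying a -> decaying b -> decaying (tadd a b).
Proof. by move=> da db; apply/forallP => j /=; case: ifP. Qed.

Lemma decaying_der t : decaying t -> decaying (der t).
Proof.
elim: t => [//|n ts ih|m k ts ih|t ih] /=.
- by move=> /forallP H; apply/forallP => j; exact/ih/H.
- move=> _; apply: decaying_tadd; last by apply/forallP => j.
  exact: decaying_tadd.
- by move=> /ih dt; apply: decaying_tadd => //; exact: decaying_tadd.
Qed.

Section WeightedMeanValue.
Context {R : realType} {s : scalar_kind}.
Variables (V : normedModType (scalars R s)) (b c : R).
Hypothesis b0 : 0 <= b.
Hypothesis c0 : 0 <= c.

(** A positive c is moved to the other side, where M / c bounds the derivative; for c = 0 the claim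
    only says that M a is nonnegative. *)
Let weighted_bound (x : V) M a : 0 <= M -> 0 <= a ->
  (forall N, 0 < c -> M / c <= N -> rnorm x <= N * a) -> c * rnorm x <= M * a.
Proof.
move=> M0 a0 H; have [cp|cn] := ltP 0 c.
  have := ler_wpM2l c0 (H (M / c) cp (lexx _)).
  by rewrite mulrA mulrCA divff ?mulr1// gt_eqF.
have -> : c = 0 by apply/eqP; rewrite eq_le cn.
by rewrite mul0r mulr_ge0.
Qed.

Let weight0 (x : V) M : c * rnorm x <= M -> 0 <= M.
Proof. by apply: le_trans; rewrite mulr_ge0// rnorm_ge0. Qed.

Let weightV (x : V) M N : 0 < c -> c * rnorm x <= M -> M / c <= N -> rnorm x <= N.
Proof. by move=> cp xM; apply: le_trans; rewrite ler_pdivlMr// mulrC. Qed.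

Lemma mean_value_weighted (g g' : R -> V) M :
  (forall a, 0 <= a <= b -> rderiv b g a (g' a)) ->
  (forall a, 0 <= a <= b -> c * rnorm (g' a) <= M) ->
  c * rnorm (g b - g 0) <= M * b.
Proof.
move=> dg gM; have bI : 0 <= b <= b by rewrite b0 lexx.
apply: weighted_bound => // [|N cp MN]; first exact: weight0 (gM b bI).
apply: mean_value dg _ => // a /gM aM; exact: weightV MN.
Qed.

Lemma taylor2_weighted (g g' g'' : R -> V) M :
  (forall a, 0 <= a <= b -> rderiv b g a (g' a)) ->
  (forall a, 0 <= a <= b -> rderiv b g' a (g'' a)) ->
  (forall a, 0 <= a <= b -> c * rnorm (g'' a) <= M) ->
  c * rnorm (g b - g 0 - rscale b (g' 0)) <= M * b ^+ 2.
Proof.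
move=> dg dg' gM; have bI : 0 <= b <= b by rewrite b0 lexx.
apply: weighted_bound => [||N cp MN]; [exact: weight0 (gM b bI)|exact: sqr_ge0|].
apply: taylor2 dg dg' _ => // a /gM aM; exact: weightV MN.
Qed.

End WeightedMeanValue.

Section Bounds.
Context {R : realType} {s : scalar_kind}.
Local Notation K := (scalars R s).
Variable X : completeNormedModType K.
Variables (tau rho : R) (U Ut : set X).
Hypothesis tau01 : 0 <= tau < 1.
Hypothesis rho0 : 0 <= rho.
Hypothesis oU : open U.
Hypothesis cU : forall p q t, U p -> U q -> 0 <= t <= 1 -> U (p + rscale t (q - p)).
Hypothesis UtU : forall y x, Ut y -> rnorm (x - y) <= rho -> U x.

Local Notation env := (nat -> X -> X).
Local Notation contr := (contractive tau U rho).
Local Notation bfam := (bounded_family U).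
Local Notation eval := (eval U).
Local Notation ctl := (ctl U).

Let tau1' : 0 < 1 - tau. Proof. by case/andP: tau01 => _; rewrite subr_gt0. Qed.

(** Depends on B, tau and the expression alone, hence is uniform in the index i and the point y. The
    sum 1 + ... is a positive common bound for all arguments of a multilinear map. *)
Fixpoint ubound (B : R) (t : term) : R :=
  match t with
  | Vec n => B
  | Sum n ts => \sum_j ubound B (ts j)
  | Comp m k ts => B * (1 + \sum_j ubound B (ts j)) ^+ m
  | Res t => ubound B t / (1 - tau)
  end.

Lemma ubound_ge0 B t : 0 <= B -> 0 <= ubound B t.
Proof.
move=> B0; elim: t => [n|n ts ih|m k ts ih|t ih] //=.
- exact: sumr_ge0.
- by rewrite mulr_ge0// exprn_ge0// addr_ge0// sumr_ge0.
- by rewrite divr_ge0// ltW.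
Qed.

Lemma Ut_sub y : Ut y -> U y.
Proof. by move=> Uty; apply: UtU Uty _; rewrite subrr rnorm0. Qed.

Lemma ctl_le N N' B c y e : (N' <= N)%N -> ctl N B c y e -> ctl N' B c y e.
Proof. by move=> NN H k m kN mN; apply: H; exact: leq_trans NN. Qed.

Lemma vctl_le N N' B (v : nat -> X) : (N' <= N)%N -> vctl N B v -> vctl N' B v.
Proof. by move=> NN H k kN; apply: H; exact: leq_trans NN. Qed.

(** The loss in passing from y to sigma y: c |D^m (e k) y| is at most B, and the mean value term at
    most B c |e 0 y| / (1 - tau), so at most B B / (1 - tau). *)
Definition decay_cst (B : R) := 1 + B / (1 - tau).

(** In a product a single factor has to carry the weight. At a [Comp] node this is the map, so its
    arguments enter through their unweighted bounds and may be bare vectors. *)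
Lemma eval_bound t (e : env) v y (B c : R) : 0 <= B -> 0 <= c ->
  contr (e 0) -> bfam e -> Ut y -> ctl (term_order t) B c y e -> vctl (term_order t) B v ->
  rnorm (eval e v y t) <= ubound B t /\
  (decaying t -> c * rnorm (eval e v y t) <= decay_cst B * ubound B t).
Proof.
move=> B0 c0 ce be Uty.
have [Ux xE] := sigmaP tau01 rho0 cU UtU ce Uty.
have Uy := Ut_sub Uty.
have Atau : rnorm (iterD 1 (e 0) (sigma U (e 0) y)) <= tau by have [_ + _] := ce; exact.
elim: t => [n|n ts ih|m k ts ih|t ih] Ht Hv.
- by split=> //=; exact: Hv.
- have sub j : (term_order (ts j) <= term_order (Sum ts))%N by exact: (leq_bigmax j).
  have {}ih j := ih j (ctl_le (sub j) Ht) (vctl_le (sub j) Hv).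
  split=> [|/forallP dt] /=.
    rewrite (le_trans (rnorm_sum _))//; apply: ler_sum => j _.
    by have [] := ih j.
  rewrite (le_trans (ler_wpM2l c0 (rnorm_sum _)))// !mulr_sumr.
  by apply: ler_sum => j _; have [_] := ih j; apply; exact: dt.
- have sub j : (term_order (ts j) <= term_order (Comp k ts))%N.
    by rewrite /= leq_max; apply/orP; right; exact: (leq_bigmax j).
  have {}ih j := ih j (ctl_le (sub j) Ht) (vctl_le (sub j) Hv).
  pose S := 1 + \sum_j ubound B (ts j).
  have S1 : 1 <= S by rewrite lerDl sumr_ge0// => j _; exact: ubound_ge0.
  have Sp : 0 < S by apply: lt_le_trans S1.
  have tsS j : rnorm (eval e v y (ts j)) <= S.
    have [H _] := ih j; rewrite (le_trans H)// /S (bigD1 j)//= addrCA lerDl.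
    by rewrite addr_ge0// sumr_ge0// => i _; exact: ubound_ge0.
  have [fl _] := mlinP (iterD m (e k) (sigma U (e 0) y)).
  have lek : (k < term_order (Comp k ts))%N by rewrite /= !leq_max leqnn.
  have lem : (m.+1 < term_order (Comp k ts))%N by rewrite /= !leq_max leqnn orbT.
  have le0 : (0 < term_order (Comp k ts))%N by apply: leq_ltn_trans lek.
  have le1 : (m < term_order (Comp k ts))%N by apply: ltn_trans lem.
  have bS := multilinear_bound fl (mlin_unit_bounded _) Sp tsS.
  have Sm0 : 0 <= S ^+ m by rewrite exprn_ge0// ltW.
  rewrite eval_comp [ubound _ _]/= -/S; split=> [|_].
    by rewrite (le_trans bS)// ler_wpM2r//; have [+ _] := Ht k m lek le1; exact.
  rewrite (le_trans (ler_wpM2l c0 bS))// !mulrA ler_wpM2r//.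
  (* Order m.+1 enters through the comparison of sigma y with y, hence the [m.+2] in
     [term_order]. *)
  have [H1 H2] := Ht k m lek le1; have [H3 _] := Ht k m.+1 lek lem.
  have [de _] := be.
  rewrite -(subrK (iterD m (e k) y) (iterD m (e k) (sigma U (e 0) y))).
  rewrite (le_trans (ler_wpM2l c0 (rnormD _ _)))// mulrDr addrC /decay_cst mulrDl mul1r.
  rewrite lerD// (le_trans (ler_wpM2l c0 (iterD_lipschitz cU (de k) Uy Ux H3)))//.
  rewrite mulrCA [leRHS]mulrC ler_wpM2l//.
  rewrite (le_trans (ler_wpM2l c0 (sigma_dist tau01 rho0 cU UtU ce Uty Uy)))// mulrA.
  rewrite ler_wpM2r ?invr_ge0 ?(ltW tau1')//.
  have [_ H4] := Ht 0 0 le0 le0.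
  by rewrite -rnorm_iterD0.
- have sub : (term_order t <= term_order (Res t))%N by rewrite /= leq_max leqnn orbT.
  have {ih} [ih1 ih2] := ih (ctl_le sub Ht) (vctl_le sub Hv).
  rewrite eval_res /=; split=> [|dt].
    rewrite (le_trans (resolvent_bound tau01 Atau _))//.
    by rewrite ler_wpM2r ?invr_ge0 ?(ltW tau1').
  rewrite (le_trans (ler_wpM2l c0 (resolvent_bound tau01 Atau _)))// !mulrA.
  by rewrite ler_wpM2r ?invr_ge0 ?(ltW tau1')// ih2.
Qed.

Lemma ctl_mix N B c y (e e' : env) : ctl N B c y e -> ctl N B c y e' -> ctl N B c y (mix e e').
Proof.
move=> H H' k m kN mN; have k2 : (k./2 < N)%N.
  by apply: leq_ltn_trans kN; rewrite leq_half_double -addnn leqW// leq_addr.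
by rewrite /mix; case: ifP => _; [apply: H'|apply: H].
Qed.

Lemma ctl0 N B c y : 0 <= B -> ctl N B c y (fun=> 0).
Proof.
move=> B0 k m _ _; split=> [x _|]; rewrite iterD_cst0 [X in rnorm X](_ : _ = 0)// rnorm0//.
by rewrite mulr0.
Qed.

Lemma ctl_eline N B c y (e e' : env) a : 0 <= B -> 0 <= c -> `|a| <= 1 -> U y ->
  bfam e -> bfam e' -> ctl N B c y e -> ctl N B c y e' -> ctl N (2 * B) c y (eline e e' a).
Proof.
move=> B0 c0 a1 Uy be be' H H' k m kN mN.
have [H1 H2] := H k m kN mN; have [H1' H2'] := H' k m kN mN.
have E x : U x -> rnorm (iterD m (eline e e' a k) x) <=
    rnorm (iterD m (e k) x) + rnorm (iterD m (e' k) x).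
  move=> Ux; rewrite (iterD_eline oU a k m be be' Ux) addrC (le_trans (rnormD _ _))// lerD2l.
  by rewrite rnorm_rscale ler_piMl// rnorm_ge0.
have B2 : 2 * B = B + B by ring.
rewrite B2; split=> [x Ux|]; first by rewrite (le_trans (E x Ux))// lerD ?H1 ?H1'.
by rewrite (le_trans (ler_wpM2l c0 (E y Uy)))// mulrDr lerD.
Qed.

Lemma ctl_scale N B B' c y (e : env) : B <= B' -> ctl N B c y e -> ctl N B' c y e.
Proof.
move=> BB H k m kN mN; have [H1 H2] := H k m kN mN.
by split=> [x Ux|]; [exact: le_trans (H1 x Ux) BB|exact: le_trans BB].
Qed.

Lemma vctl_scale N B B' (v : nat -> X) : B <= B' -> vctl N B v -> vctl N B' v.
Proof. by move=> BB H k kN; exact: le_trans (H k kN) BB. Qed.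

Lemma vctl_scons N B z (v : nat -> X) : rnorm z <= B -> vctl N B v -> vctl N B (scons z v).
Proof. by move=> zB H [|k] // kN; apply: H; exact: ltnW. Qed.

(** For c = 0 the weighted half of [ctl] is void, so boundedness on U suffices. *)
Lemma bfam_ctl N (e : env) : bfam e ->
  exists2 B, 0 <= B & forall B', B <= B' -> forall y, ctl N B' 0 y e.
Proof.
move=> [_ be].
have [B B0 HB] : exists2 B : R, 0 <= B & forall k : 'I_N, forall m : 'I_N,
    forall x, U x -> rnorm (iterD m (e k) x) <= B.
  apply: fin_uniform => [k C C' CC H m x Ux|k]; first exact: le_trans (H m x Ux) CC.
  have [||C _ HC] := @fin_uniform R N (fun m C => forall x, U x -> rnorm (iterD m (e k) x) <= C).
  - by move=> m C C' CC H x Ux; exact: le_trans (H x Ux) CC.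
  - by move=> m; exact: be.
  by exists C.
exists B => // B' BB y k m kN mN; split.
  by move=> x Ux; rewrite (le_trans (HB (Ordinal kN) (Ordinal mN) x Ux)).
by rewrite mul0r (le_trans B0).
Qed.

Lemma vctl_ex N (v : nat -> X) : exists2 B, 0 <= B & forall B', B <= B' -> vctl N B' v.
Proof.
exists (\sum_(n < N) rnorm (v n)); first by apply: sumr_ge0 => n _; exact: rnorm_ge0.
move=> B' BB n nN; apply: le_trans BB; rewrite (bigD1 (Ordinal nN))//= lerDl.
by apply: sumr_ge0 => i _; exact: rnorm_ge0.
Qed.

Section Segment.
Variables (t : term) (e e' : env) (v : nat -> X) (z : X) (B c b : R).
Hypothesis B0 : 0 <= B.
Hypothesis c0 : 0 <= c.
Hypothesis b01 : 0 <= b <= 1.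
Hypothesis be : bfam e.
Hypothesis be' : bfam e'.

Let b0 : 0 <= b. Proof. by case/andP: b01. Qed.
Let le1 a : 0 <= a <= b -> `|a| <= 1.
Proof. by move=> /andP[a0 ab]; rewrite ger0_norm// (le_trans ab)//; case/andP: b01. Qed.
Let BB : B <= 2 * B. Proof. by rewrite ler_peMl// ler1n. Qed.
Let B20 : 0 <= 2 * B. Proof. exact: mulr_ge0. Qed.

Let bfam1 a : bfam (mix (eline e e' a) e').
Proof. by apply: bfam_mix => //; exact: bfam_eline. Qed.

Let bfam2 a : bfam (mix (mix (eline e e' a) e') (mix e' (fun=> 0))).
Proof. by apply: bfam_mix => //; apply: bfam_mix => //; exact: bfam0. Qed.

Let C1 := ubound (2 * B) (der t).
Let C2 := ubound (2 * B) (der (der t)).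

Let ctl1 y a : U y -> 0 <= a <= b ->
  ctl (term_order (der t)) B c y e -> ctl (term_order (der t)) B c y e' ->
  ctl (term_order (der t)) (2 * B) c y (mix (eline e e' a) e').
Proof.
move=> Uy aI H H'; apply: ctl_mix; last exact: ctl_scale H'.
by apply: ctl_eline => //; exact: le1.
Qed.

Let ctl2 y a : U y -> 0 <= a <= b -> ctl (term_order (der (der t))) B c y e ->
  ctl (term_order (der (der t))) B c y e' ->
  ctl (term_order (der (der t))) (2 * B) c y (mix (mix (eline e e' a) e') (mix e' (fun=> 0))).
Proof.
move=> Uy aI H H'.
have H'2 : ctl (term_order (der (der t))) (2 * B) c y e' by exact: ctl_scale H'.
apply: ctl_mix; apply: ctl_mix => //; last exact: ctl0.
by apply: ctl_eline => //; exact: le1.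
Qed.

Let vctl1 : rnorm z <= B -> vctl (term_order (der t)) B v ->
  vctl (term_order (der t)) (2 * B) (scons z v).
Proof. by move=> zB H; apply: vctl_scale BB _; exact: vctl_scons. Qed.

Let vctl2 : rnorm z <= B -> vctl (term_order (der (der t))) B v ->
  vctl (term_order (der (der t))) (2 * B) (scons z (scons z v)).
Proof. by move=> zB H; apply: vctl_scale BB _; do 2 apply: vctl_scons => //. Qed.

Lemma eval_lip y : admissible_line tau rho U Ut e e' y z b ->
  rnorm z <= B -> vctl (term_order (der t)) B v ->
  (forall a, ctl (term_order (der t)) B c (y + rscale a z) e) ->
  (forall a, ctl (term_order (der t)) B c (y + rscale a z) e') ->
  rnorm (eval (eline e e' b) v (y + rscale b z) t - eval e v y t) <= C1 * b.
Proof.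
move=> se zB Hv H H'.
have := @mean_value R s X b (fun a => eval (eline e e' a) v (y + rscale a z) t) _ C1 b0
  (fun a => eval_rderiv tau01 rho0 oU cU UtU t v be be' se (c := a)).
rewrite eline0 rscale0 addr0; apply=> a aI.
have [ca Uta] := se a aI.
have [+ _] := eval_bound (e := mix (eline e e' a) e') B20 c0 ca (bfam1 a) Uta
  (ctl1 (Ut_sub Uta) aI (H a) (H' a)) (vctl1 zB Hv).
exact.
Qed.

Lemma eval_taylor y : admissible_line tau rho U Ut e e' y z b ->
  rnorm z <= B -> vctl (term_order (der (der t))) B v ->
  (forall a, ctl (term_order (der (der t))) B c (y + rscale a z) e) ->
  (forall a, ctl (term_order (der (der t))) B c (y + rscale a z) e') ->
  rnorm (eval (eline e e' b) v (y + rscale b z) t - eval e v y t -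
    rscale b (eval (mix e e') (scons z v) y (der t))) <= C2 * b ^+ 2.
Proof.
move=> se zB Hv H H'.
have := @taylor2 R s X b (fun a => eval (eline e e' a) v (y + rscale a z) t) _ _ C2 b0
  (fun a => eval_rderiv tau01 rho0 oU cU UtU t v be be' se (c := a))
  (fun a => eval_rderiv2 tau01 rho0 oU cU UtU t v be be' se (c := a)).
rewrite eline0 rscale0 addr0; apply=> a aI.
have [ca Uta] := se a aI.
have [+ _] := eval_bound (e := mix (mix (eline e e' a) e') (mix e' (fun=> 0))) B20 c0 ca
  (bfam2 a) Uta (ctl2 (Ut_sub Uta) aI (H a) (H' a)) (vctl2 zB Hv).
exact.
Qed.

(** Only the maps move, because c is tied to the weight at the one point y. The bound [2 * B] is
    that of e + a e' for a in [0, 1]. *)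
Lemma eval_lip_weighted y : decaying t -> Ut y -> admissible_line tau rho U Ut e e' y 0 b ->
  vctl (term_order (der t)) B v -> ctl (term_order (der t)) B c y e ->
  ctl (term_order (der t)) B c y e' ->
  c * rnorm (eval (eline e e' b) v y t - eval e v y t) <= decay_cst (2 * B) * C1 * b.
Proof.
move=> dt Uty se Hv H H'; have Uy := Ut_sub Uty.
have := @mean_value_weighted R s X b c b0 c0
  (fun a => eval (eline e e' a) v (y + rscale a 0) t) _ (decay_cst (2 * B) * C1)
  (fun a => eval_rderiv tau01 rho0 oU cU UtU t v be be' se (c := a)).
rewrite eline0 !rscaler0 !addr0; apply=> a aI; rewrite rscaler0 addr0.
have [ca _] := se a aI; have z0 : rnorm (0 : X) <= 2 * B by rewrite rnorm0.
have [_] := eval_bound (e := mix (eline e e' a) e') B20 c0 ca (bfam1 a) Uty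
  (ctl1 Uy aI H H') (vctl_scons z0 (vctl_scale BB Hv)).
by apply; exact: decaying_der.
Qed.

Lemma eval_taylor_weighted y : decaying t -> Ut y -> admissible_line tau rho U Ut e e' y 0 b ->
  vctl (term_order (der (der t))) B v ->
  ctl (term_order (der (der t))) B c y e -> ctl (term_order (der (der t))) B c y e' ->
  c * rnorm (eval (eline e e' b) v y t - eval e v y t -
    rscale b (eval (mix e e') (scons 0 v) y (der t))) <= decay_cst (2 * B) * C2 * b ^+ 2.
Proof.
move=> dt Uty se Hv H H'; have Uy := Ut_sub Uty.
have := @taylor2_weighted R s X b c b0 c0
  (fun a => eval (eline e e' a) v (y + rscale a 0) t) _ _ (decay_cst (2 * B) * C2)
  (fun a => eval_rderiv tau01 rho0 oU cU UtU t v be be' se (c := a))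
  (fun a => eval_rderiv2 tau01 rho0 oU cU UtU t v be be' se (c := a)).
rewrite eline0 !rscaler0 !addr0; apply=> a aI; rewrite rscaler0 addr0.
have [ca _] := se a aI; have z0 : rnorm (0 : X) <= 2 * B by rewrite rnorm0.
have [_] := eval_bound (e := mix (mix (eline e e' a) e') (mix e' (fun=> 0))) B20 c0 ca (bfam2 a) Uty
  (ctl2 Uy aI H H') (vctl_scons z0 (vctl_scons z0 (vctl_scale BB Hv))).
by apply; do 2 apply: decaying_der.
Qed.

End Segment.

End Bounds.

(** * Derivatives in the point and their exchange with derivatives in the maps *)

Definition vecs (T : nmodType) l (v : 'I_l -> T) : nat -> T := fun n => oapp v 0 (insub n).

Lemma vecsS (T : nmodType) l (v : 'I_l.+1 -> T) :
  vecs v = scons (v ord0) (vecs (fun j => v (lift ord0 j))).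
Proof.
apply/funext => -[|n]; rewrite /vecs /=.
  by case: insubP => //= i _ i0; congr v; exact/val_inj.
case: insubP => [i|] /= ni; last by rewrite insubF//; apply/negbTE.
rewrite ltnS in ni => iE; rewrite insubT/=; congr v; exact/val_inj.
Qed.

Lemma vecs_default (T : nmodType) l (v : 'I_l -> T) n : (l <= n)%N -> vecs v n = 0.
Proof. by move=> ln; rewrite /vecs insubF// ltnNge ln. Qed.

Section PointDerivatives.
Context {R : realType} {s : scalar_kind}.
Local Notation K := (scalars R s).
Variable X : completeNormedModType K.
Variables (tau rho : R) (U Ut : set X).
Hypothesis tau01 : 0 <= tau < 1.
Hypothesis rho0 : 0 <= rho.
Hypothesis oU : open U.
Hypothesis oUt : open Ut.
Hypothesis cU : forall p q t, U p -> U q -> 0 <= t <= 1 -> U (p + rscale t (q - p)).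
Hypothesis UtU : forall y x, Ut y -> rnorm (x - y) <= rho -> U x.

Local Notation env := (nat -> X -> X).
Local Notation contr := (contractive tau U rho).
Local Notation bfam := (bounded_family U).
Local Notation eval := (eval U).
Local Notation ctl := (ctl U).
Local Notation admissible_line := (admissible_line tau rho U Ut).
Local Notation env0 := (fun=> 0 : X -> X).

Lemma Ut_ball y : Ut y -> exists2 r : R, 0 < r & forall h, rnorm h < r -> Ut (y + h).
Proof.
move=> Uty; have /(@nbhs_rnormP R s X)[r r0 H] : nbhs y Ut by exact: open_nbhs_nbhs.
by exists r => // h hr; apply: H; rewrite [y + h]addrC addrK.
Qed.

Lemma Ut_segment y z : Ut y -> exists2 b : R, 0 < b <= 1 &
  forall a, 0 <= a <= b -> Ut (y + rscale a z).
Proof.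
move=> /Ut_ball[r r0 H]; pose m := rnorm z + 1.
have m0 : 0 < m by rewrite ltr_wpDl// rnorm_ge0.
exists (Num.min 1 (r / 2 / m)).
  by rewrite lt_min ltr01 !divr_gt0//= ge_min lexx.
move=> a; rewrite le_min => /and3P[a0 _ ar]; apply: H; rewrite rnorm_rscale ger0_norm//.
rewrite (@le_lt_trans _ _ (a * m))//; first by rewrite ler_wpM2l// lerDl.
rewrite -ltr_pdivlMr// (le_lt_trans ar)// ltr_pM2r ?invr_gt0//.
by rewrite gtr_pMr// invf_lt1// ltr1n.
Qed.

Lemma rderiv_eq (V : normedModType K) b (f g : R -> V) c d : 0 <= c <= b ->
  (forall t, 0 <= t <= b -> f t = g t) -> rderiv b f c d -> rderiv b g c d.
Proof.
move=> cb fg df eps eps0; have [r r0 H] := df eps eps0; exists r => // t tb.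
by rewrite -!fg//; exact: H.
Qed.

Lemma eval_rderiv_env t (e e' : env) v y b c : bfam e -> bfam e' -> Ut y ->
  (forall a : R, 0 <= a <= b -> contr (eline e e' a 0)) -> 0 <= c <= b ->
  rderiv b (fun a => eval (eline e e' a) v y t) c
    (eval (mix (eline e e' c) e') (scons 0 v) y (der t)).
Proof.
move=> be be' Uty se cb.
have se' : admissible_line e e' y 0 b by move=> a ab; split; [exact: se|rewrite rscaler0 addr0].
have := eval_rderiv tau01 rho0 oU cU UtU t v be be' se' cb.
have E a : y + rscale a 0 = y by rewrite rscaler0 addr0.
by rewrite E; apply: rderiv_eq cb _ => a _; rewrite E.
Qed.

Lemma eval_rderiv_point t (e : env) v y z b c : bfam e -> contr (e 0) ->
  (forall a : R, 0 <= a <= b -> Ut (y + rscale a z)) -> 0 <= c <= b ->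
  rderiv b (fun a => eval e v (y + rscale a z) t) c
    (eval (mix e env0) (scons z v) (y + rscale c z) (der t)).
Proof.
move=> be ce Uyz cb.
have se : admissible_line e env0 y z b by move=> a ab; split; [rewrite eline_zero|exact: Uyz].
have := eval_rderiv tau01 rho0 oU cU UtU t v be (bfam0 U) se cb.
by rewrite eline_zero; apply: rderiv_eq cb _ => a _; rewrite eline_zero.
Qed.

(** Both sides are mixed second derivatives at 0 of the value at the maps e + x e' and the point y +
    u z; on the left the point is differentiated first, on the right the maps. [rderiv_exchange]
    shows that the right side is also a derivative of [G2], and derivatives are unique. The
    Lipschitz bound that it requires on [G12] costs a third derivative, hence the [N] of the
    proof. *)
Lemma eval_schwarz t (e e' : env) v y z b : 0 < b -> bfam e -> bfam e' -> Ut y ->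
  (forall a : R, 0 <= a <= b -> contr (eline e e' a 0)) ->
  eval (mix (mix e env0) (mix e' env0)) (scons 0 (scons z v)) y (der (der t)) =
  eval (mix (mix e e') env0) (scons z (scons 0 v)) y (der (der t)).
Proof.
move=> b0 be be' Uty ce.
have [d /andP[d0 d1] Ud] := Ut_segment z Uty.
pose b' := Num.min b d.
have b'0 : 0 < b' by rewrite lt_min b0.
have b'b a : 0 <= a <= b' -> 0 <= a <= b by rewrite le_min => /and3P[-> ->].
have b'd a : 0 <= a <= b' -> 0 <= a <= d by rewrite le_min => /and3P[-> _ ->].
have b'1 a : 0 <= a <= b' -> 0 <= a <= 1.
  by move=> /b'd/andP[-> ad]; exact: le_trans d1.
have I0 : (0 : R) <= 0 <= b' by rewrite lexx (ltW b'0).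
have ce' a : 0 <= a <= b' -> contr (eline e e' a 0) by move=> /b'b; exact: ce.
have ce0 : contr (e 0) by have := ce' 0 I0; rewrite eline0.
pose N := term_order (der (der (der t))).
have [B1 B10 H1] := bfam_ctl N be; have [B2 B20 H2] := bfam_ctl N be'.
have [B3 B30 H3] := vctl_ex N v.
pose B := B1 + B2 + B3 + rnorm z.
have z0 := rnorm_ge0 z.
have B0 : 0 <= B by rewrite !addr_ge0.
have {}H1 y' : ctl N B 0 y' e by apply: H1; rewrite /B; lra.
have {}H2 y' : ctl N B 0 y' e' by apply: H2; rewrite /B; lra.
have {}H3 : vctl N B v by apply: H3; rewrite /B; lra.
have zB : rnorm z <= B by rewrite /B; lra.
pose E := mix (mix e e') env0; pose E' := mix (mix e' env0) env0.
have EE x : eline E E' x = mix (mix (eline e e' x) e') env0.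
  by rewrite !eline_mix eline_zero eline_zero.
have bE : bfam E by do 2 ?apply: bfam_mix => //; exact: bfam0.
have bE' : bfam E' by do 2 ?apply: bfam_mix => //; exact: bfam0.
have HE y' : ctl N B 0 y' E by apply: ctl_mix; [exact: ctl_mix|exact: ctl0].
have HE' y' : ctl N B 0 y' E'.
  by apply: ctl_mix; [apply: ctl_mix => //; exact: ctl0|exact: ctl0].
pose w := scons z (scons 0 v).
have Hw : vctl N B w by apply: vctl_scons => //; apply: vctl_scons => //; rewrite rnorm0.
pose G x u := eval (eline e e' x) v (y + rscale u z) t.
pose G1 x u := eval (mix (eline e e' x) e') (scons 0 v) (y + rscale u z) (der t).
pose G12 x u := eval (eline E E' x) w (y + rscale u z) (der (der t)).
pose G2 x := eval (mix (eline e e' x) env0) (scons z v) y (der t).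
pose C := ubound tau (2 * B) (der (der (der t))).
have := @rderiv_exchange R s X b' C G G1 G12 G2 b'0.
have -> : G12 0 0 = eval E w y (der (der t)) by rewrite /G12 eline0 rscale0 addr0.
move=> H; have {}H : rderiv b' G2 0 (eval E w y (der (der t))).
  apply: H => [x u xI uI|x u xI uI|x xI|x u xI uI].
  - by apply: eval_rderiv_env => //; exact/Ud/b'd.
  - rewrite /G12 EE; apply: eval_rderiv_point => //.
    + by apply: bfam_mix => //; exact: bfam_eline.
    + exact: ce'.
    + by move=> a /b'd; exact: Ud.
  - have := @eval_rderiv_point t (eline e e' x) v y z b' 0.
    rewrite rscale0 addr0; apply=> //; [exact: bfam_eline|exact: ce'|].
    by move=> a /b'd; exact: Ud.
  - have -> : eval E w y (der (der t)) = G12 0 0 by rewrite /G12 eline0 rscale0 addr0.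
    rewrite (le_trans (rnorm_tri (G12 0 u) _ _))// mulrDr; apply: lerD.
      have := @eval_lip _ _ _ _ _ _ _ tau01 rho0 oU cU UtU (der (der t)) E E' w 0 B 0 x
        B0 (lexx _) (b'1 x xI) bE bE' (y + rscale u z).
      rewrite rnorm0 rscaler0 addr0 /G12 eline0; apply=> // a ax.
      split; last by rewrite rscaler0 addr0; exact/Ud/b'd.
      apply: ce'; have /andP[-> /= ax'] := ax; rewrite (le_trans ax')//.
      by case/andP: xI.
    have := @eval_lip _ _ _ _ _ _ _ tau01 rho0 oU cU UtU (der (der t)) E env0 w z B 0 u
        B0 (lexx _) (b'1 u uI) bE (bfam0 U) y.
    rewrite /G12 eline0 eline_zero rscale0 addr0; apply=> // [a au|a]; last exact: ctl0.
    rewrite eline_zero; split=> //; apply/Ud/b'd.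
    by have /andP[-> /= au'] := au; rewrite (le_trans au')//; case/andP: uI.
have b'I : 0 <= b' <= b' by rewrite (ltW b'0) lexx.
apply: (rderiv_uniq b'0 I0 _ H).
have := @eval_rderiv_env (der t) (mix e env0) (mix e' env0) (scons z v) y b' 0.
rewrite eline0 => D.
have -> : G2 = fun a => eval (eline (mix e env0) (mix e' env0) a) (scons z v) y (der t).
  by apply/funext => a; rewrite eline_mix eline_zero.
by apply: D => //; apply: bfam_mix => //; exact: bfam0.
Qed.

(* The maps are kept fixed when only the point y varies. *)
Definition lift_env (l : nat) (e : env) : env := iter l (fun e => mix e env0) e.

Lemma lift_env0 l e : lift_env l e 0 = e 0.
Proof. by elim: l. Qed.

Lemma bfam_lift l e : bfam e -> bfam (lift_env l e).
Proof. by move=> be; elim: l => //= l ih; apply: bfam_mix => //; exact: bfam0. Qed.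

Lemma eline_lift l e e' a : eline (lift_env l e) (lift_env l e') a = lift_env l (eline e e' a).
Proof. by elim: l => //= l ih; rewrite eline_mix eline_zero ih. Qed.

Lemma ctl_lift l N B c y e : 0 <= B -> ctl N B c y e -> ctl N B c y (lift_env l e).
Proof. by move=> B0 H; elim: l => //= l ih; apply: ctl_mix => //; exact: ctl0. Qed.

(* As w vanishes from l on, the direction of y in [der t] is 0 on the right. *)
Lemma eval_exchange l t (e e' : env) w y b : 0 < b -> bfam e -> bfam e' -> Ut y ->
  (forall a : R, 0 <= a <= b -> contr (eline e e' a 0)) ->
  (forall n, (l <= n)%N -> w n = 0) ->
  eval (mix (lift_env l e) (lift_env l e')) (scons 0 w) y (der (iter l der t)) =
  eval (lift_env l (mix e e')) w y (iter l der (der t)).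
Proof.
move=> b0 be be' Uty ce; elim: l w y Uty => [|l ih] w y Uty w0.
  congr (eval _ _ _ _); apply/funext => -[|n] //=; last by rewrite !w0.
  by rewrite w0.
pose z := w 0; pose w' n := w n.+1.
have wE : w = scons z w' by apply/funext => -[|n].
have w'0 n : (l <= n)%N -> w' n = 0 by move=> ln; exact: w0.
have ceL a : 0 <= a <= b -> contr (eline (lift_env l e) (lift_env l e') a 0).
  by move=> ab; rewrite eline_lift lift_env0; exact: ce.
have bL := bfam_lift l be; have bL' := bfam_lift l be'.
rewrite wE /= (eval_schwarz _ _ _ b0 bL bL' Uty ceL).
have [d /andP[d0 d1] Ud] := Ut_segment z Uty.
have I0 : (0 : R) <= 0 <= d by rewrite lexx (ltW d0).
have ce0 : contr (e 0) by have := ce 0; rewrite eline0 lexx (ltW b0); apply.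
have ceM : contr (mix (lift_env l e) (lift_env l e') 0).
  by have := ce0; rewrite -(lift_env0 l).
have ceM' : contr (lift_env l (mix e e') 0) by rewrite lift_env0.
(* After the exchange, both sides are derivatives in the direction z of the two sides of the
   induction hypothesis, which agree on the whole segment. *)
have D1 := eval_rderiv_point (der (iter l der t)) (scons 0 w') (bfam_mix bL bL') ceM Ud I0.
have D2 := eval_rderiv_point (iter l der (der t)) w' (bfam_lift l (bfam_mix be be')) ceM' Ud I0.
rewrite rscale0 addr0 in D1 D2.
apply: (rderiv_uniq d0 I0 _ D2); apply: rderiv_eq D1 => // a ad.
by apply: ih => //; exact: Ud.
Qed.

Section IterD.
Variables (t : term) (e : env) (phi : X -> X).
Hypothesis be : bfam e.
Hypothesis ce : contr (e 0).
Hypothesis phiE : forall y, Ut y -> phi y = eval e (fun=> 0) y t.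

Let F l y (v : 'I_l -> X) := eval (lift_env l e) (vecs v) y (iter l der t).
Let ceL l : contr (lift_env l e 0). Proof. by rewrite lift_env0. Qed.
Let beL l : bfam (lift_env l e). Proof. exact: bfam_lift. Qed.

Let dF l y z v := eval (mix (lift_env l e) env0) (scons z (@vecs X l v)) y (der (iter l der t)).

Let dF_lin l y v a z1 z2 : Ut y ->
  dF y (a *: z1 + z2) v = a *: @dF l y z1 v + dF y z2 v.
Proof.
move=> Uty; have := eval_der_lin tau01 rho0 oU cU UtU (iter l der t) (vecs v) z1 z2 a
  (ceL l) (beL l) (bfam0 U) (bfam0 U) Uty.
by rewrite (_ : (fun _ : nat => a *: 0 + 0) = env0)//; apply/funext => k; rewrite scaler0 addr0.
Qed.

Let dF_bound l : exists2 M, 0 <= M & forall y v z, Ut y -> (forall i, rnorm (v i) <= 1) ->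
  rnorm (@dF l y z v) <= M * rnorm z.
Proof.
pose N := term_order (der (iter l der t)).
have [B1 B10 H1] := bfam_ctl N (beL l).
pose B := B1 + 1; have B0 : 0 <= B by rewrite addr_ge0.
exists (ubound tau B (der (iter l der t))); first exact: ubound_ge0.
move=> y v z Uty v1.
have H z' : rnorm z' <= 1 -> rnorm (dF y z' v) <= ubound tau B (der (iter l der t)).
  move=> z'1.
  have B1B : B1 <= B by rewrite lerDl.
  have le1B : 1 <= B by rewrite lerDr.
  have c0 : ctl N B 0 y env0 by exact: ctl0.
  have vB : vctl N B (vecs v).
    move=> n _; rewrite /vecs; case: insubP => /= [i _ _|_]; last by rewrite rnorm0.
    exact: le_trans (v1 i) le1B.
  have [+ _] := @eval_bound _ _ _ _ _ _ _ tau01 rho0 cU UtU (der (iter l der t))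
    (mix (lift_env l e) env0) (scons z' (vecs v)) y B 0 B0 (lexx _) (ceL l)
    (bfam_mix (beL l) (bfam0 U)) Uty (ctl_mix (H1 B B1B y) c0)
    (vctl_scons (le_trans z'1 le1B) vB).
  exact.
have [z0|z0] := eqVneq (rnorm z) 0.
  rewrite z0 mulr0 (rnorm0_eq0 z0).
  have := @dF_lin l y v (-1) 0 0 Uty; rewrite scaler0 addr0 scaleN1r addNr => ->.
  by rewrite rnorm0.
have zp : 0 < rnorm z by rewrite lt_neqAle eq_sym z0 rnorm_ge0.
have -> : z = ofR (rnorm z) *: rscale (rnorm z)^-1 z + 0.
  by rewrite -/(rscale _ _) rscaleA mulfV// rscale1 addr0.
rewrite dF_lin//; have -> : dF y 0 v = 0.
  by have := @dF_lin l y v (-1) 0 0 Uty; rewrite scaler0 addr0 scaleN1r addNr.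
rewrite !addr0 -!/(rscale _ _) rscaleA mulfV// rscale1 rnorm_rscale gtr0_norm// mulrC.
rewrite ler_wpM2r ?(ltW zp)//; apply: H.
by rewrite rnorm_rscale gtr0_norm ?invr_gt0// mulVf.
Qed.

(** Multilinearity in v is not visible in the expression; it is inherited from [iterD l phi], of
    which [dF] is the derivative along a line. *)
Let dF_multilinear l y z : Ut y -> (forall y, Ut y -> forall v, iterD l phi y v = F y v) ->
  multilinear (@dF l y z).
Proof.
move=> Uty H i v a x1 x2.
have [b /andP[b0 b1] Ub] := Ut_segment z Uty.
have I0 : (0 : R) <= 0 <= b by rewrite lexx (ltW b0).
have D w : rderiv b (fun u => iterD l phi (y + rscale u z) w) 0 (dF y z w).
  have := eval_rderiv_point (iter l der t) (vecs w) (beL l) (ceL l) Ub I0.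
  rewrite rscale0 addr0; apply: rderiv_eq I0 _ => u ub.
  by rewrite H//; exact: Ub.
apply: (rderiv_uniq b0 I0 (D _)).
have := rderiv_lin a (D (dfwith v i x1)) (D (dfwith v i x2)).
apply: rderiv_eq I0 _ => u ub.
by have [fl _] := mlinP (iterD l phi (y + rscale u z)); rewrite -fl.
Qed.

(** Induction on the order: once [iterD k phi] is given by an expression, [dF] is linear in the
    direction and bounded multilinear in v, so it defines a candidate for the Frechet derivative,
    and [eval_taylor] supplies a quadratic remainder uniform in the direction. *)
Lemma iterD_eval l y : Ut y ->
  (forall v, iterD l phi y v = F y v) /\ differentiable (iterD l phi) y.
Proof.
move=> Uty.
suff step k : (forall y, Ut y -> forall v, iterD k phi y v = F y v) ->
    forall y, Ut y -> differentiable (iterD k phi) y /\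
      forall z v, 'd (iterD k phi) y z v = @dF k y z v.
  have main k : forall y, Ut y -> forall v, iterD k phi y v = F y v.
    elim: k => [|k ih] y' Uty' v.
      rewrite iterD0E phiE// /F /=; congr (eval _ _ _ _); apply/funext => n.
      by rewrite vecs_default.
    have [d dE] := step k ih y' Uty'.
    by rewrite iterDSE// dE /F vecsS.
  by split; [exact: main|have [] := step l (main l) y Uty].
move=> H {}y {}Uty.
have [M M0 HM] := dF_bound k.
have cm z : continuous_multilinear (@dF k y z).
  apply: (@multilinear_unit_bounded_continuous _ _ _ _ _ _ (M * rnorm z)).
    exact: dF_multilinear.
  by move=> v v1; exact: HM.
pose L z := to_mlin (@dF k y z).
have LE z v : L z v = dF y z v by rewrite /L to_mlinE.
have Llin : linear L.
  by move=> a z1 z2; apply: mlin_eq => v; rewrite mlinD mlinZ !LE dF_lin.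
pose Lmix := GRing.isLinear.Build K X (mlin k X X) *:%R L Llin.
pose LL : {linear X -> mlin k X X} := HB.pack L Lmix.
have LM z : rnorm (LL z) <= M * rnorm z.
  by apply: mlin_rnorm_le => v v1; rewrite [LL z v]LE; exact: HM.
have [r r0 Hr] := Ut_ball Uty.
pose T := iter k der t.
pose N := term_order (der (der T)).
have [B1 B10 H1] := bfam_ctl N (beL k).
pose B := B1 + 1; have B0 : 0 <= B by rewrite addr_ge0.
have B1B : B1 <= B by rewrite lerDl.
have le1B : 1 <= B by rewrite lerDr.
pose C := ubound tau (2 * B) (der (der T)).
have quad h : rnorm h < Num.min r 1 ->
    rnorm (iterD k phi (y + h) - iterD k phi y - LL h) <= C * rnorm h ^+ 2.
  rewrite lt_min => /andP[hr h1].
  have [h0|h0] := eqVneq (rnorm h) 0.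
    rewrite (rnorm0_eq0 h0) addr0 subrr sub0r rnormN rnorm0 expr0n /= mulr0.
    by have := LM 0; rewrite rnorm0 mulr0.
  have hp : 0 < rnorm h by rewrite lt_neqAle eq_sym h0 rnorm_ge0.
  (* With z a unit vector, a bound in the square of the real parameter b is one in the square of the
     norm of h, with a constant independent of h. *)
  pose b := rnorm h; pose z := rscale b^-1 h.
  have hE : rscale b z = h by rewrite rscaleA mulfV// rscale1.
  have z1 : rnorm z = 1 by rewrite rnorm_rscale gtr0_norm ?invr_gt0// mulVf.
  have Uyh : Ut (y + h) by exact: Hr.
  apply: mlin_rnorm_le => v v1; rewrite !mlinB !H// [LL h v]LE.
  have -> : dF y h v = rscale b (dF y z v).
    rewrite -{1}hE /rscale -[_ *: z]addr0 dF_lin//.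
    have -> : dF y 0 v = 0.
      by have := @dF_lin k y v (-1) 0 0 Uty; rewrite scaler0 addr0 scaleN1r addNr.
    by rewrite addr0.
  have bI : 0 <= b <= 1 by rewrite /b (ltW hp) (ltW h1).
  have := @eval_taylor _ _ _ _ _ _ _ tau01 rho0 oU cU UtU T (lift_env k e) env0 (vecs v) z B 0 b
    B0 (lexx _) bI (beL k) (bfam0 U) y.
  rewrite eline_zero hE; apply.
  - move=> a /andP[a0 ab]; rewrite eline_zero; split; first exact: ceL.
    apply: Hr; rewrite rnorm_rscale z1 mulr1 ger0_norm//.
    exact: le_lt_trans ab hr.
  - by rewrite z1.
  - move=> n _; rewrite /vecs; case: insubP => /= [i _ _|_]; last by rewrite rnorm0.
    exact: le_trans (v1 i) le1B.
  - by move=> a; exact: H1.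
  - by move=> a; exact: ctl0.
have r1 : 0 < Num.min r 1 by rewrite lt_min r0 ltr01.
have [d dE] := diff_of_quadratic r1 LM quad.
by split=> // z v; rewrite dE [LL z v]LE.
Qed.

End IterD.
End PointDerivatives.

(** * Weighted spaces *)

Section WeightedHelpers.
Context {R : realType} {s : scalar_kind}.
Local Notation K := (scalars R s).

(* Testing with real c covers the weight +oo, for which 0 * +oo = 0. *)
Lemma weight_le (w : \bar R) (a M : R) : (0 <= w)%E -> 0 <= a -> 0 <= M ->
  (forall c, 0 <= c -> (c%:E <= w)%E -> c * a <= M) -> (w * a%:E <= M%:E)%E.
Proof.
case: w => [w||] // w0 a0 M0 H.
  by rewrite -EFinM lee_fin; apply: H; rewrite ?lee_fin -?lee_fin.
have [->|an] := eqVneq a 0; first by rewrite mule0 lee_fin.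
have ap : 0 < a by rewrite lt_neqAle eq_sym an.
have := H ((M + 1) / a); rewrite leey divfK// => /(_ _ isT).
by rewrite divr_ge0 ?addr_ge0// => /(_ isT); rewrite gerDl ler10.
Qed.

Lemma opnorm_weighted (X Y : normedModType K) l (F : mlin l X Y) (c M : R) : 0 <= c -> 0 <= M ->
  (forall v, (forall i, rnorm (v i) <= 1) -> c * rnorm (F v) <= M) -> c * rnorm F <= M.
Proof.
move=> c0 M0 H; have [cp|cn] := ltP 0 c.
  rewrite mulrC -ler_pdivlMr//; apply: mlin_rnorm_le => v v1.
  by rewrite ler_pdivlMr// mulrC; exact: H.
have -> : c = 0 by apply/eqP; rewrite eq_le cn.
by rewrite mul0r.
Qed.

Lemma convex_segment (X : normedModType K) (U : set X) : convex_set U ->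
  forall p q (t : R), U p -> U q -> 0 <= t <= 1 -> U (p + rscale t (q - p)).
Proof.
move=> cU p q t Up Uq /andP[t0 t1].
have t0' : 0 <= ofR t :> K by rewrite -(@ofR0 R s) ofR_le.
have t1' : ofR t <= 1 :> K by rewrite -(@ofR1 R s) ofR_le.
have E : (conv (Itv01 t0' t1') (q : convex_lmodType X) (p : convex_lmodType X) : X) =
    p + rscale t (q - p).
  rewrite [LHS](_ : _ = ofR t *: q + (1 - ofR t) *: p)//; rlin.
have := cU q p (Itv01 t0' t1'); rewrite !inE -E; exact.
Qed.

End WeightedHelpers.

Section FCooRules.
Context {R : realType} {s : scalar_kind}.
Local Notation K := (scalars R s).
Variables (X Y : normedModType K) (U : set X).
Hypothesis oU : open U.

Lemma FCooZ (a : K) (phi : X -> Y) : FCoo U phi -> FCoo U (a *: phi).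
Proof. by move=> dphi; rewrite -[_ *: _]addr0; apply: FCoo_lin => //; exact: FCoo0. Qed.

Lemma FCooB (phi psi : X -> Y) : FCoo U phi -> FCoo U psi -> FCoo U (phi - psi).
Proof. by move=> dphi dpsi; rewrite addrC -scaleN1r; apply: FCoo_lin. Qed.

Lemma iterDZ (a : K) l (phi : X -> Y) x : FCoo U phi -> U x ->
  iterD l (a *: phi) x = a *: iterD l phi x.
Proof.
move=> dphi Ux; rewrite -[in LHS](addr0 (a *: phi)).
have [-> _] := iterD_lin a oU dphi (@FCoo0 _ _ X Y U) l Ux.
by rewrite iterD_cst0 addr0.
Qed.

Lemma iterDB l (phi psi : X -> Y) x : FCoo U phi -> FCoo U psi -> U x ->
  iterD l (phi - psi) x = iterD l phi x - iterD l psi x.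
Proof.
move=> dphi dpsi Ux; rewrite addrC -scaleN1r.
have [-> _] := iterD_lin (-1) oU dpsi dphi l Ux.
by rewrite scaleN1r addrC.
Qed.

Lemma iterDB_eq l (phi psi : X -> Y) x v a b : FCoo U phi -> FCoo U psi -> U x ->
  iterD l phi x v = a -> iterD l psi x v = b -> iterD l (phi - psi) x v = a - b.
Proof. by move=> dphi dpsi Ux <- <-; rewrite iterDB// mlinB. Qed.

Lemma iterDZ_eq l c (phi : X -> Y) x v a : FCoo U phi -> U x ->
  iterD l phi x v = a -> iterD l (c *: phi) x v = c *: a.
Proof. by move=> dphi Ux <-; rewrite iterDZ// mlinZ. Qed.

End FCooRules.

Section WeightedMaps.
Context {R : realType} {s : scalar_kind}.
Local Notation K := (scalars R s).
Variables (I : Type) (X : I -> completeNormedModType K).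
Variables (U Ut : forall i, domain (X i)) (tau rho : R).
Variable W : set (forall i, X i -> \bar R).
Hypothesis tau01 : 0 <= tau < 1.
Hypothesis rho0 : 0 <= rho.
Hypothesis cU : forall i p q t, dom (U i) p -> dom (U i) q -> 0 <= t <= 1 ->
  dom (U i) (p + rscale t (q - p)).
Hypothesis UtU : forall i y x, dom (Ut i) y -> rnorm (x - y) <= rho -> dom (U i) x.
Variable f1 : {f | W f}.
Hypothesis f1E : forall i x, dom (U i) x -> sval f1 i x = 1%E.

Local Notation wU := (wprod (fun i => X i) U W).
Local Notation wUt := (wprod (fun i => X i) Ut W).
Local Notation fam := (family (fun i => X i) (fun i => X i)).
Implicit Types (e : nat -> wU) (f : {f | W f}).

Let oU i : open (U i). Proof. exact: dom_open. Qed.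
Let oUt i : open (Ut i). Proof. exact: dom_open. Qed.

Lemma wprod_FCoo (phi : wU) i : FCoo (U i) (phi i).
Proof. by have [_ /(_ i)[]] := wprodP phi. Qed.

Lemma wseminorm_iterD f m (phi : wU) i x c : dom (U i) x -> 0 <= c -> (c%:E <= `|sval f i x|)%E ->
  c * rnorm (iterD m (phi i) x) <= wseminorm (f, m) phi.
Proof.
move=> Ux c0 cf; rewrite -lee_fin EFinM.
apply: le_trans (wseminorm_ub (f, m) phi).
apply: le_trans (prod_norm_ub _ _ _ Ux).
by rewrite lee_wpmul2r// lee_fin rnorm_ge0.
Qed.

Lemma wseminorm1_iterD m (phi : wU) i x : dom (U i) x ->
  rnorm (iterD m (phi i) x) <= wseminorm (f1, m) phi.
Proof.
move=> Ux; rewrite -[leLHS]mul1r; apply: wseminorm_iterD => //.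
by rewrite f1E// abse1.
Qed.

Definition admissible (phi : wU) := forall i, contractive tau (U i) rho (phi i).

Lemma admissibleP (phi : wU) : wseminorm (f1, 1%N) phi <= tau -> wseminorm (f1, 0%N) phi <= rho ->
  admissible phi.
Proof.
move=> H1 H0 i; split; first exact: wprod_FCoo.
  by move=> x Ux; exact: le_trans (wseminorm1_iterD 1 phi Ux) H1.
by move=> x Ux; rewrite -rnorm_iterD0; exact: le_trans (wseminorm1_iterD 0 phi Ux) H0.
Qed.

Definition env_at e i : nat -> X i -> X i := fun k => e k i.
Arguments env_at : clear implicits.

Lemma bfam_env e i : bounded_family (U i) (env_at e i).
Proof.
split=> [k|k m]; first exact: wprod_FCoo.
by exists (wseminorm (f1, m) (e k)) => x Ux; exact: wseminorm1_iterD.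
Qed.

(** The seminorm version of [ctl], uniform in i: f yields the bound at y, the weight 1 the bound on
    all of [U i]. *)
Definition wctl (N : nat) (B : R) f e := forall k m, (k < N)%N -> (m < N)%N ->
  wseminorm (f, m) (e k) <= B /\ wseminorm (f1, m) (e k) <= B.

Lemma wctl_ctl N B f e i y c : wctl N B f e -> dom (U i) y -> 0 <= c -> (c%:E <= `|sval f i y|)%E ->
  ctl (U i) N B c y (env_at e i).
Proof.
move=> H Uy c0 cf k m kN mN; have [H1 H2] := H k m kN mN; split=> [x Ux|].
  by apply: le_trans H2; exact: wseminorm1_iterD.
by apply: le_trans H1; exact: wseminorm_iterD.
Qed.

Lemma wctl_le N B B' f e : B <= B' -> wctl N B f e -> wctl N B' f e.
Proof. by move=> BB H k m kN mN; have [H1 H2] := H k m kN mN; split; exact: le_trans BB. Qed.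

Lemma wctl_ex N f e : exists2 B, 0 <= B & wctl N B f e.
Proof.
have [|k|B B0 HB] := @fin_uniform R N (fun k B => forall m : 'I_N,
    wseminorm (f, m : nat) (e k) <= B /\ wseminorm (f1, m : nat) (e k) <= B).
- by move=> k C C' CC H m; have [H1 H2] := H m; split; exact: le_trans CC.
- have [|m|B B0 HB] := @fin_uniform R N (fun m B =>
    wseminorm (f, m : nat) (e k) <= B /\ wseminorm (f1, m : nat) (e k) <= B).
  + by move=> m C C' CC [H1 H2]; split; exact: le_trans CC.
  + exists (wseminorm (f, m : nat) (e k) + wseminorm (f1, m : nat) (e k)).
    by rewrite lerDl lerDr !wseminorm_ge0.
  + by exists B.
by exists B => // k m kN mN; exact: (HB (Ordinal kN) (Ordinal mN)).
Qed.

(** The value 0 outside [Ut i] is the one that elements of the weighted product must take. *)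
Definition term_family t e : fam := fun i y =>
  if `[<dom (Ut i) y>] then eval (U i) (env_at e i) (fun=> 0) y t else 0.

Arguments term_family : clear implicits.

Lemma term_familyE t e i y : dom (Ut i) y ->
  term_family t e i y = eval (U i) (env_at e i) (fun=> 0) y t.
Proof. by move=> Uty; rewrite /term_family; case: asboolP. Qed.

Lemma iterD_term t e l i y v : admissible (e 0) -> dom (Ut i) y ->
  iterD l (term_family t e i) y v =
  eval (U i) (lift_env l (env_at e i)) (vecs v) y (iter l der t).
Proof.
move=> ae Uty.
have [] := iterD_eval tau01 rho0 (oU i) (oUt i) (@cU i) (@UtU i) (bfam_env e i)
  (ae i) (phi := term_family t e i) (t := t) _ l Uty; last by move=> + _; exact.
by move=> z; exact: term_familyE.
Qed.

Lemma term_FCoo t e i : admissible (e 0) -> FCoo (Ut i) (term_family t e i).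
Proof.
move=> ae; apply/FCooP => l x Utx.
have [] := iterD_eval tau01 rho0 (oU i) (oUt i) (@cU i) (@UtU i) (bfam_env e i)
  (ae i) (phi := term_family t e i) (t := t) _ l Utx; last by [].
by move=> z; exact: term_familyE.
Qed.

Lemma vctl_vecs (V : completeNormedModType K) N B l (v : 'I_l -> V) : 1 <= B ->
  (forall i, rnorm (v i) <= 1) -> vctl N B (vecs v).
Proof.
move=> B1 v1 n _; rewrite /vecs; case: insubP => /= [i _ _|_]; first exact: le_trans (v1 i) B1.
by rewrite rnorm0 (le_trans ler01).
Qed.

Lemma decaying_iter l t : decaying t -> decaying (iter l der t).
Proof. by move=> dt; elim: l => //= l ih; exact: decaying_der. Qed.

(** Replaces the possibly infinite weight by the reals c below it and the operator norm by values on
    unit vectors, the form in which expressions are bounded. *)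
Lemma prod_norm_bound (g : forall i, X i -> \bar R) l (phi : fam) M : 0 <= M ->
  (forall i y c v, dom (Ut i) y -> 0 <= c -> (c%:E <= `|g i y|)%E -> (forall j, rnorm (v j) <= 1) ->
    c * rnorm (iterD l (phi i) y v) <= M) ->
  (prod_norm Ut g l phi <= M%:E)%E.
Proof.
move=> M0 H; apply: prod_norm_le => i y Uty; apply: weight_le => //; first exact: rnorm_ge0.
by move=> c c0 cg; apply: opnorm_weighted => // v v1; exact: H.
Qed.

Lemma term_weighted t e : decaying t -> admissible (e 0) -> weighted_family Ut W (term_family t e).
Proof.
move=> dt ae.
have H g l : W g -> (prod_norm Ut g l (term_family t e) < +oo)%E.
  move=> Wg; pose T := iter l der t; pose N := term_order T.
  have [B0 B00 HB0] := wctl_ex N (exist _ g Wg) e.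
  pose B := B0 + 1; have Bp : 0 <= B by rewrite addr_ge0.
  have HB : wctl N B (exist _ g Wg) e by apply: wctl_le HB0; rewrite lerDl.
  apply: le_lt_trans (ltry (decay_cst tau B * ubound tau B T)).
  apply: prod_norm_bound => [|i y c v Uty c0 cf v1].
    rewrite mulr_ge0 ?ubound_ge0// addr_ge0// divr_ge0// subr_ge0 ltW//.
    by case/andP: tau01.
  have Uy : dom (U i) y by exact: (Ut_sub rho0 (@UtU i)).
  have ce : contractive tau (U i) rho (lift_env l (env_at e i) 0) by rewrite lift_env0; exact: ae.
  have be : bounded_family (U i) (lift_env l (env_at e i)) by exact/bfam_lift/bfam_env.
  have He : ctl (U i) N B c y (lift_env l (env_at e i)).
    by apply: ctl_lift => //; exact: wctl_ctl HB Uy c0 cf.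
  have Hv : vctl N B (vecs v) by apply: vctl_vecs v1; rewrite lerDr.
  have [_] := eval_bound tau01 rho0 (@cU i) (@UtU i) Bp c0 ce be Uty He Hv.
  by rewrite (iterD_term t v ae Uty); apply; exact: decaying_iter.
split=> [i y Uty|i|g l Wg]; last exact: H.
  by rewrite /term_family; case: asboolP.
split; first exact: term_FCoo.
move=> _ l [g Wg <-]; exact: le_lt_trans (weight_le_prod _ _ _ _ _) (H g l Wg).
Qed.

(* Junk value 0 unless the family of values is weighted. *)
Definition term_map t e : wUt := insubd (0 : wUt) (term_family t e).

Lemma term_mapE t e : decaying t -> admissible (e 0) -> term_map t e = term_family t e :> fam.
Proof.
move=> dt ae; rewrite /term_map val_insubd ifT//; apply/asboolP.
exact: term_weighted.
Qed.

Definition weline e e' (a : R) : nat -> wU := fun k => (ofR a : K) *: e' k + e k.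

Lemma env_weline e e' a i : env_at (weline e e' a) i = eline (env_at e i) (env_at e' i) a.
Proof. by []. Qed.

Lemma env_mix e e' i : env_at (mix e e') i = mix (env_at e i) (env_at e' i).
Proof. by apply: functional_extensionality_dep => k; rewrite /env_at /mix; case: ifP. Qed.

(** Convexity: e + a e' is the combination of e + b e' and e with weights a / b and 1 - a / b, so
    the end points of a segment control all of it. *)
Lemma admissible_weline e e' b a : 0 < b -> admissible (e 0) -> admissible (weline e e' b 0) ->
  0 <= a <= b -> admissible (weline e e' a 0).
Proof.
move=> b0 ae ab /andP[a0 leab] i.
have [d1 c1 r1] := ae i; have [d2 c2 r2] := ab i.
pose th := a / b; have th0 : 0 <= th by rewrite divr_ge0// ltW.
have th1 : 0 <= 1 - th by rewrite subr_ge0 ler_pdivrMr// mul1r.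
have E (V : lmodType K) (x y : V) : ofR a *: x + y =
    rscale th (ofR b *: x + y) + rscale (1 - th) y.
  have ab' : a = th * b by rewrite /th divfK// gt_eqF.
  by rewrite {1}ab'; rlin.
have conv (V : normedModType K) (x y : V) M : rnorm (ofR b *: x + y) <= M -> rnorm y <= M ->
    rnorm (ofR a *: x + y) <= M.
  move=> H1 H2; rewrite E (le_trans (rnormD _ _))// !rnorm_rscale !ger0_norm//.
  rewrite (le_trans (lerD (ler_wpM2l th0 H1) (ler_wpM2l th1 H2)))//.
  by rewrite -mulrDl addrC subrK mul1r.
have be := bfam_env e i; have be' := bfam_env e' i.
split; first exact: wprod_FCoo.
  move=> x Ux; have := c2 x Ux.
  rewrite -[weline e e' a 0 i]/(eline (env_at e i) (env_at e' i) a 0).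
  rewrite -[weline e e' b 0 i]/(eline (env_at e i) (env_at e' i) b 0).
  rewrite !(iterD_eline (oU i) _ _ _ be be' Ux) => H; apply: conv H _; exact: c1.
by move=> x Ux; apply: (conv _ (e' 0 i x) (e 0 i x)); [exact: r2|exact: r1].
Qed.

Section Estimates.
Variables (t : term) (dt : decaying t) (f : {f | W f}) (l : nat).
Let T := iter l der t.

Let tau1 : 0 <= 1 - tau. Proof. by rewrite subr_ge0 ltW//; case/andP: tau01. Qed.

Let cst_ge0 B t' : 0 <= B -> 0 <= decay_cst tau B * ubound tau B t'.
Proof.
by move=> B0; rewrite mulr_ge0 ?ubound_ge0// addr_ge0// divr_ge0.
Qed.

Let seg_line e e' b i y : 0 < b -> admissible (e 0) -> admissible (weline e e' b 0) ->
  dom (Ut i) y ->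
  admissible_line tau rho (U i) (Ut i) (lift_env l (env_at e i)) (lift_env l (env_at e' i)) y 0 b.
Proof.
move=> b0 ae ab Uty a aI; rewrite rscaler0 addr0; split=> //.
by rewrite eline_lift lift_env0; exact: (admissible_weline b0 ae ab aI i).
Qed.

Lemma term_map_lip B : 0 <= B -> exists2 C : R, 0 <= C & forall e e' b, 0 < b <= 1 ->
  admissible (e 0) -> admissible (weline e e' b 0) ->
  wctl (term_order (der T)) B f e -> wctl (term_order (der T)) B f e' ->
  wseminorm (f, l) (term_map t (weline e e' b) - term_map t e) <= C * b.
Proof.
(* The 1 makes [B'] a bound also for the unit vectors at which the derivative of order l is
   evaluated. *)
move=> B0; pose B' := B + 1; have B'0 : 0 <= B' by rewrite addr_ge0.
have BB' : B <= B' by rewrite lerDl.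
have C0 : 0 <= decay_cst tau (2 * B') * ubound tau (2 * B') (der T).
  by apply: cst_ge0; exact: mulr_ge0.
exists (decay_cst tau (2 * B') * ubound tau (2 * B') (der T)) => //.
move=> e e' b /andP[b0 b1] ae ab He He'.
apply: wseminorm_le; first by rewrite mulr_ge0// ltW.
apply: (@prod_norm_bound (sval f) l) => [|i y c v Uty c0 cf v1].
  by rewrite mulr_ge0// ltW.
have -> : (term_map t (weline e e' b) - term_map t e) i =
    term_family t (weline e e' b) i - term_family t e i.
  by rewrite -(term_mapE dt ab) -(term_mapE dt ae).
rewrite (iterDB_eq (oUt i) (term_FCoo t i ab) (term_FCoo t i ae) Uty
  (iterD_term t v ab Uty) (iterD_term t v ae Uty)) env_weline -eline_lift.
have Uy : dom (U i) y by exact: (Ut_sub rho0 (@UtU i)).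
have H w : wctl (term_order (der T)) B f w ->
    ctl (U i) (term_order (der T)) B' c y (lift_env l (env_at w i)).
  by move=> Hw; apply: ctl_lift => //; exact: wctl_ctl (wctl_le BB' Hw) Uy c0 cf.
have b01 : 0 <= b <= 1 by rewrite ltW.
apply: (eval_lip_weighted tau01 rho0 (oU i) (@cU i) (@UtU i) B'0 c0 b01
  (bfam_lift l (bfam_env e i)) (bfam_lift l (bfam_env e' i)) (decaying_iter l dt) Uty).
- exact: seg_line.
- by apply: vctl_vecs v1; rewrite lerDr.
- exact: H.
- exact: H.
Qed.

Lemma term_map_taylor B : 0 <= B -> exists2 C : R, 0 <= C & forall e e' b, 0 < b <= 1 ->
  admissible (e 0) -> admissible (weline e e' b 0) ->
  wctl (term_order (der (der T))) B f e -> wctl (term_order (der (der T))) B f e' ->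
  wseminorm (f, l) (term_map t (weline e e' b) - term_map t e -
    rscale b (term_map (der t) (mix e e'))) <= C * b ^+ 2.
Proof.
move=> B0; pose B' := B + 1; have B'0 : 0 <= B' by rewrite addr_ge0.
have BB' : B <= B' by rewrite lerDl.
have C0 : 0 <= decay_cst tau (2 * B') * ubound tau (2 * B') (der (der T)).
  by apply: cst_ge0; exact: mulr_ge0.
exists (decay_cst tau (2 * B') * ubound tau (2 * B') (der (der T))) => //.
move=> e e' b /andP[b0 b1] ae ab He He'.
have dt' := decaying_der dt; have ae' : admissible (mix e e' 0) by [].
apply: wseminorm_le; first by rewrite mulr_ge0// sqr_ge0.
apply: (@prod_norm_bound (sval f) l) => [|i y c v Uty c0 cf v1].
  by rewrite mulr_ge0// sqr_ge0.
have -> : (term_map t (weline e e' b) - term_map t e - rscale b (term_map (der t) (mix e e'))) i =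
    term_family t (weline e e' b) i - term_family t e i
    - (ofR b : K) *: term_family (der t) (mix e e') i.
  by rewrite -(term_mapE dt ab) -(term_mapE dt ae) -(term_mapE dt' ae').
rewrite (iterDB_eq (oUt i) (FCooB (oUt i) (term_FCoo t i ab) (term_FCoo t i ae))
  (FCooZ (oUt i) (ofR b) (term_FCoo (der t) i ae')) Uty
  (iterDB_eq (oUt i) (term_FCoo t i ab) (term_FCoo t i ae) Uty
    (iterD_term t v ab Uty) (iterD_term t v ae Uty))
  (iterDZ_eq (oUt i) (ofR b) (term_FCoo (der t) i ae') Uty (iterD_term (der t) v ae' Uty))).
rewrite env_weline env_mix -eline_lift.
have Uy : dom (U i) y by exact: (Ut_sub rho0 (@UtU i)).
have H w : wctl (term_order (der (der T))) B f w ->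
    ctl (U i) (term_order (der (der T))) B' c y (lift_env l (env_at w i)).
  by move=> Hw; apply: ctl_lift => //; exact: wctl_ctl (wctl_le BB' Hw) Uy c0 cf.
have b01 : 0 <= b <= 1 by rewrite ltW.
(* The derivative term comes from differentiating in the maps and then l times in y, whereas the
   Taylor estimate for [iter l der t] has the derivative in the maps last. *)
rewrite -(eval_exchange tau01 rho0 (oU i) (oUt i) (@cU i) (@UtU i) t b0
  (bfam_env e i) (bfam_env e' i) Uty); first last.
- by move=> n; exact: vecs_default.
- by move=> a aI; exact: (admissible_weline b0 ae ab aI i).
apply: (eval_taylor_weighted tau01 rho0 (oU i) (@cU i) (@UtU i) B'0 c0 b01
  (bfam_lift l (bfam_env e i)) (bfam_lift l (bfam_env e' i)) (decaying_iter l dt) Uty).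
- exact: seg_line.
- by apply: vctl_vecs v1; rewrite lerDr.
- exact: H.
- exact: H.
Qed.

End Estimates.

(** Lets a scalar of modulus 1, absorbed into the direction to reduce to real segments, be taken out
    again. *)
Lemma term_map_derZ t e e' (a : K) : decaying t -> admissible (e 0) ->
  term_map (der t) (mix e (fun k => a *: e' k)) = a *: term_map (der t) (mix e e').
Proof.
move=> dt ae; have dt' := decaying_der dt.
apply/val_inj; change (term_map (der t) (mix e (fun k => a *: e' k)) =
  a *: (term_map (der t) (mix e e') : fam) :> fam).
have a1 : admissible (mix e (fun k => a *: e' k) 0) by exact: ae.
have a2 : admissible (mix e e' 0) by exact: ae.
apply: (etrans (term_mapE dt' a1)); rewrite (term_mapE dt' a2).
apply: functional_extensionality_dep => i; apply/funext => y.
change (term_family (der t) (mix e (fun k => a *: e' k)) i y =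
  a *: term_family (der t) (mix e e') i y).
rewrite /term_family; case: asboolP => [Uty|_]; last by rewrite scaler0.
have be := bfam_env e i; have be' := bfam_env e' i; have b0 := bfam0 (U i).
have L c z1 := eval_der_lin tau01 rho0 (oU i) (@cU i) (@UtU i) t (fun=> 0) z1 0 c
  (ae i) be be' b0 Uty.
have S0 : scons 0 (fun=> 0) = (fun=> 0 : X i) by apply/funext => -[].
rewrite !env_mix -S0.
have := L a 0; rewrite scaler0 addr0.
have -> : (fun k => a *: env_at e' i k + 0) = env_at (fun k => a *: e' k) i.
  by apply: functional_extensionality_dep => k; rewrite addr0.
move=> ->; rewrite [X in _ + X](_ : _ = 0) ?addr0//.
have := eval_der_lin tau01 rho0 (oU i) (@cU i) (@UtU i) t (fun=> 0) 0 0 (-1) (ae i) be b0 b0 Uty.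
by rewrite !scaler0 !addr0 scaleN1r addNr.
Qed.

End WeightedMaps.

(** * Continuity and differentiability between the weighted spaces *)

Section WprodTopology.
Context {R : realType} {s : scalar_kind}.
Local Notation K := (scalars R s).
Variables (I : Type) (X : I -> normedModType K) (U : forall i, domain (X i)).
Variable W : set (forall i, X i -> \bar R).
Local Notation wU := (wprod X U W).

Lemma wprod_near (x : wU) j (e : R) : 0 < e -> nbhs x [set y : wU | wseminorm j (y - x) < e].
Proof.
move=> e0; apply: (semi_nbhs1 (@wseminormD _ _ _ _ _ _ _)).
by rewrite subrr (semi0 (@wseminormZ _ _ _ _ _ _ _) (@wseminorm_ge0 _ _ _ _ _ _ _)).
Qed.

Lemma wprod_cvg (T : Type) (F : set_system T) (g : T -> wU) (x : wU) : Filter F ->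
  (forall j e, 0 < e -> F [set t | wseminorm j (g t - x) < e]) -> g @ F --> x.
Proof.
move=> FF H A [G [e e0 GA]]; have FgF : Filter (g @ F) by exact: fmap_filter.
apply: (@filterS _ (g @ F) _ _ _ GA).
by apply: semi_filter_ball => j; exact: H.
Qed.

End WprodTopology.

Section Smoothness.
Context {R : realType} {s : scalar_kind}.
Local Notation K := (scalars R s).
Variables (I : Type) (X : I -> completeNormedModType K).
Variables (U Ut : forall i, domain (X i)) (tau rho : R).
Variable W : set (forall i, X i -> \bar R).
Hypothesis tau01 : 0 <= tau < 1.
Hypothesis rho0 : 0 <= rho.
Hypothesis cU : forall i p q t, dom (U i) p -> dom (U i) q -> 0 <= t <= 1 ->
  dom (U i) (p + rscale t (q - p)).
Hypothesis UtU : forall i y x, dom (Ut i) y -> rnorm (x - y) <= rho -> dom (U i) x.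
Variable f1 : {f | W f}.
Hypothesis f1E : forall i x, dom (U i) x -> sval f1 i x = 1%E.

Local Notation wU := (wprod (fun i => X i) U W).
Local Notation wUt := (wprod (fun i => X i) Ut W).
Local Notation admis := (admissible tau rho).

(** Write a k x' = a k x + c e' k with a small c fixed beforehand. If finitely many seminorms of a k
    x' - a k x are below c, then those of e' k are at most 1, and [term_map_lip] bounds the change
    by C c < e. *)
Lemma term_map_continuous t (E : topologicalType) (A : set E) (a : nat -> E -> wU) :
  decaying t -> (forall k, continuous (a k)) -> (forall x, A x -> admis (a 0 x)) ->
  {within A, continuous (fun x => term_map Ut t (a^~ x))}.
Proof.
move=> dt ac aA; apply/subspace_continuousP => x Ax.
apply: wprod_cvg => -[f l] e e0.
pose N := term_order (der (iter l der t)).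
have [B0 B00 HB0] := wctl_ex f1 N f (a^~ x).
pose B := B0 + 1; have Bp : 0 <= B by rewrite addr_ge0.
have HB : wctl f1 N B f (a^~ x) by apply: wctl_le HB0; rewrite lerDl.
have [C C0 HC] := term_map_lip tau01 rho0 cU UtU f1E dt f l Bp.
pose c := Num.min 1 (e / (C + 1)).
have C1 : 0 < C + 1 by rewrite ltr_wpDl.
have c0 : 0 < c by rewrite lt_min ltr01 divr_gt0.
have c1 : c <= 1 by rewrite ge_min lexx.
have Cc : C * c < e.
  rewrite (@lt_le_trans _ _ ((C + 1) * c))//; first by rewrite ltr_pM2r// ltrDl.
  by rewrite -ler_pdivlMl// mulrC ge_min lexx orbT.
have near_j k j : nbhs x [set x' | wseminorm j (a k x' - a k x) < c].
  have H3 := ac k x _ (wprod_near (a k x) j c0).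
  rewrite nbhs_simpl in H3; exact: H3.
have : nbhs x [set x' | forall k m : 'I_N,
    wseminorm (f, m : nat) (a k x' - a k x) < c /\ wseminorm (f1, m : nat) (a k x' - a k x) < c].
  apply: filter_forall => k; apply: filter_forall => m.
  exact: filterI (near_j k (f, m : nat)) (near_j k (f1, m : nat)).
apply: filterS => x' Hx' Ax' /=.
pose e' k : wU := ofR c^-1 *: (a k x' - a k x).
have W' : weline (a^~ x) e' c = a^~ x'.
  apply: functional_extensionality_dep => k.
  by rewrite /weline /e' -!/(rscale _ _) rscaleA divff ?gt_eqF// rscale1 subrK.
have He' : wctl f1 N B f e'.
  move=> k m kN mN; have [H1 H2] := Hx' (Ordinal kN) (Ordinal mN).
  have le1 j : wseminorm j (a k x' - a k x) < c -> wseminorm j (e' k) <= B.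
    move=> H; rewrite (le_trans (wseminormZ _ _ _))// rnorm_ofR ?invr_ge0 ?(ltW c0)//.
    rewrite (@le_trans _ _ 1)//; last by rewrite lerDr.
    by rewrite mulrC ler_pdivrMr// mul1r ltW.
  by split; apply: le1.
have c01 : 0 < c <= 1 by rewrite c0.
have aW : admis (weline (a^~ x) e' c 0) by rewrite W'; exact: aA.
have := HC (a^~ x) e' c c01 (aA x Ax) aW HB He'.
by rewrite W' => /le_lt_trans; apply.
Qed.

(** For rho = r / 2 * (1 - tau) this says that - phi lies in D. *)
Definition adm_interior (phi : wU) :=
  wseminorm (f1, 1%N) phi < tau /\ wseminorm (f1, 0%N) phi < rho.

Lemma adm_interior_admissible phi : adm_interior phi -> admis phi.
Proof. by move=> [H1 H0]; apply: (admissibleP f1E); exact: ltW. Qed.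

Lemma adm_interior_line (phi psi : wU) : adm_interior phi ->
  exists2 d : R, 0 < d & forall t : K, rnorm t < d -> adm_interior (t *: psi + phi).
Proof.
move=> [H1 H0].
have H j b : wseminorm j phi < b -> exists2 d : R, 0 < d &
    forall t : K, rnorm t < d -> wseminorm j (t *: psi + phi) < b.
  move=> jb; pose q := wseminorm j psi + 1.
  have q0 : 0 < q by rewrite ltr_wpDl// wseminorm_ge0.
  exists ((b - wseminorm j phi) / q); first by rewrite divr_gt0// subr_gt0.
  move=> t; rewrite (ltr_pdivlMr _ _ q0) ltrBrDr => tq; apply: le_lt_trans tq.
  rewrite (le_trans (wseminormD _ _ _))// lerD2r (le_trans (wseminormZ _ _ _))//.
  by rewrite ler_wpM2l ?rnorm_ge0// lerDl.
have [d1 d10 Hd1] := H _ _ H1; have [d0 d00 Hd0] := H _ _ H0.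
exists (Num.min d1 d0); first by rewrite lt_min d10.
by move=> t; rewrite lt_min => /andP[t1 t0]; split; [exact: Hd1|exact: Hd0].
Qed.

Lemma term_map_derivative t (E : lmodType K) (a : nat -> E -> wU) x h :
  decaying t -> (forall k, linear (a k)) -> adm_interior (a 0 x) ->
  (fun u : K => u^-1 *: (term_map Ut t (a^~ (x + u *: h)) - term_map Ut t (a^~ x))) @ 0^'
    --> term_map Ut (der t) (mix (a^~ x) (a^~ h)).
Proof.
move=> dt al ax; apply: wprod_cvg => -[f l] e e0.
have [d d0 Hd] := adm_interior_line (a 0 h) ax.
pose N := term_order (der (der (iter l der t))).
have [B1 B10 HB1] := wctl_ex f1 N f (a^~ x).
have [B2 B20 HB2] := wctl_ex f1 N f (a^~ h).
pose B := B1 + B2; have Bp : 0 <= B by rewrite addr_ge0.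
have {}HB1 : wctl f1 N B f (a^~ x) by apply: wctl_le HB1; rewrite lerDl.
have {}HB2 : wctl f1 N B f (a^~ h) by apply: wctl_le HB2; rewrite lerDr.
have [C C0 HC] := term_map_taylor tau01 rho0 cU UtU f1E dt f l Bp.
have C1 : 0 < C + 1 by rewrite ltr_wpDl.
suff : nbhs (0 : K^o) [set u | u != 0 -> wseminorm (f, l)
    (u^-1 *: (term_map Ut t (a^~ (x + u *: h)) - term_map Ut t (a^~ x)) -
     term_map Ut (der t) (mix (a^~ x) (a^~ h))) < e] by [].
apply/(@nbhs_rnormP R s K^o).
exists (Num.min (Num.min 1 d) (e / (C + 1))).
  by rewrite !lt_min ltr01 d0 divr_gt0.
move=> u; rewrite subr0 !lt_min => /andP[/andP[u1 ud] ue] un.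
pose b := rnorm u.
have b0 : 0 < b.
  rewrite lt_neqAle rnorm_ge0 andbT eq_sym.
  by apply: contra_neq un => /(@rnorm0_eq0 R s K^o).
have b01 : 0 < b <= 1 by rewrite b0 ltW.
(* The increment u is b w with b = |u| and |w| = 1. Moving w into the direction makes the Taylor
   estimate on the real segment [0, b] applicable for every scalar u. *)
pose w : K := u / ofR b.
have bn : ofR b != 0 :> K by rewrite -ofR0 (inj_eq (can_inj ofRK)) gt_eqF.
have wb : ofR b * w = u by rewrite mulrC divfK.
have w1 : rnorm w = 1.
  apply: (mulfI (_ : b != 0)); first by rewrite gt_eqF.
  rewrite mulr1 -[in LHS](@rnorm_ofR R s b) ?(ltW b0)//.
  by rewrite -(@rnormZ R s K^o) /GRing.scale/= wb.
pose e' k : wU := w *: a k h.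
have W' : weline (a^~ x) e' b = a^~ (x + u *: h).
  apply: functional_extensionality_dep => k.
  by rewrite /weline /e' scalerA wb addrC [x + _]addrC al addrC.
have He' : wctl f1 N B f e'.
  move=> k m kN mN; have [H1 H2] := HB2 k m kN mN.
  by split; rewrite (le_trans (wseminormZ _ _ _))// w1 mul1r.
have a0x := adm_interior_admissible ax.
have aW : admis (weline (a^~ x) e' b 0).
  rewrite W' /= [x + _]addrC al; exact: adm_interior_admissible (Hd u ud).
have := HC (a^~ x) e' b b01 a0x aW HB1 He'.
rewrite W' (term_map_derZ tau01 rho0 cU UtU f1E _ _ dt a0x).
set P := term_map Ut t _; set Q := term_map Ut t _; set S := term_map Ut (der t) _ => H.
have -> : u^-1 *: (P - Q) - S = u^-1 *: (P - Q - rscale b (w *: S)).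
  by rewrite /rscale [ofR b *: _]scalerA wb [RHS]scalerBr [u^-1 *: (u *: S)]scalerA mulVf// scale1r.
rewrite (le_lt_trans (wseminormZ _ _ _))//.
have uV : rnorm (u^-1) = b^-1.
  apply: (mulfI (_ : b != 0)); first by rewrite gt_eqF.
  rewrite divff ?gt_eqF// /b -(@rnormZ R s K^o) /GRing.scale/= mulfV//.
  by rewrite -(@ofR1 R s) rnorm_ofR.
rewrite uV (@le_lt_trans _ _ (b^-1 * (C * b ^+ 2)))//.
  by rewrite ler_wpM2l ?invr_ge0 ?(ltW b0).
have -> : b^-1 * (C * b ^+ 2) = C * b by field; rewrite gt_eqF.
rewrite (@le_lt_trans _ _ ((C + 1) * b))//; first by rewrite ler_wpM2r ?(ltW b0)// lerDl.
by rewrite -ltr_pdivlMl// mulrC.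
Qed.

(** The domain E and the parametrisation a are general because the derivative lives on E * E, where
    its environment interleaves those of the two components. This environment is again linear and
    continuous in the pair, and its entry 0 depends only on the base point. *)
Lemma term_map_diffC l t (E : tvsType K) (A : set E) (a : nat -> E -> wU) :
  decaying t -> (forall k, linear (a k)) -> (forall k, continuous (a k)) ->
  (forall x, A x -> adm_interior (a 0 x)) ->
  @diffC K l E wUt A (fun x => term_map Ut t (a^~ x)).
Proof.
elim: l t E A a => [|l ih] t E A a dt al ac aA.
  apply: term_map_continuous => // x /aA; exact: adm_interior_admissible.
pose a' n (p : E * E) : wU := mix (a^~ p.1) (a^~ p.2) n.
have a'c n : continuous (a' n).
  move=> p; rewrite /a' /mix; case: (odd n).
    apply: (@continuous_comp _ _ _ (snd : E * E -> E) (a n./2)); [exact: cvg_snd|exact: ac].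
  apply: (@continuous_comp _ _ _ (fst : E * E -> E) (a n./2)); [exact: cvg_fst|exact: ac].
have a'A p : (A `*` setT) p -> adm_interior (a' 0%N p) by move=> [/aA].
exists (fun p => term_map Ut (der t) (a'^~ p)); split.
- by move=> x h Ax; apply: term_map_derivative => //; exact: aA.
- apply: term_map_continuous => //; first exact: decaying_der.
  by move=> p /a'A; exact: adm_interior_admissible.
- apply: ih => //; first exact: decaying_der.
  by move=> n c p q; rewrite /a' /mix; case: (odd n); exact: al.
Qed.

End Smoothness.

(** * The set D and the inverse maps *)

Section WprodNorm.
Context {R : realType} {s : scalar_kind}.
Local Notation K := (scalars R s).
Variables (I : Type) (X : I -> normedModType K) (U : forall i, domain (X i)).
Variable W : set (forall i, X i -> \bar R).
Local Notation wU := (wprod X U W).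

Lemma wseminormN j (phi : wU) : wseminorm j (- phi) = wseminorm j phi.
Proof.
have H psi : wseminorm j (- psi) <= wseminorm j psi.
  rewrite -scaleN1r (le_trans (wseminormZ _ _ _))//.
  by rewrite rnormN -(@ofR1 R s) rnorm_ofR// mul1r.
by apply/eqP; rewrite eq_le H -{1}[phi]opprK H.
Qed.

Lemma wprod_opp_continuous : continuous (fun phi : wU => - phi).
Proof.
move=> phi; have FF : Filter (nbhs phi) by exact: nbhs_filter.
apply: (@wprod_cvg _ _ _ _ _ _ _ (nbhs phi) _ _ FF) => j e e0.
rewrite (_ : [set _ | _] = [set psi : wU | wseminorm j (psi - phi) < e]).
  exact: wprod_near.
by apply/funext => psi /=; rewrite -opprD wseminormN.
Qed.

(** The index i0 makes the supremum nonnegative; over an empty family it would be -oo, and its real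
    part 0. *)
Lemma prod_norm_cst1 (i0 : I) (f1 : {f | W f}) l (phi : wU) :
  (forall i x, dom (U i) x -> sval f1 i x = 1%E) ->
  prod_norm U (fun i => cst 1%E) l phi = (wseminorm (f1, l) phi)%:E.
Proof.
move=> f1E; have [x0 Ux0] := dom_neq0 (U i0).
have -> : prod_norm U (fun i => cst 1%E) l phi = prod_norm U (sval f1) l phi.
  apply/eqP; rewrite eq_le; apply/andP; split; apply: prod_norm_le => i x Ux.
    by apply: le_trans (prod_norm_ub _ _ _ Ux); rewrite f1E.
  by apply: le_trans (prod_norm_ub _ _ _ Ux); rewrite f1E.
rewrite /wseminorm fineK// ge0_fin_numE.
  by have [_ _ H] := wprodP phi; exact: H (svalP f1).
apply: le_trans (prod_norm_ub _ _ _ Ux0).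
by rewrite mule_ge0// lee_fin rnorm_ge0.
Qed.

End WprodNorm.

Theorem proposition4p29 (R : realType) (s : scalar_kind) (I : Type)
    (X : I -> completeNormedModType (scalars R s))
    (U Ut : forall i, domain (X i)) (r tau : R)
    (W : set (forall i, X i -> \bar R)) :
  inhabited I ->
  (forall i, convex_set (U i)) ->
  0 < r ->
  (forall i x h, dom (Ut i) x -> rnorm h < r -> dom (U i) (x + h)) ->
  (forall f, W f -> forall i x, dom (U i) x -> f i x != -oo%E) ->
  (exists2 f, W f & forall i x, dom (U i) x -> f i x = 1%E) ->
  0 < tau < 1 ->
  let D := [set phi : wprod (fun i => X i) U W |
    (prod_norm U (fun i => cst 1%E) 1 phi < tau%:E)%E /\
    (prod_norm U (fun i => cst 1%E) 0 phi < (r / 2 * (1 - tau))%:E)%E] in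
  (forall phi, D phi -> forall i,
    set_inj (U i) (phi i \+ id) /\ Ut i `<=` (phi i \+ id) @` U i) /\
  exists2 inv : wprod (fun i => X i) U W -> wprod (fun i => X i) Ut W,
    (forall phi, D phi -> forall i x, dom (Ut i) x ->
       inv phi i x = 'pinv_(fun=> 0) (U i) (phi i \+ id) x - x) &
    smooth D inv.
Proof.
move=> [i0] cU r0 UtU _ [f Wf fE] /andP[t0 t1] D.
pose f1 : {f | W f} := exist _ f Wf; pose rho := r / 2 * (1 - tau).
have f1E i x : dom (U i) x -> sval f1 i x = 1%E by exact: fE.
have tau01 : 0 <= tau < 1 by rewrite ltW.
have rho0 : 0 <= rho by rewrite mulr_ge0 ?subr_ge0 ?ltW// divr_gt0.
(* Hence the closed ball of radius rho around a point of [Ut i], on which the contraction acts, lies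
   in [U i]. *)
have rhor : rho < r.
  rewrite (@le_lt_trans _ _ (r / 2))//.
    by rewrite ler_piMr ?gerBl ?(ltW t0) ?(ltW (half_gt0 r0)).
  by rewrite gtr_pMr// invf_lt1// ltr1n.
have cU' i := convex_segment (cU i).
have UtU' i y x : dom (Ut i) y -> rnorm (x - y) <= rho -> dom (U i) x.
  move=> Uty xy; rewrite -(subrK y x) addrC; apply: UtU => //.
  exact: le_lt_trans rhor.
have DE phi : D phi <-> adm_interior tau rho f1 (- phi).
  by rewrite /adm_interior !wseminormN /D /= !(prod_norm_cst1 i0 _ _ f1E) !lte_fin.
have contr phi : D phi -> admissible tau rho (- phi).
  by move=> /DE; exact: adm_interior_admissible.
(* If x and y have the same image, then chi x - chi y = x - y for chi = - phi, while chi is a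
   contraction with factor tau < 1. *)
have inj phi i : D phi -> set_inj (U i) (phi i \+ id).
  move=> /contr/(_ i) c x y /set_mem Ux /set_mem Uy /= E.
  apply/eqP; rewrite -subr_eq0; apply/eqP/(absorb_eq0 tau01).
  have := contractive_lipschitz (@cU' i) c Ux Uy; apply: le_trans.
  have -> : (- phi) i x - (- phi) i y = x - y; last by [].
  change (- phi i x - - phi i y = x - y); rewrite opprK.
  by apply: (addrI (phi i x)); rewrite addrA subrr add0r addrA E addrK.
have sigE phi i y : D phi -> dom (Ut i) y ->
    dom (U i) (sigma (U i) ((- phi) i) y) /\
    (phi i \+ id) (sigma (U i) ((- phi) i) y) = y.
  move=> /contr/(_ i) c Uty.
  have [Us sE] := sigmaP tau01 rho0 (@cU' i) (@UtU' i) c Uty; split=> //.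
  by rewrite /= {2}sE addrCA -[(- phi) i _]/(- phi i _) subrr addr0.
split=> [phi Dphi i|].
  split; first exact: inj.
  by move=> y Uty; have [Us sE] := sigE phi i y Dphi Uty; exists (sigma (U i) ((- phi) i) y).
(* With m = 0 and k = 0 this is chi (sigma y) = sigma y - y, the inverse minus the identity. *)
pose psi := Comp 0 (fun _ : 'I_0 => Vec 0).
exists (fun phi => term_map Ut psi (fun=> - phi)).
  move=> phi Dphi i x Utx; have c := contr phi Dphi.
  rewrite (term_mapE tau01 rho0 (@cU') (@UtU') f1E (t := psi) (e := fun=> - phi) isT c).
  rewrite term_familyE// /= iterD0E.
  have [Us sE] := sigE phi i x Dphi Utx.
  have -> : 'pinv_(fun=> 0) (U i) (phi i \+ id) x = sigma (U i) ((- phi) i) x.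
    by rewrite -{1}sE pinvKV ?inE//; exact: inj.
  have [_ E] := sigmaP tau01 rho0 (@cU' i) (@UtU' i) (c i) Utx.
  by rewrite [in RHS]E addrC addKr.
split.
  rewrite openE => phi Dphi; have [H1 H0] := (DE phi).1 Dphi.
  rewrite !wseminormN in H1 H0.
  have near_lt j b : wseminorm j phi < b ->
      nbhs phi [set p : wprod (fun i => X i) U W | wseminorm j p < b].
    move=> jb; have d0 : 0 < b - wseminorm j phi by rewrite subr_gt0.
    apply: filterS (wprod_near phi j d0) => p; rewrite /mkset ltrBrDr => pb.
    by apply: le_lt_trans pb; rewrite -{1}(subrK phi p) wseminormD.
  change (nbhs phi D).
  apply: filterS (filterI (near_lt _ _ H1) (near_lt _ _ H0)) => p [p1 p0].
  by apply/DE; rewrite /adm_interior !wseminormN.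
move=> l; apply: (term_map_diffC tau01 rho0 cU' UtU' f1E (t := psi) l
  (a := fun=> (fun phi => - phi))) => //.
- by move=> _ a u v; rewrite opprD scalerN.
- by move=> _; exact: wprod_opp_continuous.
- by move=> phi /DE.
Qed.
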